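(* Let $J(x,dy)$ and $W(x,y)$ be a jumping kernel and a weight function on $\mathbb{R}^d$ satisfying the standing assumptions in the context, and let $(P_t)_{t\ge0}$ be the semigroup on $L^2(\mathbb{R}^d;dx)$ associated with the corresponding regular Dirichlet form $(\mathcal E,\mathcal F)$. Suppose that the following two conditions hold. (i) $W$ is locally bounded on $\mathbb{R}^d\times\mathbb{R}^d$, and for any $\lambda>0$ there exist a strictly positive $C^1$-function $V_\lambda$ on $\mathbb{R}^d$ and a constant $R_0>0$ such that: $W(x,y)\ge V_\lambda(x)+V_\lambda(y)$ for any $x,y\in\mathbb{R}^d$ with $|x-y|<1$; $\inf_{x\in\mathbb{R}^d}V_\lambda(x)>0$; and $V_\lambda(x)=\lambda(1+|x|^2)$ for any $x\in B(0,R_0)^c$. (ii) There exists a nonnegative Borel measure $\nu(dz)$ on $B(0,1)$ such that: $J(x,x+A)\ge\nu(A)$ for any $x\in\mathbb{R}^d$ and any Borel set $A\subset B(0,1)$; $\nu(A)=\nu(-A)$ for any Borel set $A\subset B(0,1)$; and, with $$\varphi(\xi)=\int_{\{|z|<1\}}(1-\cos\langle z,\xi\rangle)\,\nu(dz),\ \ \xi\in\mathbb{R}^d,\qquad \beta_0(r)=\int_{\mathbb{R}^d}e^{-r\varphi(\xi)}\,d\xi,\ \ r>0,$$ one has $$\beta_0(r)<\infty\quad\text{and}\quad\int_r^\infty\frac{\beta_0^{-1}(s)}{s}\,ds<\infty\qquad\text{for all } r>0,$$ where $\beta_0^{-1}$ is the inverse function of $\beta_0$. Then the semigroup $(P_t)_{t\ge0}$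 is compact on $L^2(\mathbb{R}^d;dx)$.
   Context: Standing assumptions. $J(x,dy)$ is a nonnegative kernel on $\mathbb{R}^d\times\mathcal B(\mathbb{R}^d)$ such that the measure $J(dx,dy):=J(x,dy)\,dx$ is symmetric, $J(dx,dy)=J(dy,dx)$, and $\sup_{x\in\mathbb{R}^d}\int_{\mathbb{R}^d}(1\wedge|x-y|^2)\,J(x,dy)<\infty$. $W(x,y)$ is a nonnegative, locally bounded, symmetric Borel measurable function on $\mathbb{R}^d\times\mathbb{R}^d$ such that $x\mapsto\int_{\mathbb{R}^d}(1\wedge|x-y|^2)W(x,y)\,J(x,dy)$ belongs to $L^1_{\rm loc}(\mathbb{R}^d;dx)$. Dirichlet form. Set $\mathcal E(u,u)=\iint_{\mathbb{R}^d\times\mathbb{R}^d}(u(x)-u(y))^2W(x,y)\,J(x,dy)\,dx$ and $\mathcal D(\mathcal E)=\{u\in L^2(\mathbb{R}^d;dx):\mathcal E(u,u)<\infty\}$, which contains $C_c^\infty(\mathbb{R}^d)$. Set $\|f\|_{\mathcal E_1}=(\mathcal E(f,f)+\|f\|_{L^2(\mathbb{R}^d;dx)}^2)^{1/2}$ and let $\mathcal F$ be the closure of $C_c^\infty(\mathbb{R}^d)$ in $\mathcal D(\mathcal E)$ with respect to $\|\cdot\|_{\mathcal E_1}$. Then $(\mathcal E,\mathcal F)$ is a regular Dirichlet form on $L^2(\mathbb{R}^d;dx)$, and $(P_t)_{t\ge0}$ is the associated strongly continuous symmetric Markovian semigroup on $L^2(\mathbb{R}^d;dx)$. The semigroup is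 called compact if $P_t$ is a compact operator on $L^2(\mathbb{R}^d;dx)$ for every $t>0$ (equivalently, for some $t>0$). Notation: $B(0,r)=\{x\in\mathbb{R}^d:|x|<r\}$, $B(0,r)^c$ is its complement, $-A=\{x:-x\in A\}$, $x+A=\{x+z:z\in A\}$. *)

(* Defs.v *)
From HB Require Import structures.
From mathcomp Require Import all_boot all_order all_algebra.
From mathcomp Require Import all_classical all_reals all_analysis.
From mathcomp Require Import lra.

Set Implicit Arguments.
Unset Strict Implicit.
Unset Printing Implicit Defensive.
Import Order.TTheory GRing.Theory Num.Theory.
Import numFieldNormedType.Exports.

Local Open Scope classical_set_scope.
Local Open Scope ring_scope.

(* R^d is 'rV[R]_d with its Borel sigma-algebra. The library norm `|x| on row
   vectors is the sup norm; it is used only for the topology. *)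
HB.instance Definition _ (R : realType) (d : nat) :=
  Measurable.copy 'rV[R]_d (g_sigma_algebraType (@open 'rV[R]_d)).

Section lebesgue_measure_rV.
Context {R : realType}.

Lemma measurable_coord_rV n (i : 'I_n) :
  measurable_fun [set: 'rV[R]_n] (fun x => x 0 i).
Proof.
apply: (measurability _ (@measurable_realfun.RGenOpens.measurableE R)).
move=> _ [_ [a [b ->]] <-]; rewrite setTI; apply: sub_sigma_algebra.
by apply: open_comp; [move=> x _; exact: coord_continuous|exact: itv_open].
Qed.

Lemma measurable_fun_rV disp (T : measurableType disp) n (f : T -> 'rV[R]_n) :
  (forall i, measurable_fun [set: T] (fun t => f t 0 i)) ->
  measurable_fun [set: T] f.
Proof.
move=> mf; apply: (measurability (@open 'rV[R]_n)) => //.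
move=> _ [A oA <-]; rewrite setTI.
pose box (p : 'rV[rat]_n * rat) : set 'rV[R]_n :=
  [set x | forall i, x 0 i \in `]ratr (p.1 0 i) - ratr p.2,
                                  ratr (p.1 0 i) + ratr p.2[].
pose F p : set T := if `[< box p `<=` A >] then f @^-1` box p else set0.
have -> : f @^-1` A = \bigcup_p F p.
  apply/seteqP; split => [t At|t [p _]]; last first.
    by rewrite /F; case: asboolP => // pA; exact: pA.
  have /nbhs_ballP[e /= e0 Ae] : nbhs (f t) A by exact: open_nbhs_nbhs.
  have /rat_in_itvoo[q] : 0 < e / 2 by rewrite divr_gt0.
  rewrite in_itv/= => /andP[q0 qe].
  have /choice[c cP] i : exists c, ratr c \in `]f t 0 i - ratr q, f t 0 i + ratr q[.
    by apply: rat_in_itvoo; lra.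
  exists (\row_i c i, q) => //; rewrite /F; case: asboolP => [_ i|nB] /=.
    by rewrite mxE; move: (cP i); rewrite !in_itv/= => /andP[? ?]; apply/andP; lra.
  apply: nB => x /= xB; apply: Ae; split => // i j.
  rewrite (ord1 i) /ball/= ltr_norml.
  move: (xB j) (cP j); rewrite mxE !in_itv/= => /andP[? ?] /andP[? ?].
  by apply/andP; lra.
apply: countable_bigcupT_measurable => [|p]; first exact: countableP.
rewrite /F; case: asboolP => // _.
rewrite (_ : _ @^-1` _ = \bigcap_(i in [set: 'I_n])
   ((fun t => f t 0 i) @^-1` [set` `]ratr (p.1 0 i) - ratr p.2,
                                  ratr (p.1 0 i) + ratr p.2[])); last first.
  by apply/seteqP; split => t h i; [move=> _; exact: (h i)|exact: (h i I)].
apply: fin_bigcap_measurable => // i _.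
by rewrite -[X in measurable X]setTI; apply: mf.
Qed.

Definition rV_cons n (p : 'rV[R]_n * measurableTypeR R) : 'rV[R]_n.+1 :=
  row_mx (p.2)%:M p.1.

Lemma rV_cons0 n p : @rV_cons n p 0 0 = p.2.
Proof. by rewrite /rV_cons mxE; case: splitP => // j _; rewrite ord1 mxE. Qed.

Lemma rV_cons_lift n p (i : 'I_n) : rV_cons p 0 (lift 0 i) = p.1 0 i.
Proof.
rewrite /rV_cons mxE; case: splitP => [j|j /= [ij]]; first by rewrite ord1.
by congr (p.1 _ _); apply: val_inj.
Qed.

Lemma measurable_rV_cons n : measurable_fun setT (@rV_cons n).
Proof.
apply: measurable_fun_rV => i; case: (unliftP 0 i) => [j ->|->].
  under eq_fun do rewrite rV_cons_lift.
  exact: (measurableT_comp (measurable_coord_rV j) measurable_fst).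
under eq_fun do rewrite rV_cons0.
exact: measurable_snd.
Qed.

(* Lebesgue measure on R^n, by iterated products with the one-dimensional one;
   lebesgue_rV_box below gives its value on boxes. *)
Fixpoint lebesgue_rV n : set 'rV[R]_n -> \bar R :=
  match n with
  | 0 => dirac (0 : 'rV[R]_0)
  | n.+1 => pushforward (@lebesgue_rV n \x lebesgue_measure)%E (@rV_cons n)
  end.

Let lebesgue_rV_measure n :
  {m : {measure set 'rV[R]_n -> \bar R} | @lebesgue_rV n = m}.
Proof.
elim: n => [|n [m mE]]; first by exists (dirac (0 : 'rV[R]_0)).
exists (measure_function_pushforward__canonical__measure_function_Measure
  (m \x lebesgue_measure)%E (@measurable_rV_cons n)).
by rewrite /= mE.
Qed.

Let lebesgue_rV0 n : @lebesgue_rV n set0 = 0%E.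
Proof. by have [m ->] := lebesgue_rV_measure n. Qed.

Let lebesgue_rV_ge0 n A : (0 <= @lebesgue_rV n A)%E.
Proof. by have [m ->] := lebesgue_rV_measure n. Qed.

Let lebesgue_rV_sigma_additive n : semi_sigma_additive (@lebesgue_rV n).
Proof.
have [m ->] := lebesgue_rV_measure n; exact: measure_semi_sigma_additive.
Qed.

HB.instance Definition _ n := isMeasure.Build _ _ _ (@lebesgue_rV n)
  (@lebesgue_rV0 n) (@lebesgue_rV_ge0 n) (@lebesgue_rV_sigma_additive n).

Definition rV_box n (a b : 'rV[R]_n) : set 'rV[R]_n :=
  [set x | forall i, x 0 i \in `[a 0 i, b 0 i]].

Lemma measurable_rV_box n (a b : 'rV[R]_n) : measurable (rV_box a b).
Proof.
rewrite (_ : rV_box a b = \bigcap_(i in [set: 'I_n])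
   ((fun x => x 0 i) @^-1` [set` `[a 0 i, b 0 i]])); last first.
  by apply/seteqP; split => t h i; [move=> _; exact: (h i)|exact: (h i I)].
apply: fin_bigcap_measurable => // i _.
by rewrite -[X in measurable X]setTI; exact: measurable_coord_rV.
Qed.

Lemma lebesgue_rV_box n (a b : 'rV[R]_n) : (forall i, a 0 i <= b 0 i) ->
  lebesgue_rV (rV_box a b) = (\prod_(i < n) (b 0 i - a 0 i))%:E.
Proof.
elim: n => [|n ih] in a b *.
  move=> _; rewrite big_ord0 /= diracE mem_set// => -[].
  by [].
move=> ab; rewrite big_ord_recl /= /pushforward.
pose a' : 'rV[R]_n := \row_i a 0 (lift 0 i).
pose b' : 'rV[R]_n := \row_i b 0 (lift 0 i).
rewrite (_ : _ @^-1` _ = rV_box a' b' `*` [set` `[a 0 0, b 0 0]]); last first.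
  apply/seteqP; split => [[x t] /= h|[x t] /= [h1 h2] i].
    split; last by have := h 0; rewrite rV_cons0.
    by move=> i /=; have := h (lift 0 i); rewrite rV_cons_lift !mxE.
  case: (unliftP 0 i) => [j ->|->]; last by rewrite rV_cons0.
  by rewrite rV_cons_lift; have := h1 j; rewrite !mxE.
rewrite product_measure1E//; last exact: measurable_rV_box.
rewrite [X in (X * _)%E](ih a' b'); last by move=> i; rewrite !mxE.
rewrite [X in (_ * X)%E](lebesgue_measure_itv `[a 0 0, b 0 0]) /= lte_fin.
under eq_bigr do rewrite !mxE.
rewrite -EFinD; have [_|ba] := ltP (a 0 0) (b 0 0); first by rewrite -EFinM mulrC.
have -> : b 0 0 = a 0 0 by apply/eqP; rewrite eq_le ba ab.
by rewrite subrr mul0r mule0.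
Qed.

Let lebesgue_rV_sigma_finite n : sigma_finite setT (@lebesgue_rV n).
Proof.
exists (fun k => rV_box (const_mx (- k%:R)) (const_mx k%:R)).
  apply/seteqP; split => // x _.
  exists (Num.truncn `|x|).+1 => // i; rewrite !mxE in_itv/= -ler_norml.
  rewrite (@le_trans _ _ `|x|) ?(ltW (truncnS_gt _))//.
  by rewrite [leRHS]/Num.norm /= mx_normrE; apply/bigmax_geP; right => /=; exists (0, i).
move=> k; split; first exact: measurable_rV_box.
rewrite lebesgue_rV_box ?ltry// => i; rewrite !mxE.
by rewrite (@le_trans _ _ 0)// oppr_le0.
Qed.

HB.instance Definition _ n := @Measure_isSigmaFinite.Build _ _ _
  (@lebesgue_rV n) (@lebesgue_rV_sigma_finite n).

End lebesgue_measure_rV.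

Section euclidean.
Context {R : realType} {d : nat}.
Implicit Types x y : 'rV[R]_d.

Definition dotr x y : R := \sum_i x 0 i * y 0 i.

Definition enorm x : R := Num.sqrt (dotr x x).

Definition trunc_sqdist x y : R := Num.min 1 (enorm (x - y) ^+ 2).

Definition partial (i : 'I_d) (f : 'rV[R]_d -> R) : 'rV[R]_d -> R :=
  fun x => 'D_(delta_mx 0 i) f x.

Definition iter_partial (s : seq 'I_d) (f : 'rV[R]_d -> R) : 'rV[R]_d -> R :=
  foldr partial f s.

Definition class_C (k : nat) (f : 'rV[R]_d -> R) : Prop :=
  (forall (s : seq 'I_d) i x, (size s < k)%N ->
     derivable (iter_partial s f) x (delta_mx 0 i)) /\
  (forall s : seq 'I_d, (size s <= k)%N -> continuous (iter_partial s f)).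

Definition smooth_cpt_supp (f : 'rV[R]_d -> R) : Prop :=
  (forall k, class_C k f) /\ compact (closure [set x | f x != 0]).

Definition locally_bounded (W : 'rV[R]_d -> 'rV[R]_d -> R) : Prop :=
  forall p : 'rV[R]_d * 'rV[R]_d,
    bounded_near (fun q : 'rV[R]_d * 'rV[R]_d => W q.1 q.2) (nbhs p).

Definition L1_loc (f : 'rV[R]_d -> \bar R) : Prop :=
  forall K : set 'rV[R]_d, compact K -> (@lebesgue_rV R d).-integrable K f.

End euclidean.

(* Square-integrable functions, not identified when equal almost everywhere. *)
Notation L2 R d := (LfunType (@lebesgue_rV R d) (lee1n 2)).

Section jump_form.
Context {R : realType} {d : nat}.
Local Notation Rd := 'rV[R]_d.
Local Notation mu := (@lebesgue_rV R d).
Variables (J : R.-ker Rd ~> Rd) (W : Rd -> Rd -> R).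

(* J(dx,dy) = J(dy,dx) for the measure J(x,dy)dx on R^d x R^d *)
Definition symmetric_kernel : Prop :=
  forall D : set (Rd * Rd), measurable D ->
    (\int[mu]_x J x (xsection D x) = \int[mu]_x J x (ysection D x))%E.

Definition uniform_levy_bound : Prop :=
  (ereal_sup (range (fun x => \int[J x]_y (trunc_sqdist x y)%:E)) < +oo)%E.

Definition energy (u : Rd -> R) : \bar R :=
  (\int[mu]_x \int[J x]_y ((u x - u y) ^+ 2 * W x y)%:E)%E.

Definition E1_norm (u : Rd -> R) : \bar R :=
  sqrte (energy u + ('N[mu]_2%:E[EFin \o u]) ^+ 2)%E.

Definition form_maxdomain : set (L2 R d) :=
  [set u : L2 R d | (energy u < +oo)%E].

Definition form_domain : set (L2 R d) :=
  [set u : L2 R d | form_maxdomain u /\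
    forall e : R, 0 < e -> exists2 phi : Rd -> R,
      smooth_cpt_supp phi & (E1_norm (u \- phi)%R < e%:E)%E].

End jump_form.

Section semigroup.
Context {R : realType} {d : nat}.
Local Notation Rd := 'rV[R]_d.
Local Notation mu := (@lebesgue_rV R d).
Local Notation L2 := (L2 R d).
Local Notation "'N2[ u ]" := ('N[mu]_2%:E[EFin \o u%R])%E (format "''N2[' u ]").

Definition L2_inner (u v : Rd -> R) : R := \int[mu]_x (u x * v x).

(* Operators act on representatives: T induces an operator on classes by
   [sg_ae] below, and all equalities between values are almost everywhere. *)
Record symmetric_markov_semigroup (P : R -> L2 -> L2) : Prop := {
  sg_ae : forall t (u v : L2), 0 <= t ->
    u = v %[ae mu] -> P t u = P t v %[ae mu] ;
  sg_linear : forall t a (u v : L2), 0 <= t ->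
    P t (a *: u + v) = a *: P t u + P t v %[ae mu] ;
  sg_id : forall u : L2, P 0 u = u %[ae mu] ;
  sg_add : forall s t (u : L2), 0 <= s -> 0 <= t ->
    P (s + t) u = P s (P t u) %[ae mu] ;
  sg_contraction : forall t (u : L2), 0 <= t -> ('N2[P t u] <= 'N2[u])%E ;
  sg_symmetric : forall t (u v : L2), 0 <= t ->
    L2_inner (P t u) v = L2_inner u (P t v) ;
  sg_markov : forall t (u : L2), 0 <= t ->
    (\forall x \ae mu, 0 <= u x <= 1) -> \forall x \ae mu, 0 <= P t u x <= 1 ;
  sg_continuous : forall u : L2,
    'N2[P t u \- u] @[t --> 0^'+] --> 0%E }.

Definition approx_form (P : R -> L2 -> L2) (t : R) (u : L2) : R :=
  t^-1 * L2_inner (u \- P t u) u.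

(* (E, F) is the Dirichlet form of (P_t): F is the set of u for which
   t^-1 (u - P_t u, u) has a finite limit as t decreases to 0, and this limit
   is E(u, u). The off-diagonal values of E are given by polarization. *)
Definition associated_semigroup (E : (Rd -> R) -> \bar R) (F : set L2)
    (P : R -> L2 -> L2) : Prop :=
  [/\ symmetric_markov_semigroup P,
      forall u : L2, F u <-> cvg (approx_form P t u @[t --> 0^'+]) &
      forall u : L2, F u -> (approx_form P t u)%:E @[t --> 0^'+] --> E u].

Definition compact_operator (T : L2 -> L2) : Prop :=
  forall u_ : nat -> L2, (exists M : R, forall n, ('N2[u_ n] <= M%:E)%E) ->
    exists s : nat -> nat, {homo s : m n / (m < n)%N} /\
      exists v : L2, 'N2[T (u_ (s n)) \- v] @[n --> \oo] --> 0%E.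

End semigroup.

Section levy_exponent.
Context {R : realType} {d : nat}.
Variable nu : {measure set 'rV[R]_d -> \bar R}.

Definition levy_exponent (xi : 'rV[R]_d) : \bar R :=
  (\int[nu]_(z in [set z | (enorm z < 1)%R]) (1 - cos (dotr z xi))%:E)%E.

Definition beta0 (r : R) : \bar R :=
  (\int[@lebesgue_rV R d]_xi expeR (- (r%:E * levy_exponent xi)))%E.

(* inverse of the (finite-valued) function beta0 on the half-line r > 0 *)
Definition beta0_inv : R -> R :=
  'pinv_(fun=> 0) `]0, +oo[ (fun r => fine (beta0 r)).

End levy_exponent.

(* Main.v *)
Require Import Defs.
From HB Require Import structures.
From mathcomp Require Import all_boot all_order all_algebra.
From mathcomp Require Import all_classical all_reals all_analysis.
From mathcomp Require Import measurable_realfun ring lra.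

Set Implicit Arguments.
Unset Strict Implicit.
Unset Printing Implicit Defensive.
Import Order.TTheory GRing.Theory Num.Theory.
Import numFieldNormedType.Exports.

Local Open Scope classical_set_scope.
Local Open Scope ring_scope.

(** Why the semigroup is compact. Let (u_k) be bounded in L^2 and put
    v_k = P_t u_k. The function s |-> (P_s u, u) is nonincreasing and midpoint
    convex, so its slopes are monotone; this puts v_k in the domain of the form,
    with E(v_k, v_k) <= |u_k|^2 / (2 t) ([semigroup_energy]). Smooth functions of
    compact support being dense for the norm of the form, it remains to extract
    a Cauchy subsequence from test functions bounded in that norm.

    The lower bounds on J and W give, for every g >= 0 such that
    g(x) <= W(x, x + z) when |z| < 1,
      E(v, v) >= int int (v(x + z) - v(x))^2 g(x) dx nu(dz)
    ([weighted_form_le_energy]). Two choices of g are made: the positive constant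
    inf V, and lambda |x|^2 away from a ball ([form_ctrl_bounds]).

    On balls: the constant weight bounds the translation-invariant form whose
    Fourier multiplier is the symbol phi. If phi stayed bounded along points
    going to infinity, it would be bounded on infinitely many disjoint unit
    balls, because phi(xi + eta) <= 2 phi(xi) + 2 phi(eta) and phi is locally
    bounded, and e^(- phi) would not be integrable; so phi tends to infinity
    ([symbol_infty]). A bound on the form then forces small translations to move
    v little in L^2 ([translation_equicontinuous]), and therefore a truncation
    of v is determined, up to a small error, by finitely many of its Fourier
    coefficients ([cutoff_finite_rank]). Both steps use the Fourier transform
    only through a finite Plancherel identity ([finite_plancherel]): on
    functions supported in a fixed ball, a nonnegative trigonometric sum that
    concentrates at the origin acts as a Dirac mass on autocorrelations.

    At infinity: summing by parts against <x, z> gives a Hardy inequality that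
    bounds the mass of v off a ball by its mass in a larger ball, a small
    multiple of |v|^2, and a multiple of the form with weight |x|^2
    ([hardy_difference], [hardy_tail]). The last multiple is harmless since the
    energy controls lambda times that form, with lambda as large as needed.

    Altogether |v|^2 is at most eps (|v|^2 + E(v, v)) plus a combination of
    finitely many squared Fourier coefficients of a truncation of v
    ([finite_rank_control]). Applied to differences along an ultrafilter, for
    which all these bounded coefficients converge, this gives the Cauchy
    subsequence ([cauchy_subsequence]), and L^2 is complete. *)

(** * Measurability and translation invariance *)

Lemma measurable_fun_EFin {R : realType} d (T : measurableType d) (f : T -> R) :
  measurable_fun setT f -> measurable_fun setT (fun x => (f x)%:E).
Proof. by move=> mf; exact/measurable_EFinP. Qed.

Section lebesgue_rV_facts.
Context {R : realType} {n : nat}.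
Local Notation Rd := 'rV[R]_n.
Local Notation mu := (@lebesgue_rV R n).

Lemma open_measurable_rV (A : set Rd) : open A -> measurable A.
Proof. by move=> oA; exact: sub_sigma_algebra. Qed.

Lemma continuous_measurable_fun_rV (f : Rd -> R) :
  continuous f -> measurable_fun setT f.
Proof.
move=> cf; apply: (measurability _ (@measurable_realfun.RGenOpens.measurableE R)).
move=> _ [_ [a [b ->]] <-]; rewrite setTI; apply: open_measurable_rV.
by apply: open_comp => [x _|]; [exact: cf|exact: itv_open].
Qed.

Lemma measurable_fun_rVD d (T : measurableType d) (f g : T -> Rd) :
  measurable_fun setT f -> measurable_fun setT g ->
  measurable_fun setT (fun t => f t + g t).
Proof.
move=> mf mg; apply: measurable_fun_rV => i.
under eq_fun do rewrite mxE.
by apply: measurable_funD;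
  [exact: (measurableT_comp (measurable_coord_rV i) mf)
  |exact: (measurableT_comp (measurable_coord_rV i) mg)].
Qed.

Lemma measurable_fun_dotr d (T : measurableType d) (f g : T -> Rd) :
  measurable_fun setT f -> measurable_fun setT g ->
  measurable_fun setT (fun t => dotr (f t) (g t)).
Proof.
move=> mf mg; apply: measurable_sum => i.
by apply: measurable_funM;
  [exact: (measurableT_comp (measurable_coord_rV i) mf)
  |exact: (measurableT_comp (measurable_coord_rV i) mg)].
Qed.

Lemma measurable_fun_normrV d (T : measurableType d) (f : T -> Rd) :
  measurable_fun setT f -> measurable_fun setT (fun t => `|f t|).
Proof.
apply: measurableT_comp; apply: continuous_measurable_fun_rV.
exact: norm_continuous.
Qed.

End lebesgue_rV_facts.

Section translation.
Context {R : realType}.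

(** The image of Lebesgue measure under a translation gives half-open intervals
    their length, which characterizes Lebesgue measure. *)
Lemma lebesgue_integral_shift (f : R -> \bar R) (a : R) :
  measurable_fun setT f -> (forall x, 0 <= f x)%E ->
  (\int[lebesgue_measure]_x f (x + a)%R = \int[lebesgue_measure]_x f x)%E.
Proof.
move=> mf f0.
pose h : measurableTypeR R -> measurableTypeR R := fun x => x + a.
have mh : measurable_fun setT h by exact: measurable_funD.
transitivity (\int[pushforward (@lebesgue_measure R) h]_x f x)%E.
  by rewrite ge0_integral_pushforward// preimage_setT.
apply: eq_measure_integral => A mA _; apply/esym.
apply: lebesgue_measure_unique => // _ [[b c]] _ <-.
rewrite /pushforward [X in _ = lebesgue_measure X](_ : _ = `]b - a, c - a]%classic); last first.
  by apply/seteqP; split => x /=; rewrite /h !in_itv/=; lra.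
rewrite !lebesgue_measure_itv/= !lte_fin ltrD2r; case: ifP => // _.
by rewrite -!EFinB; congr EFin; lra.
Qed.

(** One coordinate at a time: Tonelli separates the first coordinate, to which
    the one-dimensional case applies, from the others. *)
Lemma ge0_integral_rV_shift n (f : 'rV[R]_n -> \bar R) (a : 'rV[R]_n) :
  measurable_fun setT f -> (forall x, 0 <= f x)%E ->
  (\int[@lebesgue_rV R n]_x f (x + a)%R = \int[@lebesgue_rV R n]_x f x)%E.
Proof.
elim: n => [|n ih] in f a *.
  by move=> mf f0; apply: eq_integral => x _; congr f; apply/rowP => -[].
move=> mf f0.
have mfa : measurable_fun setT (fun x : 'rV[R]_n.+1 => f (x + a)).
  exact: (measurableT_comp mf (measurable_fun_rVD _ _)).
have pE g : measurable_fun setT g -> (forall x, 0 <= g x)%E ->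
   (\int[@lebesgue_rV R n.+1]_x g x =
   \int[@lebesgue_rV R n]_x \int[lebesgue_measure]_t g (rV_cons (x, t)))%E.
  move=> mg g0.
  rewrite [LHS](ge0_integral_pushforward (@measurable_rV_cons R n) (@lebesgue_rV R n \x lebesgue_measure)%E)//.
  rewrite preimage_setT fubini_tonelli1//.
    exact: (measurableT_comp mg (@measurable_rV_cons R n)).
  by move=> x; exact: g0.
rewrite (pE _ mfa (fun x => f0 _)) (pE _ mf f0).
pose a' : 'rV[R]_n := \row_i a 0 (lift 0 i).
have aE x t : rV_cons (x, t) + a = rV_cons (x + a', t + a 0 0).
  apply/rowP => i; rewrite [LHS]mxE; case: (unliftP 0 i) => [j ->|->].
    by rewrite !rV_cons_lift /= !mxE.
  by rewrite !rV_cons0.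
have mft : measurable_fun setT (f \o @rV_cons R n).
  exact: (measurableT_comp mf (@measurable_rV_cons R n)).
transitivity (\int[@lebesgue_rV R n]_x
    \int[lebesgue_measure]_t f (rV_cons ((x + a')%R, t)))%E; last first.
  rewrite (ih (fun x => \int[lebesgue_measure]_t f (rV_cons (x, t)))%E)//.
    by apply: (measurable_fun_fubini_tonelli_F (f \o @rV_cons R n)) => // z; exact: f0.
  by move=> x; apply: integral_ge0 => t _; exact: f0.
apply: eq_integral => x _.
under eq_integral do rewrite aE.
apply: (@lebesgue_integral_shift (fun t => f (rV_cons (x + a', t)))) => //.
exact: (measurableT_comp mft (measurable_pair1 _)).
Qed.

End translation.

(** * Bounded functions of compact support *)

Section bounded_compact_support.
Context {R : realType} {n : nat}.
Local Notation Rd := 'rV[R]_n.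
Local Notation mu := (@lebesgue_rV R n).
Implicit Types (f g : Rd -> R) (x z : Rd).

Lemma coord_le_normrV x i : `|x 0 i| <= `|x|.
Proof.
by rewrite [leRHS]/Num.norm /= mx_normrE; apply/bigmax_geP; right => /=; exists (0, i).
Qed.

Lemma normrV_le x r : 0 <= r -> (forall i, `|x 0 i| <= r) -> `|x| <= r.
Proof.
move=> r0 xr; rewrite [leLHS]/Num.norm /= mx_normrE.
by apply/bigmax_leP; split => // -[i j] _ /=; rewrite ord1.
Qed.

Definition supball (r : R) : set Rd := [set x | `|x| <= r].

Lemma measurable_supball r : measurable (supball r).
Proof.
have -> : supball r = (fun x : Rd => `|x|) @^-1` `]-oo, r].
  by apply/seteqP; split => x /=; rewrite in_itv.
rewrite -[X in measurable X]setTI; apply: measurable_fun_normrV => //.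
Qed.

Lemma lebesgue_supball r : 0 <= r -> mu (supball r) = ((2 * r) ^+ n)%:E.
Proof.
move=> r0.
have -> : supball r = rV_box (const_mx (- r)) (const_mx r).
  apply/seteqP; split => x /= xr.
    by move=> i; rewrite !mxE in_itv/= -ler_norml (le_trans (coord_le_normrV x i)).
  apply: normrV_le => // i; rewrite ler_norml.
  by have := xr i; rewrite !mxE in_itv.
rewrite lebesgue_rV_box => [|i]; last by rewrite !mxE; lra.
under eq_bigr do rewrite !mxE opprK -mulr2n -mulr_natl.
by rewrite prodr_const card_ord.
Qed.

(** The class on which all integrals below are taken. It is stable under sums,
    products and translations and its members are integrable, so linearity,
    monotonicity and Fubini hold without further conditions. Supports are
    measured by the sup norm `|x|, for which balls are boxes of known volume. *)
Definition bcs f := [/\ measurable_fun setT f,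
  exists M : R, forall x, `|f x| <= M & exists r : R, forall x, r < `|x| -> f x = 0].

Lemma bcs_bounds f : bcs f -> exists M r : R, [/\ 0 <= M, 0 <= r,
  forall x, `|f x| <= M & forall x, r < `|x| -> f x = 0].
Proof.
case=> mf [M fM] [r fr]; exists M, `|r|; split => //.
  by rewrite (le_trans _ (fM 0)).
by move=> x rx; apply: fr; rewrite (le_lt_trans (ler_norm r)).
Qed.

Lemma bcs_integrable f : bcs f -> mu.-integrable setT (EFin \o f).
Proof.
move=> bf; have [mf _ _] := bf; have [M [r [M0 r0 fM fr]]] := bcs_bounds bf.
apply: (@le_integrable _ _ _ _ _ _ _ (fun x => (M * \1_(supball r) x)%:E)) => //.
- exact: (measurable_fun_EFin mf).
- move=> x _ /=; rewrite lee_fin [leRHS]ger0_norm ?mulr_ge0// indicE.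
  have [_|] := boolP (x \in supball r); first by rewrite mulr1.
  by rewrite notin_setE /= => /negP; rewrite -ltNge => /fr ->; rewrite normr0 mulr0.
- apply/integrableP; split.
    apply: measurable_fun_EFin; apply: measurable_funM => //.
    exact: measurable_indic (measurable_supball r).
  under eq_integral do rewrite gee0_abs ?lee_fin ?mulr_ge0// EFinM.
  rewrite ge0_integralZl//; last first.
    by apply: measurable_fun_EFin; exact: measurable_indic (measurable_supball r).
  rewrite integral_indic//; last exact: measurable_supball.
  by rewrite setIT [X in (_ * X)%E](lebesgue_supball r0) ltry.
Qed.

Lemma bcs0 : bcs (cst 0).
Proof. by split => //; exists 0 => // x; rewrite normr0. Qed.

Lemma bcsD f g : bcs f -> bcs g -> bcs (fun x => f x + g x).
Proof.
move=> bf bg; have [mf _ _] := bf; have [mg _ _] := bg.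
have [M [r [M0 r0 fM fr]]] := bcs_bounds bf.
have [N [s [N0 s0 gN gs]]] := bcs_bounds bg.
split; first exact: measurable_funD.
  by exists (M + N) => x; rewrite (le_trans (ler_normD _ _))// lerD.
by exists (r + s) => x rsx; rewrite fr ?gs ?addr0//; lra.
Qed.

Lemma bcsM f g : bcs f -> measurable_fun setT g ->
  (forall r, exists N : R, forall x, `|x| <= r -> `|g x| <= N) ->
  bcs (fun x => f x * g x).
Proof.
move=> bf mg gN; have [mf _ _] := bf.
have [M [r [M0 r0 fM fr]]] := bcs_bounds bf.
split; first exact: measurable_funM.
  have [N {}gN] := gN r; exists (M * `|N|) => x; rewrite normrM.
  have [xr|/fr ->] := leP `|x| r; last by rewrite normr0 mul0r mulr_ge0.
  by apply: ler_pM => //; rewrite (le_trans (gN _ xr))// ler_norm.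
by exists r => x /fr ->; rewrite mul0r.
Qed.

Lemma bcsM_bounded f g M : bcs f -> measurable_fun setT g ->
  (forall x, `|g x| <= M) -> bcs (fun x => f x * g x).
Proof. by move=> bf mg gM; apply: bcsM => // r; exists M. Qed.

Lemma bcsZ c f : bcs f -> bcs (fun x => c * f x).
Proof.
move=> bf; under eq_fun do rewrite mulrC.
by apply: (bcsM_bounded (M := `|c|)).
Qed.

Lemma bcsN f : bcs f -> bcs (fun x => - f x).
Proof. by move=> /(bcsZ (-1)); under eq_fun do rewrite mulN1r. Qed.

Lemma bcsB f g : bcs f -> bcs g -> bcs (fun x => f x - g x).
Proof. by move=> bf bg; apply: bcsD => //; exact: bcsN. Qed.

Lemma bcsMM f g : bcs f -> bcs g -> bcs (fun x => f x * g x).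
Proof. by move=> bf [mg [M gM] _]; exact: (bcsM_bounded (M := M)). Qed.

Lemma bcs_sqr f : bcs f -> bcs (fun x => f x ^+ 2).
Proof. by move=> bf; under eq_fun do rewrite expr2; exact: bcsMM. Qed.

Lemma bcs_shift f z : bcs f -> bcs (fun x => f (x + z)).
Proof.
move=> bf; have [mf [M fM] [r fr]] := bf; split.
- exact: (measurableT_comp mf (measurable_fun_rVD _ _)).
- by exists M => x.
- exists (r + `|z|) => x xr; apply: fr.
  have := ler_normB (x + z) z; rewrite addrK; lra.
Qed.

Lemma bcs_sum (I : Type) (s : seq I) (F : I -> Rd -> R) :
  (forall i, bcs (F i)) -> bcs (fun x => \sum_(i <- s) F i x).
Proof.
move=> bF; elim: s => [|i s ih].
  by under eq_fun do rewrite big_nil; exact: bcs0.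
by under eq_fun do rewrite big_cons; exact: bcsD.
Qed.

Lemma bcs_indic r : bcs (\1_(supball r) : Rd -> R).
Proof.
split.
- exact: measurable_indic (measurable_supball r).
- by exists 1 => x; rewrite ger0_norm.
- by exists r => x rx; rewrite indicE memNset//; apply/negP; rewrite -ltNge.
Qed.

Lemma IntD f g : bcs f -> bcs g ->
  \int[mu]_x (f x + g x) = \int[mu]_x f x + \int[mu]_x g x.
Proof. by move=> /bcs_integrable ? /bcs_integrable ?; exact: RintegralD. Qed.

Lemma IntB f g : bcs f -> bcs g ->
  \int[mu]_x (f x - g x) = \int[mu]_x f x - \int[mu]_x g x.
Proof. by move=> /bcs_integrable ? /bcs_integrable ?; exact: RintegralB. Qed.

Lemma IntZ c f : bcs f -> \int[mu]_x (c * f x) = c * \int[mu]_x f x.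
Proof. by move=> /bcs_integrable ?; exact: RintegralZl. Qed.

Lemma Int_le f g : bcs f -> bcs g -> (forall x, f x <= g x) ->
  \int[mu]_x f x <= \int[mu]_x g x.
Proof.
by move=> /bcs_integrable ? /bcs_integrable ? fg; apply: le_Rintegral => // x _.
Qed.

Lemma Int_ge0 f : (forall x, 0 <= f x) -> 0 <= \int[mu]_x f x.
Proof. by move=> f0; apply: Rintegral_ge0. Qed.

Lemma EFin_Int f : bcs f -> (\int[mu]_x f x)%:E = (\int[mu]_x (f x)%:E)%E.
Proof. by move=> /bcs_integrable/integrable_fin_num fi; rewrite fineK// fi. Qed.

Lemma Int_sum (I : Type) (s : seq I) (F : I -> Rd -> R) :
  (forall i, bcs (F i)) ->
  \int[mu]_x (\sum_(i <- s) F i x) = \sum_(i <- s) \int[mu]_x F i x.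
Proof.
move=> bF; elim: s => [|i s ih].
  rewrite big_nil; under eq_Rintegral do rewrite big_nil.
  by rewrite Rintegral_cst// mul0r.
rewrite big_cons -ih -IntD//; last exact: bcs_sum.
by apply: eq_Rintegral => x _; rewrite big_cons.
Qed.

(** Translation invariance is known for nonnegative functions; the positive and
    negative parts reduce the general case to it. *)
Lemma Int_shift f z : bcs f -> \int[mu]_x f (x + z) = \int[mu]_x f x.
Proof.
move=> bf; have [mf [M fM] [r fr]] := bf.
have shift_ge0 g : bcs g -> (forall x, 0 <= g x) ->
    \int[mu]_x g (x + z) = \int[mu]_x g x.
  move=> [mg _ _] g0; rewrite /Rintegral.
  rewrite (@ge0_integral_rV_shift R n (EFin \o g) z)//.
  exact: measurable_fun_EFin.
have bp : bcs (fun x => Num.max (f x) 0).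
  split; first exact: measurable_maxr.
    exists M => x; have := fM x; rewrite !ler_norml => /andP[? ?].
    by apply/andP; case: (leP (f x) 0); lra.
  by exists r => x /fr ->; rewrite maxxx.
have bn : bcs (fun x => Num.max (- f x) 0).
  split; first by apply: measurable_maxr => //; exact: measurable_funN.
    exists M => x; have := fM x; rewrite !ler_norml => /andP[? ?].
    by apply/andP; case: (leP (- f x) 0); lra.
  by exists r => x /fr ->; rewrite oppr0 maxxx.
have fE x : f x = Num.max (f x) 0 - Num.max (- f x) 0.
  by case: (leP (f x) 0); case: (leP (- f x) 0); lra.
transitivity (\int[mu]_x (Num.max (f (x + z)) 0 - Num.max (- f (x + z)) 0)).
  by apply: eq_Rintegral => x _; exact: fE.
transitivity (\int[mu]_x (Num.max (f x) 0 - Num.max (- f x) 0)); last first.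
  by apply: eq_Rintegral => x _; rewrite -fE.
rewrite (IntB (bcs_shift z bp) (bcs_shift z bn)) (IntB bp bn).
congr (_ - _).
  by apply: (shift_ge0 _ bp) => x; rewrite le_max lexx orbT.
by apply: (shift_ge0 _ bn) => x; rewrite le_max lexx orbT.
Qed.

Definition bcs2 (F : Rd * Rd -> R) := [/\ measurable_fun setT F,
  exists M : R, forall p, `|F p| <= M &
  exists r : R, forall p, r < `|p.1| \/ r < `|p.2| -> F p = 0].

Lemma bcs2_swap F : bcs2 F -> bcs2 (fun p => F (p.2, p.1)).
Proof.
case=> mF [M FM] [r Fr]; split.
- by apply: (measurableT_comp mF); exact: measurable_swap.
- by exists M => p.
- by exists r => -[x y] /= [h|h]; apply: Fr; [right|left].
Qed.

Lemma bcs2_sec F x : bcs2 F -> bcs (fun y => F (x, y)).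
Proof.
case=> mF [M FM] [r Fr]; split.
- exact: (measurableT_comp mF (measurable_pair1 x)).
- by exists M => y.
- by exists r => y ry; apply: Fr; right.
Qed.

Lemma bcs2_sec2 F y : bcs2 F -> bcs (fun x => F (x, y)).
Proof. by move=> /bcs2_swap/(bcs2_sec y). Qed.

(** Each section in y is dominated by M on a ball of radius r, and vanishes for x
    off the same ball; the iterated integral is at most M vol^2. *)
Lemma bcs2_integrable F : bcs2 F ->
  (mu \x mu)%E.-integrable setT (EFin \o F).
Proof.
case=> mF [M FM] [r Fr].
have M0 : 0 <= M by rewrite (le_trans _ (FM (0, 0))).
have r0 : 0 <= `|r| by [].
pose G (x : Rd) := M * \1_(supball `|r|) x.
have bG : bcs G by apply: bcsZ; exact: bcs_indic.
have G0 x : 0 <= G x by rewrite mulr_ge0.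
apply/integrable12ltyP; first exact: measurable_fun_EFin.
apply: (@le_lt_trans _ _ (\int[mu]_x (G x * (2 * `|r|) ^+ n)%:E)%E); last first.
  rewrite -EFin_Int ?ltry//.
  under eq_fun do rewrite mulrC.
  exact: bcsZ.
apply: ge0_le_integral => //.
- by move=> x _; apply: integral_ge0.
- apply: (measurable_fun_fubini_tonelli_F (fun p => `|(F p)%:E|%E)) => //.
  by apply: measurable_fun_EFin; exact: measurableT_comp.
- apply: measurable_fun_EFin; apply: measurable_funM => //.
  by case: bG.
move=> x _; have [xr|rx] := leP `|x| `|r|; last first.
  rewrite (_ : G x = 0).
    rewrite mul0r le_eqVlt; apply/orP; left; apply/eqP.
    under eq_integral => y _.
      rewrite /= Fr; last by left => /=; rewrite (le_lt_trans (ler_norm r)).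
      rewrite normr0; over.
    by rewrite integral0.
  by rewrite /G indicE memNset ?mulr0//; apply/negP; rewrite -ltNge.
rewrite (_ : G x = M); last by rewrite /G indicE mem_set ?mulr1.
apply: (@le_trans _ _ (\int[mu]_y (G y)%:E)%E).
  apply: ge0_le_integral => //.
  - apply: measurable_fun_EFin; apply: measurableT_comp => //.
    exact: (measurableT_comp mF (measurable_pair1 x)).
  - by apply: measurable_fun_EFin; case: bG.
  - move=> y _; rewrite lee_fin /G.
    have [yr|ry] := leP `|y| `|r|; first by rewrite indicE mem_set// mulr1.
    rewrite Fr ?normr0 ?mulr_ge0//; right => /=.
    by rewrite (le_lt_trans (ler_norm r)).
rewrite -EFin_Int// /G IntZ; last exact: bcs_indic.
rewrite lee_fin.
rewrite /Rintegral integral_indic//; last exact: measurable_supball.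
by rewrite setIT [X in fine X](lebesgue_supball r0).
Qed.

Lemma bcs2_Int F : bcs2 F -> bcs (fun x => \int[mu]_y F (x, y)).
Proof.
move=> bF; have [mF [M FM] [r Fr]] := bF.
have M0 : 0 <= M by rewrite (le_trans _ (FM (0, 0))).
split.
- apply: (measurableT_comp (@fine_measurable R setT measurableT)).
  exact: (measurable_fubini_F (bcs2_integrable bF)).
- exists (\int[mu]_y (M * \1_(supball `|r|) y)) => x.
  have bG : bcs (fun y => M * \1_(supball `|r|) y) by apply: bcsZ; exact: bcs_indic.
  have FG y : `|F (x, y)| <= M * \1_(supball `|r|) y.
    have [yr|ry] := leP `|y| `|r|; first by rewrite indicE mem_set// mulr1.
    rewrite Fr ?normr0 ?mulr_ge0//; right => /=.
    by rewrite (le_lt_trans (ler_norm r)).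
  have bF1 := bcs2_sec x bF.
  rewrite ler_norml -mulN1r -IntZ//; apply/andP; split; apply: Int_le => //.
  + exact: bcsZ.
  + by move=> y; have := FG y; rewrite ler_norml; lra.
  + by move=> y; have := FG y; rewrite ler_norml; lra.
- exists r => x rx.
  transitivity (\int[mu]_(y in setT) (0 : R)).
    by apply: eq_Rintegral => y _; rewrite Fr//; left.
  by rewrite Rintegral_cst// mul0r.
Qed.

Lemma Int_Fubini F : bcs2 F ->
  \int[mu]_x (\int[mu]_y F (x, y)) = \int[mu]_y (\int[mu]_x F (x, y)).
Proof.
move=> bF; apply: EFin_inj.
rewrite (EFin_Int (bcs2_Int bF)) (EFin_Int (bcs2_Int (bcs2_swap bF))).
under eq_integral => x _ do rewrite (EFin_Int (bcs2_sec x bF)).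
under [RHS]eq_integral => y _ do rewrite (EFin_Int (bcs2_sec2 y bF)).
exact: (Fubini (bcs2_integrable bF)).
Qed.

End bounded_compact_support.

(** * Fourier coefficients and translations *)

Section finite_parseval.
Context {R : realType} {n : nat}.
Local Notation Rd := 'rV[R]_n.
Local Notation mu := (@lebesgue_rV R n).
Implicit Types (v : Rd -> R) (x z u xi : Rd).

(** With v^ the Fourier transform of v, [fcos v xi] and [fsin v xi] are the real
    and imaginary parts of v^(xi) up to sign, and [pspec v xi] is |v^(xi)|^2. A
    pair in [trig s] is a coefficient and a frequency. *)
Definition l2sq v : R := \int[mu]_x (v x) ^+ 2.
Definition fdiff z v : Rd -> R := fun x => v (x + z) - v x.
Definition autocorr v u : R := \int[mu]_x (v x * v (x + u)).
Definition fcos v xi : R := \int[mu]_x (v x * cos (dotr xi x)).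
Definition fsin v xi : R := \int[mu]_x (v x * sin (dotr xi x)).
Definition pspec v xi : R := fcos v xi ^+ 2 + fsin v xi ^+ 2.
Definition trig (s : seq (R * Rd)) u : R := \sum_(p <- s) p.1 * cos (dotr p.2 u).

Lemma dotrDr xi x z : dotr xi (x + z) = dotr xi x + dotr xi z.
Proof.
by rewrite /dotr -big_split; apply: eq_bigr => i _; rewrite mxE mulrDr.
Qed.

Lemma dotrNr xi x : dotr xi (- x) = - dotr xi x.
Proof.
by rewrite /dotr -sumrN; apply: eq_bigr => i _; rewrite mxE mulrN.
Qed.

Lemma dotrC x z : dotr x z = dotr z x.
Proof. by rewrite /dotr; apply: eq_bigr => i _; rewrite mulrC. Qed.

Lemma dotr_le x z : `|dotr x z| <= n%:R * (`|x| * `|z|).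
Proof.
rewrite (le_trans (ler_norm_sum _ _ _))//.
apply: (@le_trans _ _ (\sum_(i < n) `|x| * `|z|)).
  by apply: ler_sum => i _; rewrite normrM ler_pM// coord_le_normrV.
by rewrite sumr_const card_ord mulr_natl.
Qed.

Lemma measurable_cos_dotr xi : measurable_fun setT (fun x => cos (dotr xi x)).
Proof.
have mcos : measurable_fun setT (@cos R).
  by apply: continuous_measurable_fun => x; exact: continuous_cos.
exact: (measurableT_comp mcos (measurable_fun_dotr _ _)).
Qed.

Lemma measurable_sin_dotr xi : measurable_fun setT (fun x => sin (dotr xi x)).
Proof.
have msin : measurable_fun setT (@sin R).
  by apply: continuous_measurable_fun => x; exact: continuous_sin.
exact: (measurableT_comp msin (measurable_fun_dotr _ _)).
Qed.

Lemma bcs_cos v xi : bcs v -> bcs (fun x => v x * cos (dotr xi x)).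
Proof.
move=> bv; apply: (bcsM_bounded (M := 1)) => //; first exact: measurable_cos_dotr.
by move=> x; exact: cos_max.
Qed.

Lemma bcs_sin v xi : bcs v -> bcs (fun x => v x * sin (dotr xi x)).
Proof.
move=> bv; apply: (bcsM_bounded (M := 1)) => //; first exact: measurable_sin_dotr.
by move=> x; exact: sin_max.
Qed.

Lemma bcs_fdiff v z : bcs v -> bcs (fdiff z v).
Proof. by move=> bv; apply: bcsB => //; exact: bcs_shift. Qed.

Lemma l2sq_ge0 v : 0 <= l2sq v.
Proof. by apply: Int_ge0 => x; exact: sqr_ge0. Qed.

Lemma bcs_autocorr_integrand v u : bcs v -> bcs (fun x => v x * v (x + u)).
Proof. by move=> bv; apply: bcsMM => //; exact: bcs_shift. Qed.

(** Expand the square of v(x + u) - v(x): both squares have the same integral. *)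
Lemma autocorrE v u : bcs v -> autocorr v u = l2sq v - 2^-1 * l2sq (fdiff u v).
Proof.
move=> bv.
have b1 := bcs_sqr bv; have b2 := bcs_shift u b1.
have b3 := bcs_autocorr_integrand u bv.
have -> : l2sq (fdiff u v) =
    \int[mu]_x ((v (x + u)) ^+ 2 + v x ^+ 2 - 2 * (v x * v (x + u))).
  by apply: eq_Rintegral => x _; rewrite /fdiff; ring.
rewrite IntB ?IntD ?IntZ//; [|exact: bcsD|exact: bcsZ].
rewrite (Int_shift u b1) /l2sq /autocorr; lra.
Qed.

Lemma fcos_shift v xi z : bcs v -> fcos (fun x => v (x + z)) xi =
  cos (dotr xi z) * fcos v xi + sin (dotr xi z) * fsin v xi.
Proof.
move=> bv; have bc := bcs_cos xi bv; have bs := bcs_sin xi bv.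
rewrite -(IntZ _ bc) -(IntZ _ bs) -IntD; [|exact: bcsZ|exact: bcsZ].
have bg : bcs (fun x => cos (dotr xi z) * (v x * cos (dotr xi x)) +
               sin (dotr xi z) * (v x * sin (dotr xi x))).
  by apply: bcsD; exact: bcsZ.
rewrite -(Int_shift z bg); apply: eq_Rintegral => x _.
have -> : cos (dotr xi x) = cos (dotr xi (x + z) - dotr xi z).
  by rewrite dotrDr addrK.
by rewrite cosB; ring.
Qed.

Lemma fsin_shift v xi z : bcs v -> fsin (fun x => v (x + z)) xi =
  cos (dotr xi z) * fsin v xi - sin (dotr xi z) * fcos v xi.
Proof.
move=> bv; have bc := bcs_cos xi bv; have bs := bcs_sin xi bv.
rewrite -(IntZ _ bc) -(IntZ _ bs) -IntB; [|exact: bcsZ|exact: bcsZ].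
have bg : bcs (fun x => cos (dotr xi z) * (v x * sin (dotr xi x)) -
               sin (dotr xi z) * (v x * cos (dotr xi x))).
  by apply: bcsB; exact: bcsZ.
rewrite -(Int_shift z bg); apply: eq_Rintegral => x _.
have -> : sin (dotr xi x) = sin (dotr xi (x + z) - dotr xi z).
  by rewrite dotrDr addrK.
by rewrite sinB; ring.
Qed.

(** A translation by z multiplies v^(xi) by a unit complex number of argument
    <xi, z>, and |e^(i a) - 1|^2 = 2 (1 - cos a). *)
Lemma pspec_fdiff v xi z : bcs v ->
  pspec (fdiff z v) xi = 2 * (1 - cos (dotr xi z)) * pspec v xi.
Proof.
move=> bv; have bvz := bcs_shift z bv.
have cE : fcos (fdiff z v) xi = fcos (fun x => v (x + z)) xi - fcos v xi.
  rewrite -IntB; [|exact: bcs_cos|exact: bcs_cos].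
  by apply: eq_Rintegral => x _; rewrite mulrBl.
have sE : fsin (fdiff z v) xi = fsin (fun x => v (x + z)) xi - fsin v xi.
  rewrite -IntB; [|exact: bcs_sin|exact: bcs_sin].
  by apply: eq_Rintegral => x _; rewrite mulrBl.
rewrite /pspec cE sE fcos_shift// fsin_shift//.
have := cos2Dsin2 (dotr xi z).
move: (cos _) (sin _) (fcos v xi) (fsin v xi) => c s a b cs.
have -> : (c * a + s * b - a) ^+ 2 + (c * b - s * a - b) ^+ 2 =
  (c ^+ 2 + s ^+ 2 - 2 * c + 1) * (a ^+ 2 + b ^+ 2) by ring.
by rewrite cs; ring.
Qed.

Lemma measurable_trig s : measurable_fun setT (trig s).
Proof.
rewrite /trig; apply: measurable_sum => p.
by apply: measurable_funM => //; exact: measurable_cos_dotr.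
Qed.

Lemma trig_bounded s : exists M : R, forall u, `|trig s u| <= M.
Proof.
exists (\sum_(p <- s) `|p.1|) => u; rewrite (le_trans (ler_norm_sum _ _ _))//.
by apply: ler_sum => p _; rewrite normrM ler_piMr// cos_max.
Qed.

Lemma bcs_trig s r : bcs (fun u => trig s u * \1_(supball r) u).
Proof.
under eq_fun do rewrite mulrC.
have [M sM] := trig_bounded s.
by apply: (bcsM_bounded (M := M)) => //; [exact: bcs_indic|exact: measurable_trig].
Qed.

Lemma bcs2_corr v s r : bcs v ->
  bcs2 (fun p : Rd * Rd => v p.1 * v (p.1 + p.2) * (trig s p.2 * \1_(supball r) p.2)).
Proof.
move=> bv; have [mv _ _] := bv; have [M [a [M0 a0 vM va]]] := bcs_bounds bv.
have bs := bcs_trig s r; have [ms _ _] := bs.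
have [N [b [N0 b0 sN sb]]] := bcs_bounds bs.
split.
- apply: measurable_funM.
    apply: measurable_funM; first exact: (measurableT_comp mv measurable_fst).
    apply: (measurableT_comp mv); apply: measurable_fun_rVD.
      exact: measurable_fst.
    exact: measurable_snd.
  exact: (measurableT_comp ms measurable_snd).
- exists (M * M * N) => p; rewrite normrM ler_pM//.
  by rewrite normrM ler_pM.
- exists (a + b) => p [h|h].
    by rewrite va ?mul0r//; lra.
  by rewrite (sb p.2) ?mulr0//; lra.
Qed.

(** Both sides are the double integral of v(x) v(y) trig(y - x): on the left
    the sum is taken outside, the addition formula separating x and y; on the
    right one integrates along y - x = u, and the indicator is harmless because
    two points of the support are at distance at most L. *)
Lemma sum_pspecE v s L : bcs v ->
  (forall x y, v x != 0 -> v y != 0 -> `|y - x| <= L) ->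
  \sum_(p <- s) p.1 * pspec v p.2 =
  \int[mu]_u (trig s u * \1_(supball L) u * autocorr v u).
Proof.
move=> bv vL.
have psE xi : pspec v xi =
    \int[mu]_x (v x * \int[mu]_u (v (x + u) * cos (dotr xi u))).
  have bc := bcs_cos xi bv; have bs := bcs_sin xi bv.
  have -> : pspec v xi = \int[mu]_x (fcos v xi * (v x * cos (dotr xi x)) +
                                     fsin v xi * (v x * sin (dotr xi x))).
    by rewrite IntD ?IntZ//; [exact: bcsZ|exact: bcsZ].
  apply: eq_Rintegral => x _.
  have -> : \int[mu]_u (v (x + u) * cos (dotr xi u)) = fcos (fun u => v (u + x)) xi.
    by apply: eq_Rintegral => u _; rewrite addrC.
  by rewrite fcos_shift//; ring.
have bin xi x : bcs (fun u => v (x + u) * cos (dotr xi u)).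
  by apply: bcs_cos; under eq_fun do rewrite addrC; exact: bcs_shift.
have binx (p : R * Rd) : bcs (fun x => v x * \int[mu]_u (v (x + u) * cos (dotr p.2 u))).
  have -> : (fun x => v x * \int[mu]_u (v (x + u) * cos (dotr p.2 u))) =
      (fun x => fcos v p.2 * (v x * cos (dotr p.2 x)) +
                fsin v p.2 * (v x * sin (dotr p.2 x))).
    apply/funext => x.
    have -> : \int[mu]_u (v (x + u) * cos (dotr p.2 u)) = fcos (fun u => v (u + x)) p.2.
      by apply: eq_Rintegral => u _; rewrite addrC.
    by rewrite fcos_shift//; ring.
  by apply: bcsD; apply: bcsZ; [exact: bcs_cos|exact: bcs_sin].
have bF := bcs2_corr s L bv.
transitivity (\int[mu]_x \int[mu]_u (v x * v (x + u) * (trig s u * \1_(supball L) u))); last first.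
  rewrite (Int_Fubini bF) /=; apply: eq_Rintegral => u _.
  rewrite -IntZ; last exact: bcs_autocorr_integrand.
  by apply: eq_Rintegral => x _; rewrite mulrC.
under eq_bigr do rewrite psE -IntZ//.
rewrite -Int_sum; last by move=> p; exact: bcsZ.
apply: eq_Rintegral => x _.
transitivity (\sum_(p <- s) \int[mu]_u (p.1 * v x * (v (x + u) * cos (dotr p.2 u)))).
  by apply: eq_bigr => p _; rewrite IntZ// mulrA.
rewrite -Int_sum; last by move=> p; exact: bcsZ.
apply: eq_Rintegral => u _.
have -> : \sum_(p <- s) p.1 * v x * (v (x + u) * cos (dotr p.2 u)) =
          v x * v (x + u) * trig s u.
  by rewrite /trig mulr_sumr; apply: eq_bigr => p _; ring.
rewrite mulrA; have [->|vx] := eqVneq (v x) 0; first by rewrite !mul0r.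
have [->|vxu] := eqVneq (v (x + u)) 0; first by rewrite mulr0 !mul0r.
have := vL _ _ vx vxu; rewrite addrC addKr => uL.
by rewrite indicE mem_set// mulr1.
Qed.

End finite_parseval.

(** * A Plancherel identity with finitely many frequencies *)

Section trig_kernel.
Context {R : realType} {n : nat}.
Local Notation Rd := 'rV[R]_n.
Local Notation mu := (@lebesgue_rV R n).
Implicit Types (v : Rd -> R) (x z u xi : Rd) (s : seq (R * Rd)).

Definition coef_ge0 s := {in s, forall p, 0 <= p.1}.

(** 2 cos a cos b = cos (a + b) + cos (a - b) keeps the coefficients
    nonnegative. *)
Lemma trig_mul s s' : coef_ge0 s -> coef_ge0 s' ->
  exists2 s'', coef_ge0 s'' & forall u, trig s'' u = trig s u * trig s' u.
Proof.
move=> s0 s'0.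
exists ([seq (p.1 * q.1 / 2, p.2 + q.2) | p <- s, q <- s'] ++
        [seq (p.1 * q.1 / 2, p.2 - q.2) | p <- s, q <- s']).
  move=> r; rewrite mem_cat => /orP[] /allpairsP[[p q] /= [ps qs ->]] /=;
    by apply: divr_ge0 => //; apply: mulr_ge0; [exact: s0|exact: s'0].
move=> u; rewrite /trig big_cat /= !big_allpairs_dep /= -big_split /=.
rewrite mulr_suml; apply: eq_bigr => p _.
rewrite -big_split /= mulr_sumr; apply: eq_bigr => q _.
rewrite !(dotrC _ u) !dotrDr dotrNr cosD cosB.
move: (cos _) (sin _) (cos _) (sin _) => a b c e.
by field.
Qed.

Lemma trig_exp s N : coef_ge0 s ->
  exists2 s', coef_ge0 s' & forall u, trig s' u = trig s u ^+ N.
Proof.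
move=> s0; elim: N => [|N [s' s'0 s'E]].
  exists [:: (1, 0)] => [p|u]; first by rewrite inE => /eqP ->.
  by rewrite /trig big_seq1 /= dotrC /dotr big1 ?cos0 ?mulr1// => i _; rewrite mxE mulr0.
have [s'' s''0 s''E] := trig_mul s0 s'0.
by exists s'' => // u; rewrite s''E s'E exprS.
Qed.

Lemma trig_scale s c : 0 <= c -> coef_ge0 s ->
  exists2 s', coef_ge0 s' & forall u, trig s' u = c * trig s u.
Proof.
move=> c0 s0; have c1 : coef_ge0 [:: (c, 0)] by move=> p; rewrite inE => /eqP ->.
have [s' s'0 s'E] := trig_mul c1 s0; exists s' => // u; rewrite s'E.
congr (_ * _); rewrite /trig big_seq1 /= dotrC /dotr big1 ?cos0 ?mulr1//.
by move=> i _; rewrite mxE mulr0.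
Qed.

Lemma Int_indic c r : 0 <= r ->
  \int[mu]_u (c * \1_(supball r) u) = c * (2 * r) ^+ n.
Proof.
move=> r0; rewrite IntZ; last exact: bcs_indic.
rewrite /Rintegral integral_indic//; last exact: measurable_supball.
by rewrite setIT [X in fine X](lebesgue_supball r0).
Qed.

(** The sum is a normalized large power of the mean b(u) of the cos(u_i / L).
    For |u| <= L all these cosines are nonnegative; b is at most q < 1 off the
    ball of radius delta and at least q' > q near the origin, so that the mass
    of b^N off that ball is a fraction of order (q / q')^N. *)
Lemma trig_approx_identity (L delta eta : R) : (0 < n)%N ->
  0 < delta -> delta <= L -> 0 < eta ->
  exists s, [/\ coef_ge0 s, forall u, `|u| <= L -> 0 <= trig s u,
    \int[mu]_u (trig s u * \1_(supball L) u) = 1 &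
    \int[mu]_u (trig s u * (\1_(supball L) u - \1_(supball delta) u)) <= eta].
Proof.
move=> n0 d0 dL eta0; have L0 : 0 < L by exact: lt_le_trans dL.
have nR0 : 0 < n%:R :> R by rewrite ltr0n.
pose e (i : 'I_n) : Rd := L^-1 *: delta_mx 0 i.
pose b := [seq (n%:R^-1 : R, e i) | i <- enum 'I_n].
have eE i u : dotr (e i) u = u 0 i / L.
  rewrite /dotr (bigD1 i)//= big1 ?addr0 => [|j ji].
    by rewrite !mxE !eqxx /= mulr1 mulrC.
  by rewrite !mxE (negbTE ji) andbF mulr0 mul0r.
have bE u : trig b u = n%:R^-1 * \sum_i cos (u 0 i / L).
  rewrite /trig /b big_map big_enum /= mulr_sumr.
  by apply: eq_bigr => i _; rewrite eE.
have b0 : coef_ge0 b by move=> p /mapP[i _ ->] /=; rewrite invr_ge0.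
have uL1 u i : `|u| <= L -> `|u 0 i / L| <= 1.
  move=> uL; rewrite normrM normfV (gtr0_norm L0) ler_pdivrMr// mul1r.
  exact: le_trans (coord_le_normrV u i) uL.
have pi2 := @pi_ge2 R.
have cos_ge0 t : `|t| <= 1 -> 0 <= cos t :> R.
  by rewrite ler_norml => /andP[? ?]; apply: cos_ge0_pihalf; apply/andP; lra.
have bge0 u : `|u| <= L -> 0 <= trig b u.
  move=> uL; rewrite bE mulr_ge0 ?invr_ge0// sumr_ge0// => i _.
  by apply: cos_ge0; exact: uL1.
have mean_cst c : n%:R^-1 * \sum_(i < n) c = c :> R.
  by rewrite sumr_const card_ord -[c *+ n]mulr_natl mulrA mulVf ?mul1r// gt_eqF.
pose c := cos (delta / L).
have dL01 : 0 < delta / L <= 1.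
  by rewrite divr_gt0//= ler_pdivrMr// mul1r.
have c1 : c < 1.
  rewrite /c -[ltRHS]cos0 ltr_cos ?in_itv/=; first by case/andP: dL01.
    by rewrite lexx; lra.
  by apply/andP; case/andP: dL01; lra.
have c0 : 0 <= c.
  by apply: cos_ge0; rewrite ger0_norm; case/andP: dL01 => // /ltW.
pose q := 1 - (1 - c) / n%:R.
have q1 : q < 1 by rewrite /q ltrBlDr ltrDl divr_gt0// subr_gt0.
have q0 : 0 <= q.
  rewrite /q subr_ge0 ler_pdivrMr// mul1r (@le_trans _ _ 1)//; first lra.
  by rewrite ler1n.
have bq u : delta < `|u| -> `|u| <= L -> trig b u <= q.
  move=> du uL; have [i di] : exists i, delta < `|u 0 i|.
    apply/not_existsP => h; move: du; apply/negP; rewrite -leNgt.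
    by apply: normrV_le => [|i]; [exact: ltW|rewrite leNgt; apply/negP/h].
  rewrite bE (bigD1 i)//=.
  have ci : cos (u 0 i / L) <= c.
    have h1 := uL1 u i uL.
    have h2 : `|u 0 i / L| \in `[0, pi].
      by rewrite in_itv/= normr_ge0 (le_trans h1)//; lra.
    have h3 : delta / L \in `[0, pi].
      by rewrite in_itv/=; apply/andP; case/andP: dL01; lra.
    rewrite -cos_norm /c leNgt ltr_cos// -leNgt.
    by rewrite normrM normfV (gtr0_norm L0) ler_pM2r ?invr_gt0// ltW.
  have -> : q = n%:R^-1 * (c + (n%:R - 1)).
    by rewrite /q; field; rewrite gt_eqF.
  rewrite ler_pM2l ?invr_gt0// lerD//.
  apply: (@le_trans _ _ (\sum_(j < n | j != i) 1)).
    by apply: ler_sum => j _; exact: cos_le1.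
  rewrite sumr_const (_ : #|_| = n.-1); last by rewrite cardC1 card_ord.
  by rewrite -subn1 natrB.
pose q' := (1 + q) / 2.
have [d' [d'0 d'L bq']] : exists d', [/\ 0 < d', d' <= L &
    forall u, `|u| <= d' -> q' <= trig b u].
  have /cvgrPdist_lt/(_ ((1 - q) / 2)) : cos t @[t --> (0 : R)] --> cos (0 : R).
    exact: continuous_cos.
  rewrite divr_gt0 ?subr_gt0// => /(_ isT)/nbhs_ballP[r /= r0 hr].
  exists (Num.min L (L * (r / 2))); split.
  - by rewrite lt_min L0 mulr_gt0// divr_gt0.
  - by rewrite ge_min lexx.
  - move=> u; rewrite le_min => /andP[uL ur].
    rewrite bE -[leLHS](mean_cst q') ler_pM2l ?invr_gt0// ler_sum// => i _.
    have /hr : ball (0 : R) r (u 0 i / L).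
      have h : `|u 0 i / L| < r.
        suff : `|u 0 i| / L < r by rewrite normrM normfV (gtr0_norm L0).
        rewrite ltr_pdivrMr// (le_lt_trans (coord_le_normrV u i))//.
        by rewrite (le_lt_trans ur)// mulrC ltr_pM2r//; lra.
      by rewrite /ball/= sub0r normrN.
    by rewrite cos0 ltr_norml /q' => /andP[]; lra.
have qq' : q < q' by rewrite /q'; lra.
have q'0 : 0 < q' by lra.
(* the ratio of the volumes of the two balls is (d' / L) ^ n *)
have [N hN] : exists N, (q / q') ^+ N <= eta * (d' / L) ^+ n.
  have z1 : `|q / q'| < 1.
    by rewrite ger0_norm ?ltr_pdivrMr ?mul1r// divr_ge0// ltW.
  have /cvgrPdist_le/(_ (eta * (d' / L) ^+ n)) := cvg_expr z1.
  rewrite mulr_gt0 ?exprn_gt0 ?divr_gt0// => /(_ isT)[N _ hN].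
  exists N; have := hN N (leqnn N); rewrite sub0r normrN; apply: le_trans.
  exact: ler_norm.
have [s1 s10 s1E] := trig_exp N b0.
pose m := \int[mu]_u (trig s1 u * \1_(supball L) u).
have bd r : bcs (fun u => trig s1 u * \1_(supball r) u) by exact: bcs_trig.
have bI k r : bcs (fun u => k * \1_(supball r) u) by apply: bcsZ; exact: bcs_indic.
have inB r u : `|u| <= r -> \1_(supball r) u = 1 :> R.
  by move=> ur; rewrite indicE mem_set.
have notB r u : r < `|u| -> \1_(supball r) u = 0 :> R.
  by move=> ru; rewrite indicE memNset//; apply/negP; rewrite -ltNge.
have mge : q' ^+ N * (2 * d') ^+ n <= m.
  rewrite -(Int_indic _ (ltW d'0)); apply: Int_le => // u.
  have [ud|du] := leP `|u| d'.
    by rewrite !inB// ?(le_trans ud)// !mulr1 s1E lerXn2r ?nnegrE ?(ltW q'0) ?(le_trans (ltW q'0)) ?bq'.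
  rewrite notB// mulr0; have [uL|Lu] := leP `|u| L; last by rewrite notB// mulr0.
  by rewrite inB// mulr1 s1E exprn_ge0// bge0.
have m0 : 0 < m by rewrite (lt_le_trans _ mge)// mulr_gt0 ?exprn_gt0// mulr_gt0.
have mle : \int[mu]_u (trig s1 u * (\1_(supball L) u - \1_(supball delta) u)) <=
    q ^+ N * (2 * L) ^+ n.
  rewrite -(Int_indic _ (ltW L0)); apply: Int_le => // [|u].
    by under eq_fun do rewrite mulrBr; exact: bcsB.
  have [uL|Lu] := leP `|u| L; last first.
    by rewrite !notB// ?(le_lt_trans dL)// subrr !mulr0.
  have [ud|du] := leP `|u| delta.
    by rewrite !inB// subrr mulr0 mulr1 exprn_ge0.
  rewrite inB// notB// subr0 !mulr1 s1E lerXn2r ?nnegrE ?bge0//.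
  exact: bq.
have mi : 0 <= m^-1 by rewrite invr_ge0 ltW.
have [s s0 sE] := trig_scale mi s10.
exists s; split => //.
- by move=> u uL; rewrite sE mulr_ge0// s1E exprn_ge0// bge0.
- transitivity (\int[mu]_u (m^-1 * (trig s1 u * \1_(supball L) u))).
    by apply: eq_Rintegral => u _; rewrite sE mulrA.
  by rewrite IntZ// mulVf// gt_eqF.
- apply: (@le_trans _ _ (\int[mu]_u (m^-1 * (trig s1 u * (\1_(supball L) u - \1_(supball delta) u))))).
    by rewrite le_eqVlt; apply/orP; left; apply/eqP/eq_Rintegral => u _; rewrite sE mulrA.
  rewrite IntZ; last by under eq_fun do rewrite mulrBr; exact: bcsB.
  rewrite ler_pdivrMl// (le_trans mle)//.
  rewrite -[leLHS]mulr1 (le_trans _ (ler_wpM2r (ltW eta0) mge))//.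
  have -> : q ^+ N = (q / q') ^+ N * q' ^+ N.
    by rewrite -exprMn divfK// gt_eqF.
  rewrite mulr1 (mulrC (_ ^+ N)) -!mulrA ler_pM2l ?exprn_gt0//.
  apply: (@le_trans _ _ (eta * (d' / L) ^+ n * (2 * L) ^+ n)).
    by rewrite ler_wpM2r// exprn_ge0// mulr_ge0// ltW.
  rewrite -mulrA -exprMn [leRHS]mulrC.
  by have -> : d' / L * (2 * L) = 2 * d' by field; rewrite gt_eqF.
Qed.

(** The weighted sum of the |v^|^2 is the average of the autocorrelation
    |v|^2 - |v(. + u) - v|^2 / 2 against a probability density concentrated on
    |u| <= delta. It is at most |v|^2; it falls short by at most eps / 2 on that
    ball, and by at most 2 |v|^2 on the rest, whose mass is at most eta. *)
Lemma finite_plancherel (L delta eta : R) : (0 < n)%N ->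
  0 < delta -> delta <= L -> 0 < eta ->
  exists s, coef_ge0 s /\
    forall v, bcs v -> (forall x y, v x != 0 -> v y != 0 -> `|y - x| <= L) ->
      \sum_(p <- s) p.1 * pspec v p.2 <= l2sq v /\
      forall eps, (forall u, `|u| <= delta -> l2sq (fdiff u v) <= eps) ->
        l2sq v <= \sum_(p <- s) p.1 * pspec v p.2 + eps / 2 + 2 * eta * l2sq v.
Proof.
move=> n0 d0 dL eta0.
have [s [s0 sge0 s1 seta]] := trig_approx_identity n0 d0 dL eta0.
exists s; split => // v bv vL; rewrite (sum_pspecE s bv vL).
have bs r : bcs (fun u => trig s u * \1_(supball r) u) by exact: bcs_trig.
have ba : bcs (fun u => trig s u * \1_(supball L) u * autocorr v u).
  rewrite (_ : (fun u => _) = (fun u => \int[mu]_x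
      (v x * v (x + u) * (trig s u * \1_(supball L) u)))).
    exact: (bcs2_Int (bcs2_swap (bcs2_corr s L bv))).
  apply/funext => u /=; rewrite /autocorr -IntZ; last exact: bcs_autocorr_integrand.
  by apply: eq_Rintegral => x _; rewrite mulrC.
have IL : \int[mu]_u (l2sq v * (trig s u * \1_(supball L) u)) = l2sq v.
  by rewrite IntZ// s1 mulr1.
have inB r u : `|u| <= r -> \1_(supball r) u = 1 :> R.
  by move=> ur; rewrite indicE mem_set.
have notB r u : r < `|u| -> \1_(supball r) u = 0 :> R.
  by move=> ru; rewrite indicE memNset//; apply/negP; rewrite -ltNge.
split.
  rewrite -[leRHS]IL; apply: Int_le => // [|u]; first exact: bcsZ.
  have [uL|Lu] := leP `|u| L; last by rewrite notB// !(mulr0, mul0r).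
  rewrite inB// mulr1 mulrC ler_wpM2r// ?sge0// autocorrE//.
  by rewrite gerBl mulr_ge0// l2sq_ge0.
move=> eps veps.
pose g u := trig s u * (\1_(supball L) u - \1_(supball delta) u).
have bg : bcs g by rewrite /g; under eq_fun do rewrite mulrBr; exact: bcsB.
suff : \int[mu]_u ((l2sq v - eps / 2) * (trig s u * \1_(supball L) u) -
                   2 * l2sq v * g u) <=
       \int[mu]_u (trig s u * \1_(supball L) u * autocorr v u).
  rewrite IntB ?IntZ//; [|exact: bcsZ|exact: bcsZ].
  rewrite s1 mulr1.
  have : 2 * l2sq v * \int[mu]_u g u <= 2 * l2sq v * eta.
    by rewrite ler_wpM2l// mulr_ge0// l2sq_ge0.
  by lra.
have eps0 : 0 <= eps.
  by rewrite (le_trans _ (veps 0 _))// ?l2sq_ge0// normr0 ltW.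
apply: Int_le => // [|u]; first by apply: bcsB; exact: bcsZ.
have l0 := l2sq_ge0 v.
have Dle : l2sq (fdiff u v) <= 4 * l2sq v.
  have b1 := bcs_sqr bv; have b2 := bcs_shift u b1.
  apply: (@le_trans _ _ (\int[mu]_x (2 * (v (x + u)) ^+ 2 + 2 * v x ^+ 2))).
    apply: Int_le => [||x]; first by apply: bcs_sqr; exact: bcs_fdiff.
      by apply: bcsD; exact: bcsZ.
    by rewrite /fdiff; have := sqr_ge0 (v (x + u) + v x); lra.
  rewrite IntD ?IntZ//; [|exact: bcsZ|exact: bcsZ].
  by rewrite (Int_shift u b1) /l2sq; lra.
rewrite /g; have [uL|Lu] := leP `|u| L; last first.
  by rewrite !notB// ?(le_lt_trans dL)// subrr !(mulr0, mul0r) subrr.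
rewrite inB// mulr1 autocorrE//; have := sge0 _ uL.
move: (trig s u) => k k0.
have [ud|du] := leP `|u| delta.
  rewrite inB// subrr !mulr0 subr0 mulrC ler_wpM2l//.
  by have := veps _ ud; lra.
rewrite notB// subr0 mulr1 -mulrBl mulrC ler_wpM2l//.
lra.
Qed.

End trig_kernel.

(** * Cutoff functions and continuity of translations *)

Section cutoff.
Context {R : realType} {n : nat}.
Local Notation Rd := 'rV[R]_n.
Local Notation mu := (@lebesgue_rV R n).
Implicit Types (v : Rd -> R) (x z u xi : Rd).

(** Heine's theorem, applied to (u, x) |-> v(x + u) - v(x) near u = 0 over a
    compact neighbourhood of the support. *)
Lemma uniformly_continuous_fdiff v eps : continuous v -> bcs v -> 0 < eps ->
  exists2 delta, 0 < delta & forall u, `|u| <= delta ->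
    forall x, `|fdiff u v x| <= eps.
Proof.
move=> cv bv eps0; have [M [r [M0 r0 vM vr]]] := bcs_bounds bv.
have cK : compact (supball (r + 1) : set Rd).
  apply: bounded_closed_compact.
    by exists (r + 1); split; rewrite ?num_real// => t rt x /= /le_trans; apply; exact: ltW.
  rewrite (_ : supball _ = (fun x : Rd => `|x|) @^-1` [set t | t <= r + 1])//.
  by apply: closed_comp => [x _|]; [exact: norm_continuous|exact: closed_le].
have /compact_near_coveringP/(_ Rd (nbhs (0 : Rd)) (fun u x => `|fdiff u v x| <= eps) _) h := cK.
have /nbhs_ballP[e /= e0 he] : \forall u \near (0 : Rd), supball (r + 1) `<=` (fun x => `|fdiff u v x| <= eps).
  apply: h => x _.
  have cF : continuous (fun p : Rd * Rd => fdiff p.2 v p.1).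
    move=> p; apply: cvgB.
      apply: (@continuous_comp _ _ _ (fun p : Rd * Rd => p.1 + p.2) v).
        by apply: cvgD; [exact: cvg_fst|exact: cvg_snd].
      exact: cv.
    by apply: (@continuous_comp _ _ _ fst v); [exact: cvg_fst|exact: cv].
  have := cF (x, 0); rewrite /continuous_at /= {2}/fdiff addr0 subrr.
  move=> /cvgrPdist_le/(_ eps eps0) hF.
  have [[A B] /= [Ax B0] AB] := hF.
  exists (A, B) => // -[a b] /= [Aa Bb].
  by have := AB (a, b) (conj Aa Bb); rewrite /= sub0r normrN.
exists (Num.min 1 (e / 2)); first by rewrite lt_min ltr01 divr_gt0.
move=> u; rewrite le_min => /andP[u1 ue] x.
have [xr|rx] := leP `|x| (r + 1).
  by apply: (he u) => //; rewrite -ball_normE /= sub0r normrN; lra.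
have v1 : v x = 0 by apply: vr; lra.
have v2 : v (x + u) = 0.
  by apply: vr; have := ler_normB (x + u) u; rewrite addrK; lra.
by rewrite /fdiff v1 v2 subrr normr0 ltW.
Qed.

Lemma l2sq_fdiff_small v eps : continuous v -> bcs v -> 0 < eps ->
  exists2 delta, 0 < delta & forall u, `|u| <= delta -> l2sq (fdiff u v) <= eps.
Proof.
move=> cv bv eps0; have [M [r [M0 r0 vM vr]]] := bcs_bounds bv.
pose c := (2 * (r + 1)) ^+ n.
have c0 : 0 < c by rewrite exprn_gt0//; lra.
have e0 : 0 < Num.min 1 (eps / c) by rewrite lt_min ltr01 divr_gt0.
have [delta delta0 dv] := uniformly_continuous_fdiff cv bv e0.
exists (Num.min 1 delta); first by rewrite lt_min ltr01.
move=> u; rewrite le_min => /andP[u1 ud].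
apply: (@le_trans _ _ (\int[mu]_x (eps / c * \1_(supball (r + 1)) x))); last first.
  rewrite Int_indic -/c ?divfK// ?gt_eqF//; lra.
apply: Int_le => [||x]; first by apply: bcs_sqr; exact: bcs_fdiff.
  by apply: bcsZ; exact: bcs_indic.
have [xr|rx] := leP `|x| (r + 1).
  rewrite indicE mem_set// mulr1 -real_normK ?num_real//.
  have := dv u ud x; rewrite le_min => /andP[h1 h2].
  by rewrite expr2 (le_trans _ h2)// ler_piMl.
have v1 : v x = 0 by apply: vr; lra.
have v2 : v (x + u) = 0.
  by apply: vr; have := ler_normB (x + u) u; rewrite addrK; lra.
rewrite /fdiff v1 v2 subrr expr0n /= mulr_ge0// divr_ge0//; exact: ltW.
Qed.

Definition cutoff (rho : R) x : R := Num.max 0 (Num.min 1 (rho + 1 - `|x|)).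

Lemma cutoff_ge0 rho x : 0 <= cutoff rho x.
Proof. by rewrite le_max lexx. Qed.

Lemma cutoff_le1 rho x : cutoff rho x <= 1.
Proof. by rewrite ge_max ler01 ge_min lexx. Qed.

Lemma cutoff1 rho x : `|x| <= rho -> cutoff rho x = 1.
Proof.
move=> xr; have h : 1 <= rho + 1 - `|x| by lra.
by rewrite /cutoff min_l// max_r.
Qed.

Lemma cutoff0 rho x : rho + 1 <= `|x| -> cutoff rho x = 0.
Proof.
move=> xr; have h : rho + 1 - `|x| <= 0 by lra.
by rewrite /cutoff max_l// ge_min h orbT.
Qed.

Lemma cutoff_lip rho x z : `|cutoff rho (x + z) - cutoff rho x| <= `|z|.
Proof.
have h1 := ler_normD x z.
have h2 := ler_normB (x + z) z; rewrite addrK in h2.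
pose m t : R := Num.max 0 (Num.min 1 t).
have mE t : [\/ t <= 0 /\ m t = 0, 0 <= t <= 1 /\ m t = t | 1 <= t /\ m t = 1].
  rewrite /m; have [t0|t0] := leP t 0.
    by apply: Or31; split=> //; rewrite max_l// ge_min t0 orbT.
  have [t1|t1] := leP t 1.
    by apply: Or32; rewrite (ltW t0); split=> //; rewrite max_r// ltW.
  by apply: Or33; rewrite (ltW t1) max_r.
rewrite /cutoff -!/(m _) ler_norml.
case: (mE (rho + 1 - `|x + z|)) => -[+ ->]; case: (mE (rho + 1 - `|x|)) => -[+ ->];
  by move=> a b; apply/andP; lra.
Qed.

Lemma continuous_cutoff rho : continuous (cutoff rho).
Proof.
move=> x; apply/(@cvgrPdist_le _ _ _ (nbhs x) (nbhs_filter x)) => eps eps0.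
apply/nbhs_ballP; exists eps => //= y; rewrite -ball_normE /= distrC => xy.
have := cutoff_lip rho x (y - x).
rewrite (_ : x + (y - x) = y); last by rewrite addrC subrK.
by rewrite distrC => /le_trans; apply; exact: ltW.
Qed.

Lemma measurable_cutoff rho : measurable_fun setT (cutoff rho).
Proof. by apply: continuous_measurable_fun_rV; exact: continuous_cutoff. Qed.

Lemma bcs_cutoffM rho v : bcs v -> bcs (fun x => cutoff rho x * v x).
Proof.
move=> bv; under eq_fun do rewrite mulrC.
apply: (bcsM_bounded (M := 1)) => //; first exact: measurable_cutoff.
by move=> x; rewrite ger0_norm ?cutoff_ge0 ?cutoff_le1.
Qed.

(** Product rule for differences: the cutoff is at most 1 and 1-Lipschitz. *)
Lemma l2sq_fdiff_cutoff rho v u : bcs v ->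
  l2sq (fdiff u (fun x => cutoff rho x * v x)) <=
  2 * l2sq (fdiff u v) + 2 * `|u| ^+ 2 * l2sq v.
Proof.
move=> bv; have b1 := bcs_sqr bv; have b2 := bcs_sqr (bcs_fdiff u bv).
rewrite -(IntZ _ b1) -(IntZ _ b2) -IntD; [|exact: bcsZ|exact: bcsZ].
apply: Int_le => [||x].
- by apply: bcs_sqr; apply: bcs_fdiff; exact: bcs_cutoffM.
- by apply: bcsD; exact: bcsZ.
have -> : fdiff u (fun x => cutoff rho x * v x) x =
    cutoff rho (x + u) * fdiff u v x + (cutoff rho (x + u) - cutoff rho x) * v x.
  by rewrite /fdiff; ring.
have := cutoff_lip rho x u; move: (cutoff_ge0 rho (x + u)) (cutoff_le1 rho (x + u)).
move: (cutoff rho (x + u)) (cutoff rho x) (fdiff u v x) (v x) => a b p q a0 a1 ab.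
apply: (@le_trans _ _ (2 * (a * p) ^+ 2 + 2 * ((a - b) * q) ^+ 2)).
  by have := sqr_ge0 (a * p - (a - b) * q); lra.
rewrite !exprMn; apply: lerD.
  by apply: ler_wpM2l => //; rewrite ler_piMl ?sqr_ge0// expr_le1.
rewrite -[leRHS]mulrA ler_pM2l// ler_wpM2r ?sqr_ge0//.
by rewrite -real_normK ?num_real// lerXn2r ?nnegrE.
Qed.

Lemma l2sq_cutoff_le rho v : bcs v ->
  l2sq (fun x => cutoff rho x * v x) <= l2sq v.
Proof.
move=> bv; apply: Int_le => [||x].
- by apply: bcs_sqr; exact: bcs_cutoffM.
- exact: bcs_sqr.
by rewrite exprMn ler_piMl ?sqr_ge0// expr_le1 ?cutoff_ge0 ?cutoff_le1.
Qed.

(** Up to a constant this is an autocorrelation, whose measurability in z comes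
    from Fubini. *)
Lemma measurable_l2sq_fdiff v : bcs v ->
  measurable_fun setT (fun z => l2sq (fdiff z v)).
Proof.
move=> bv; have [mv _ _] := bv; have [M [r [M0 r0 vM vr]]] := bcs_bounds bv.
have bF : bcs2 (fun p : Rd * Rd => v p.2 * v (p.2 + p.1)).
  split.
  - apply: measurable_funM; first exact: (measurableT_comp mv measurable_snd).
    apply: (measurableT_comp mv); apply: measurable_fun_rVD.
      exact: measurable_snd.
    exact: measurable_fst.
  - by exists (M * M) => p; rewrite normrM ler_pM.
  - exists (2 * r) => -[u x] /= h; have [xr|rx] := leP `|x| r; last by rewrite vr ?mul0r.
    rewrite [v (x + u)]vr ?mulr0//.
    by case: h => h; [have := ler_normB (x + u) x; rewrite addrC addKr|]; lra.
have [mF _ _] := bcs2_Int bF.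
have -> : (fun z => l2sq (fdiff z v)) = (fun z => 2 * l2sq v - 2 * autocorr v z).
  by apply/funext => z; rewrite autocorrE//; lra.
by apply: measurable_funB => //; apply: measurable_funM.
Qed.

End cutoff.

(** * Compactness on balls *)

Section equicontinuity.
Context {R : realType} {n : nat}.
Local Notation Rd := 'rV[R]_n.
Local Notation mu := (@lebesgue_rV R n).
Variables (nu : {measure set Rd -> \bar R}) (D : set Rd).
Hypothesis n_gt0 : (0 < n)%N.
Hypothesis mD : measurable D.
Hypothesis D1 : forall z, D z -> `|z| <= 1.
Implicit Types (v : Rd -> R) (x z u xi : Rd).

Definition symbol xi : \bar R := (\int[nu]_(z in D) (1 - cos (dotr z xi))%:E)%E.

Hypothesis symbol_infty : forall A : R, exists N : R, forall xi,
  N <= `|xi| -> (A%:E <= symbol xi)%E.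

Lemma one_sub_cos_ge0 (t : R) : 0 <= 1 - cos t.
Proof. by rewrite subr_ge0 cos_le1. Qed.

Lemma normr_sin_le (t : R) : `|sin t| <= `|t|.
Proof.
wlog t0 : t / 0 <= t.
  by move=> h; have [/h//|t0] := leP 0 t; rewrite -[leLHS]normrN -sinN -[leRHS]normrN h//; lra.
have [c _] := @MVT_segment R sin cos 0 t t0 (fun s _ => is_derive_sin s)
  (continuous_subspaceT (@continuous_sin R)).
by rewrite sin0 !subr0 => ->; rewrite normrM ler_piMl// cos_max.
Qed.

Lemma one_sub_cos_le (t : R) : 1 - cos t <= t ^+ 2 / 2.
Proof.
have -> : 1 - cos t = 2 * sin (t / 2) ^+ 2.
  have -> : cos t = cos ((t / 2) *+ 2) by congr cos; lra.
  by rewrite cos_mulr2n cos2sin2; lra.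
have : sin (t / 2) ^+ 2 <= (t / 2) ^+ 2.
  rewrite -(@real_normK _ (sin _)) ?num_real// -(@real_normK _ (t / 2)) ?num_real//.
  by rewrite lerXn2r ?nnegrE// normr_sin_le.
by lra.
Qed.

(** The form of nu is diagonal in frequency, its multiplier being twice the
    symbol: integrate [pspec_fdiff] in z. Bessel's inequality, assumed for the
    weighted frequencies s, is applied to each difference v(. + z) - v. *)
Lemma symbol_pspec v s e : bcs v -> coef_ge0 s ->
  (forall w, bcs w -> (forall x y, w x != 0 -> w y != 0 -> `|y - x| <= e) ->
     \sum_(p <- s) p.1 * pspec w p.2 <= l2sq w) ->
  forall K : R, (\int[nu]_(z in D) (l2sq (fdiff z v))%:E <= K%:E)%E ->
  (forall z, D z -> forall x y, fdiff z v x != 0 -> fdiff z v y != 0 -> `|y - x| <= e) ->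
  (\sum_(p <- s) (p.1 * pspec v p.2)%:E * symbol p.2 <= (K / 2)%:E)%E.
Proof.
move=> bv s0 bessel K vK vz.
have ps0 w xi : 0 <= pspec w xi by rewrite addr_ge0// sqr_ge0.
have mcos xi : measurable_fun D (fun z => (1 - cos (dotr z xi))%:E).
  apply: measurable_funTS; apply: measurable_fun_EFin; apply: measurable_funB => //.
  by under eq_fun do rewrite dotrC; exact: measurable_cos_dotr.
have c0 p : p \in s -> 0 <= p.1 * pspec v p.2.
  by move=> /s0 p0; exact: mulr_ge0.
have -> : (\sum_(p <- s) (p.1 * pspec v p.2)%:E * symbol p.2 =
    \sum_(p <- s) \int[nu]_(z in D) (p.1 * pspec v p.2 * (1 - cos (dotr z p.2)))%:E)%E.
  rewrite big_seq [RHS]big_seq; apply: eq_bigr => p ps.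
  by rewrite -ge0_integralZl//; exact: c0.
have ck0 p z : p \in s -> (0 <= (p.1 * pspec v p.2 * (1 - cos (dotr z p.2)))%:E)%E.
  by move=> ps; rewrite lee_fin mulr_ge0 ?c0// one_sub_cos_ge0.
have mk p : measurable_fun D (fun z => (p.1 * pspec v p.2 * (1 - cos (dotr z p.2)))%:E).
  by under eq_fun do rewrite EFinM; exact: measurable_funeM.
have -> : (\sum_(p <- s) \int[nu]_(z in D) (p.1 * pspec v p.2 * (1 - cos (dotr z p.2)))%:E =
  \int[nu]_(z in D) (\sum_(p <- s) p.1 * pspec v p.2 * (1 - cos (dotr z p.2)))%:E)%E.
  under [RHS]eq_integral do rewrite -sumEFin.
  elim: s ck0 {s0 bessel c0} => [|p s ih] ck0.
    by rewrite big_nil; under eq_integral do rewrite big_nil; rewrite integral0.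
  rewrite big_cons ih => [|q z qs]; last by apply: ck0; rewrite inE qs orbT.
  under [RHS]eq_integral do rewrite big_cons.
  rewrite ge0_integralD//.
  - by move=> z _; apply: ck0; rewrite inE eqxx.
  - by move=> z _; rewrite big_seq; apply: sume_ge0 => q qs; apply: ck0; rewrite inE qs orbT.
  - by apply: emeasurable_sum.
have -> : (K / 2)%:E = (2^-1%:E * K%:E)%E by rewrite -EFinM mulrC.
apply: (@le_trans _ _ (2^-1%:E * \int[nu]_(z in D) (l2sq (fdiff z v))%:E)%E); last first.
  by rewrite lee_pmul2l.
have ml : measurable_fun D (fun z => (l2sq (fdiff z v))%:E).
  by apply: measurable_funTS; apply: measurable_fun_EFin; exact: measurable_l2sq_fdiff.
rewrite -ge0_integralZl//; last by move=> z _; rewrite lee_fin l2sq_ge0.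
apply: ge0_le_integral => //.
- move=> z _; rewrite lee_fin big_seq sumr_ge0// => p ps.
  by have := ck0 p z ps; rewrite lee_fin.
- by under eq_fun do rewrite -sumEFin; apply: emeasurable_sum.
- exact: measurable_funeM.
move=> z Dz; rewrite -EFinM lee_fin.
have := bessel _ (bcs_fdiff z bv) (vz z Dz).
have -> : \sum_(p <- s) p.1 * pspec (fdiff z v) p.2 =
    2 * \sum_(p <- s) p.1 * pspec v p.2 * (1 - cos (dotr z p.2)).
  rewrite mulr_sumr; apply: eq_bigr => p _.
  by rewrite pspec_fdiff// (dotrC z); ring.
by lra.
Qed.

Lemma continuous_fdiff v z : continuous v -> continuous (fdiff z v).
Proof.
move=> cv x.
apply/(@cvgrPdist_le _ _ _ (nbhs x) (nbhs_filter x)) => eps eps0.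
have e20 : 0 < eps / 2 by rewrite divr_gt0.
have near_ball y : exists2 r, 0 < r & forall y', `|y - y'| < r -> `|v y - v y'| <= eps / 2.
  have /(@cvgrPdist_le _ _ _ (nbhs y) (nbhs_filter y))/(_ _ e20) := cv y.
  by move=> /nbhs_ballP[r /= r0 hr]; exists r => // y' yr; apply: hr; rewrite -ball_normE.
have [r r0 hr] := near_ball x; have [q q0 hq] := near_ball (x + z).
apply/nbhs_ballP; exists (Num.min r q); first by rewrite /= lt_min r0.
move=> y; rewrite -ball_normE /= lt_min => /andP[xr xq].
have h1 := hr _ xr.
have h2 : `|v (x + z) - v (y + z)| <= eps / 2.
  by apply: hq; rewrite opprD addrACA subrr addr0.
rewrite /fdiff (_ : _ - _ = (v (x + z) - v (y + z)) - (v x - v y)); last by ring.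
by rewrite (le_trans (ler_normB _ _))//; lra.
Qed.

Lemma fdiff_supp v z r : (forall x, r < `|x| -> v x = 0) -> `|z| <= 1 ->
  forall x, fdiff z v x != 0 -> `|x| <= r + 1.
Proof.
move=> vr z1 x; apply: contraNT; rewrite -ltNge => rx; apply/eqP.
have v1 : v x = 0 by apply: vr; lra.
have v2 : v (x + z) = 0.
  by apply: vr; have := ler_normB (x + z) z; rewrite addrK; lra.
by rewrite /fdiff v1 v2 subrr.
Qed.

(** High frequencies carry little mass because the symbol is large there, and
    the low ones vary little under a small translation. The bound h depends on
    neither v nor the size of its support, although the finite set of
    frequencies used in the proof depends on both. *)
Lemma translation_equicontinuous eps : 0 < eps -> exists2 h, 0 < h &
  forall v K, continuous v -> bcs v ->
  (\int[nu]_(z in D) (l2sq (fdiff z v))%:E <= K%:E)%E ->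
  forall y, `|y| <= h -> l2sq (fdiff y v) <= eps * (l2sq v + K).
Proof.
move=> eps0; have [N0 hN0] := symbol_infty (2 / eps).
pose N := Num.max N0 1.
have N1 : 1 <= N by rewrite le_max lexx orbT.
pose c := (n%:R * N) ^+ 2.
have c0 : 0 <= c by exact: sqr_ge0.
have c1 : 0 < c + 1 by lra.
exists (Num.min 1 (eps / (c + 1))); first by rewrite lt_min ltr01 divr_gt0.
move=> v K cv bv vK y; rewrite le_min => /andP[y1 yeps].
have [M [r [M0 r0 vM vr]]] := bcs_bounds bv.
pose L := 2 * (r + 1); have L0 : 0 < L by rewrite /L; lra.
have supp2 z : `|z| <= 1 -> forall x x', fdiff z v x != 0 ->
    fdiff z v x' != 0 -> `|x' - x| <= L.
  move=> z1 x x' /(fdiff_supp vr z1) hx /(fdiff_supp vr z1) hx'.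
  by rewrite (le_trans (ler_normB _ _))// /L; lra.
have suppv x x' : v x != 0 -> v x' != 0 -> `|x' - x| <= L.
  have h t : v t != 0 -> `|t| <= r.
    by apply: contraNT; rewrite -ltNge => /vr ->.
  by move=> /h hx /h hx'; rewrite (le_trans (ler_normB _ _))// /L; lra.
pose w := fdiff y v.
have cw : continuous w by exact: continuous_fdiff.
have bw : bcs w by exact: bcs_fdiff.
have lw0 := l2sq_ge0 w.
(* the finite Plancherel identity is exact only up to an error e, which its
   frequencies can make as small as desired once v is given *)
apply/ler_addgt0Pr => e e0.
have [d0 d00 hd0] := l2sq_fdiff_small cw bw e0.
pose eta := e / (4 * (l2sq w + 1)).
have lw1 : 0 < 4 * (l2sq w + 1) by lra.
have eta0 : 0 < eta by rewrite divr_gt0.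
have etale : 2 * eta * l2sq w <= e / 2.
  rewrite /eta mulrA mulrAC ler_pdivrMr// -subr_ge0.
  have -> : e / 2 * (4 * (l2sq w + 1)) - 2 * e * l2sq w = 2 * e by field.
  by rewrite mulr_ge0// ltW.
have dd : 0 < Num.min d0 L by rewrite lt_min d00.
have dL : Num.min d0 L <= L by rewrite ge_min lexx orbT.
have [s [s0 hs]] := finite_plancherel n_gt0 dd dL eta0.
have [_ /(_ e) hw] := hs w bw (supp2 _ y1).
have {}hw := le_trans (hw _) _.
apply: hw => [u|].
  by rewrite le_min => /andP[ud _]; exact: hd0.
suff : \sum_(p <- s) p.1 * pspec w p.2 <= eps * (l2sq v + K) by lra.
have ps0 xi : 0 <= pspec v xi by rewrite addr_ge0// sqr_ge0.
have S0 p : p \in s -> 0 <= p.1 * pspec v p.2.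
  by move=> /s0 p0; exact: mulr_ge0.
have [bv1 _] := hs v bv suppv.
have := @symbol_pspec v s L bv s0 (fun w bw h => (hs w bw h).1) K vK
  (fun z Dz => supp2 z (D1 Dz)).
move=> hsym; rewrite -lee_fin -sumEFin.
have sym0 xi : (0 <= symbol xi)%E.
  by apply: integral_ge0 => z _; rewrite lee_fin one_sub_cos_ge0.
have pw p : p \in s -> ((p.1 * pspec w p.2)%:E <=
    eps%:E * (p.1 * pspec v p.2)%:E + (2 * eps)%:E * ((p.1 * pspec v p.2)%:E * symbol p.2))%E.
  move=> ps; rewrite pspec_fdiff//.
  have -> : p.1 * (2 * (1 - cos (dotr p.2 y)) * pspec v p.2) =
     2 * (1 - cos (dotr p.2 y)) * (p.1 * pspec v p.2) by ring.
  have := S0 _ ps; move: (p.1 * pspec v p.2) => S S0'.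
  (* at a high frequency 2 (1 - cos) <= 4 <= 2 eps symbol; at a low one
     2 (1 - cos) <= (n N |y|)^2 <= eps *)
  have [pN|Np] := leP N `|p.2|.
    apply: (@le_trans _ _ ((2 * eps)%:E * (S%:E * (2 / eps)%:E))%E).
      rewrite -!EFinM lee_fin.
      have -> : 2 * eps * (S * (2 / eps)) = 4 * S by field; rewrite gt_eqF.
      by apply: ler_wpM2r => //; have := cos_geN1 (dotr p.2 y); lra.
    rewrite -[leLHS]add0e leeD//.
      by rewrite -EFinM lee_fin mulr_ge0// ltW.
    apply: lee_wpmul2l; first by rewrite lee_fin mulr_ge0// ltW.
    apply: lee_wpmul2l; rewrite ?lee_fin//; apply: hN0.
    by rewrite (le_trans _ pN)// le_max lexx.
  rewrite -[leLHS]adde0 leeD//.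
    rewrite -EFinM lee_fin ler_wpM2r//.
    have h1 := one_sub_cos_le (dotr p.2 y).
    have h2 : (dotr p.2 y) ^+ 2 <= c * `|y|.
      rewrite -real_normK ?num_real//.
      apply: (@le_trans _ _ ((n%:R * (N * `|y|)) ^+ 2)).
        rewrite lerXn2r ?nnegrE ?mulr_ge0//; first lra.
        rewrite (le_trans (dotr_le _ _))// ler_wpM2l// ler_wpM2r//.
        exact: ltW.
      rewrite /c mulrA exprMn ler_wpM2l ?sqr_ge0//.
      by rewrite expr2 ler_piMl.
    have h3 : c * `|y| <= eps.
      apply: (@le_trans _ _ ((c + 1) * `|y|)); first by rewrite ler_wpM2r//; lra.
      by rewrite mulrC -ler_pdivlMr.
    by lra.
  apply: mule_ge0; first by rewrite lee_fin mulr_ge0// ltW.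
  by apply: mule_ge0; rewrite ?lee_fin.
apply: (@le_trans _ _ (\sum_(p <- s) (eps%:E * (p.1 * pspec v p.2)%:E +
    (2 * eps)%:E * ((p.1 * pspec v p.2)%:E * symbol p.2)))%E).
  by rewrite big_seq [leRHS]big_seq; apply: lee_sum.
rewrite big_seq big_split /= -!ge0_sume_distrr; last 2 first.
- by move=> p ps; apply: mule_ge0 => //; rewrite lee_fin S0.
- by move=> p ps; rewrite lee_fin S0.
rewrite -!big_seq sumEFin.
have -> : (eps * (l2sq v + K))%:E = (eps%:E * (l2sq v)%:E + (2 * eps)%:E * (K / 2)%:E)%E.
  by rewrite -!EFinM -EFinD; congr EFin; field.
have eps0' : 0 <= eps by exact: ltW.
by apply: leeD; apply: lee_wpmul2l => //; rewrite lee_fin// mulr_ge0.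
Qed.

(** A truncation has support in a fixed ball, so the finite Plancherel identity
    applies with frequencies that do not depend on v; equicontinuity of
    translations bounds its error uniformly. *)
Lemma cutoff_finite_rank rho eps : 0 <= rho -> 0 < eps ->
  exists s, coef_ge0 s /\ forall v K, continuous v -> bcs v ->
  (\int[nu]_(z in D) (l2sq (fdiff z v))%:E <= K%:E)%E ->
  l2sq (fun x => cutoff rho x * v x) <= eps * (l2sq v + K) +
    \sum_(p <- s) p.1 * pspec (fun x => cutoff rho x * v x) p.2.
Proof.
move=> rho0 eps0; have eps4 : 0 < eps / 4 by rewrite divr_gt0.
have [h h0 hT] := translation_equicontinuous eps4.
pose L := 2 * (rho + 1); have L0 : 0 < L by rewrite /L; lra.
pose delta := Num.min (Num.min h L) (Num.min 1 (eps / 4)).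
have d0 : 0 < delta by rewrite !lt_min h0 L0 ltr01 eps4.
have dL : delta <= L by rewrite !ge_min lexx orbT.
have [s [s0 hs]] := finite_plancherel n_gt0 d0 dL eps4.
exists s; split => // v K cv bv vK.
have K0 : 0 <= K.
  by rewrite -lee_fin; apply: le_trans vK; apply: integral_ge0 => z _; rewrite lee_fin l2sq_ge0.
have bw := bcs_cutoffM rho bv; set w := fun x => _ in bw *.
have wL x x' : w x != 0 -> w x' != 0 -> `|x' - x| <= L.
  have wr t : w t != 0 -> `|t| <= rho + 1.
    apply: contraNT; rewrite -ltNge => tr.
    by rewrite /w cutoff0 ?mul0r// ltW.
  by move=> /wr hx /wr hx'; rewrite (le_trans (ler_normB _ _))// /L; lra.
have [_ /(_ (eps * (l2sq v + K)))] := hs w bw wL.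
have lv0 := l2sq_ge0 v.
have lw : l2sq w <= l2sq v by exact: l2sq_cutoff_le.
have lw' : 2 * (eps / 4) * l2sq w <= 2 * (eps / 4) * l2sq v.
  by rewrite ler_wpM2l//; lra.
have epsK : 0 <= eps * K by rewrite mulr_ge0// ltW.
have epsv : 0 <= eps * l2sq v by rewrite mulr_ge0// ltW.
move=> hw; apply: (le_trans (hw _)); last by lra.
move=> u; rewrite !le_min => /andP[/andP[uh _] /andP[u1 ue]].
rewrite (le_trans (l2sq_fdiff_cutoff rho u bv))//.
have h1 := hT v K cv bv vK u uh.
have h2 : `|u| ^+ 2 * l2sq v <= eps / 4 * l2sq v.
  apply: ler_wpM2r => //; rewrite expr2 (le_trans _ ue)//.
  by rewrite ler_piMl.
by lra.
Qed.

End equicontinuity.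

(** * A Hardy inequality for differences *)

Section hardy.
Context {R : realType} {n : nat}.
Local Notation Rd := 'rV[R]_n.
Local Notation mu := (@lebesgue_rV R n).
Implicit Types (v : Rd -> R) (x z u xi : Rd).

Lemma sqr_normrV_le_dotr z : `|z| ^+ 2 <= dotr z z.
Proof.
have dz0 : 0 <= dotr z z by apply: sumr_ge0 => i _; rewrite -expr2 sqr_ge0.
rewrite -ler_sqrt ?sqrtr_sqr ?ger0_norm//.
apply: normrV_le => [|i]; first exact: sqrtr_ge0.
rewrite -sqrtr_sqr ler_sqrt// /dotr (bigD1 i)//= -expr2 lerDl.
by apply: sumr_ge0 => j _; rewrite -expr2 sqr_ge0.
Qed.

(** |x|^2, switched off in the ball of radius rho. *)
Definition hardy_weight (rho : R) x : R := (1 - cutoff rho x) * `|x| ^+ 2.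

Lemma hardy_weight_ge0 rho x : 0 <= hardy_weight rho x.
Proof. by rewrite mulr_ge0// ?sqr_ge0// subr_ge0 cutoff_le1. Qed.

Lemma measurable_hardy_weight rho : measurable_fun setT (hardy_weight rho).
Proof.
apply: measurable_funM.
  by apply: measurable_funB => //; exact: measurable_cutoff.
by apply: measurable_funX; exact: measurable_fun_normrV.
Qed.

Lemma bcs_hardy rho v : bcs v -> bcs (fun x => v x * hardy_weight rho x).
Proof.
move=> bv; apply: bcsM => // [|r]; first exact: measurable_hardy_weight.
exists (r ^+ 2) => x xr; rewrite ger0_norm ?hardy_weight_ge0//.
have r0 : 0 <= r by rewrite (le_trans _ xr).
rewrite -[leRHS]mul1r ler_pM ?subr_ge0 ?cutoff_le1//.
  by rewrite gerBl cutoff_ge0.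
by rewrite lerXn2r ?nnegrE.
Qed.

Lemma bcs_hardy_fdiff rho z v : bcs v ->
  bcs (fun x => fdiff z v x ^+ 2 * hardy_weight rho x).
Proof. by move=> bv; apply: bcs_hardy; apply: bcs_sqr; exact: bcs_fdiff. Qed.

Lemma bcs_co_cutoff rho v : bcs v -> bcs (fun x => (1 - cutoff rho x) * v x).
Proof.
move=> bv; under eq_fun do rewrite mulrBl mul1r.
by apply: bcsB => //; exact: bcs_cutoffM.
Qed.

(** Summation by parts in the direction z: shifting the variable turns the
    integral of f(x) (v(x + z)^2 - v(x)^2), where f(x) = <x, z> eta(x) and eta
    is 1 - cutoff, into that of (f(x - z) - f(x)) v(x)^2, and
    f(x - z) - f(x) = - |z|^2 eta(x) up to an error living where eta is not
    constant. The former integral is estimated by the inequality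
    2 p q <= a p^2 + q^2 / a. *)
Lemma hardy_difference rho (a : R) z v : bcs v -> 0 <= rho -> 0 < a -> `|z| <= 1 ->
  `|z| ^+ 2 * \int[mu]_x ((1 - cutoff rho x) * v x ^+ 2) <=
  `|z| ^+ 2 * (n%:R * (rho + 2) * l2sq (fun x => cutoff (rho + 2) x * v x) +
               2 * n%:R / a * l2sq v) +
  n%:R * a / 2 * \int[mu]_x (fdiff z v x ^+ 2 * hardy_weight rho x).
Proof.
move=> bv rho0 a0 z1.
have bv2 := bcs_sqr bv.
have n0 : 0 <= n%:R :> R by [].
pose eta x := 1 - cutoff rho x.
have eta0 x : 0 <= eta x by rewrite subr_ge0 cutoff_le1.
have eta1 x : eta x <= 1 by rewrite gerBl cutoff_ge0.
have meta : measurable_fun setT eta.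
  by apply: measurable_funB => //; exact: measurable_cutoff.
pose f x := dotr x z * eta x.
have mf : measurable_fun setT f.
  by apply: measurable_funM => //; exact: measurable_fun_dotr.
have f_le x : `|f x| <= n%:R * `|x| * `|z| * eta x.
  by rewrite /f normrM (ger0_norm (eta0 x)) ler_wpM2r// -mulrA dotr_le.
have bf w : bcs w -> bcs (fun x => w x * f x).
  move=> bw; apply: bcsM => // r; exists (n%:R * r * `|z|) => x xr.
  rewrite (le_trans (f_le x))//.
  apply: (@le_trans _ _ (n%:R * `|x| * `|z| * 1)).
    by rewrite ler_wpM2l// !mulr_ge0.
  by rewrite mulr1 ler_wpM2r// ler_wpM2l.
have bfz w : bcs w -> bcs (fun x => w x * f (x - z)).
  move=> bw; have := bcs_shift (- z) (bf _ (bcs_shift z bw)).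
  by under eq_fun do rewrite subrK.
(* g bounds the error: eta is 1 outside the ball of radius rho + 1 and |z| <= 1,
   so eta (x - z) = eta x unless |x| <= rho + 2 *)
pose g x := n%:R * (rho + 2) * `|z| ^+ 2 * (cutoff (rho + 2) x * v x) ^+ 2.
have bg : bcs g by apply: bcsZ; apply: bcs_sqr; exact: bcs_cutoffM.
have errE x : v x ^+ 2 * (f (x - z) - f x) + `|z| ^+ 2 * (eta x * v x ^+ 2) <= g x.
  have fE : f (x - z) - f x = dotr (x - z) z * (eta (x - z) - eta x) - dotr z z * eta x.
    by rewrite /f !(dotrC _ z) dotrDr dotrNr; ring.
  have elip : `|eta (x - z) - eta x| <= `|z|.
    have -> : eta (x - z) - eta x = - (cutoff rho (x - z) - cutoff rho x).
      by rewrite /eta; ring.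
    by rewrite normrN (le_trans (cutoff_lip _ _ _))// normrN.
  have h1 : v x ^+ 2 * (f (x - z) - f x) + `|z| ^+ 2 * (eta x * v x ^+ 2) <=
      v x ^+ 2 * (dotr (x - z) z * (eta (x - z) - eta x)).
    rewrite fE -subr_ge0.
    have zz : 0 <= dotr z z - `|z| ^+ 2 by rewrite subr_ge0 sqr_normrV_le_dotr.
    have := mulr_ge0 zz (mulr_ge0 (eta0 x) (sqr_ge0 (v x))).
    by rewrite [X in 0 <= X -> _](_ : _ = (dotr z z - `|z| ^+ 2) * (eta x * v x ^+ 2))//; lra.
  apply: (le_trans h1).
  have [e0|e0] := eqVneq (eta (x - z) - eta x) 0.
    rewrite e0 !mulr0 /g mulr_ge0 ?sqr_ge0// mulr_ge0 ?sqr_ge0// mulr_ge0//; lra.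
  have xz : `|x - z| <= rho + 2 /\ `|x| <= rho + 2.
    have h2 := ler_normB x z; have h3 := ler_normD (x - z) z; rewrite subrK in h3.
    have [xr|rx] := leP `|x| (rho + 1); first by split; lra.
    have [xr'|rx'] := leP `|x - z| (rho + 1); first by split; lra.
    by move: e0; rewrite /eta !cutoff0 ?subrr ?eqxx// ltW.
  rewrite /g cutoff1 ?mul1r; last by case: xz.
  rewrite [leRHS]mulrC ler_wpM2l ?sqr_ge0//.
  rewrite (le_trans (ler_norm _))// normrM.
  apply: (@le_trans _ _ (n%:R * ((rho + 2) * `|z|) * `|z|)); last first.
    by rewrite expr2 !mulrA.
  apply: ler_pM => //; rewrite (le_trans (dotr_le _ _))// ler_wpM2l//.
  by rewrite ler_wpM2r//; case: xz.
(* h bounds f times v (x + z) ^ 2 - v x ^ 2, which factors as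
   (v (x + z) - v x) (v (x + z) + v x) *)
pose h x := n%:R * a / 2 * (fdiff z v x ^+ 2 * hardy_weight rho x) +
   n%:R / a * `|z| ^+ 2 * (v (x + z) ^+ 2 + v x ^+ 2).
have bh : bcs h.
  apply: bcsD; apply: bcsZ; first exact: bcs_hardy_fdiff.
  by apply: bcsD => //; exact: (bcs_shift z bv2).
have mainE x : - ((v (x + z) ^+ 2 - v x ^+ 2) * f x) <= h x.
  rewrite (le_trans (ler_norm _))// normrN normrM.
  apply: (@le_trans _ _ (`|v (x + z) ^+ 2 - v x ^+ 2| * (n%:R * `|x| * `|z| * eta x))).
    by rewrite ler_wpM2l.
  have -> : v (x + z) ^+ 2 - v x ^+ 2 = fdiff z v x * (v (x + z) + v x).
    by rewrite /fdiff; ring.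
  rewrite normrM /h /hardy_weight -/(eta x).
  have -> : fdiff z v x ^+ 2 = `|fdiff z v x| ^+ 2 by rewrite real_normK ?num_real.
  have sle : `|v (x + z) + v x| ^+ 2 <= 2 * (v (x + z) ^+ 2 + v x ^+ 2).
    by rewrite real_normK ?num_real//; have := sqr_ge0 (v (x + z) - v x); lra.
  move: (`|fdiff z v x|) (`|v (x + z) + v x|) sle (normr_ge0 x) (normr_ge0 z).
  move: `|x| `|z| (eta x) (eta0 x) (eta1 x) => X Z e e0 e1 p q sle X0 Z0.
  move: (v (x + z) ^+ 2 + v x ^+ 2) sle => S sle.
  have amgm : e * (p * X) * (q * Z) <= e * (a / 2 * (p * X) ^+ 2 + (2 * a)^-1 * (q * Z) ^+ 2).
    rewrite -mulrA ler_wpM2l// -subr_ge0.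
    have -> : a / 2 * (p * X) ^+ 2 + (2 * a)^-1 * (q * Z) ^+ 2 - p * X * (q * Z) =
       (2 * a)^-1 * (a * (p * X) - q * Z) ^+ 2 by field; rewrite gt_eqF.
    by rewrite mulr_ge0 ?sqr_ge0// invr_ge0; lra.
  have second : e * ((2 * a)^-1 * (q * Z) ^+ 2) <= a^-1 * Z ^+ 2 * S.
    rewrite (_ : a^-1 * Z ^+ 2 * S = 1 * ((2 * a)^-1 * (2 * S * Z ^+ 2))); last first.
      by field; rewrite gt_eqF.
    apply: ler_pM => //; first by rewrite mulr_ge0 ?sqr_ge0// invr_ge0; lra.
    rewrite ler_wpM2l//; first by rewrite invr_ge0; lra.
    by rewrite exprMn ler_wpM2r ?sqr_ge0.
  have -> : p * q * (n%:R * X * Z * e) = n%:R * (e * (p * X) * (q * Z)) by ring.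
  have -> : n%:R * a / 2 * (p ^+ 2 * (e * X ^+ 2)) + n%:R / a * Z ^+ 2 * S =
    n%:R * (e * (a / 2 * (p * X) ^+ 2) + a^-1 * Z ^+ 2 * S).
    by field; rewrite gt_eqF.
  rewrite ler_wpM2l// (le_trans amgm)// mulrDr lerD2l//.
have be := bcs_co_cutoff rho bv2.
have byparts : \int[mu]_x ((v (x + z) ^+ 2 - v x ^+ 2) * f x) =
    \int[mu]_x (v x ^+ 2 * (f (x - z) - f x)).
  have b1 := bf _ (bcs_shift z bv2); have b2 := bf _ bv2; have b3 := bfz _ bv2.
  under eq_Rintegral do rewrite mulrBl.
  under [RHS]eq_Rintegral do rewrite mulrBr.
  rewrite !IntB//; congr (_ - _).
  rewrite -(Int_shift z b3); apply: eq_Rintegral => x _.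
  by rewrite addrK.
have bd : bcs (fun x => v x ^+ 2 * (f (x - z) - f x)).
  by under eq_fun do rewrite mulrBr; apply: bcsB; [exact: bfz|exact: bf].
have bm : bcs (fun x => (v (x + z) ^+ 2 - v x ^+ 2) * f x).
  by apply: bf; apply: bcsB => //; exact: (bcs_shift z bv2).
have e1 : \int[mu]_x (v x ^+ 2 * (f (x - z) - f x)) +
    `|z| ^+ 2 * \int[mu]_x (eta x * v x ^+ 2) <= \int[mu]_x g x.
  rewrite -IntZ// -IntD//; last exact: bcsZ.
  by apply: Int_le => //; apply: bcsD => //; exact: bcsZ.
have e2 : (-1) * \int[mu]_x ((v (x + z) ^+ 2 - v x ^+ 2) * f x) <= \int[mu]_x h x.
  rewrite -(IntZ _ bm); apply: Int_le => // [|x]; first exact: bcsZ.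
  by rewrite mulN1r.
have gE : \int[mu]_x g x = n%:R * (rho + 2) * `|z| ^+ 2 *
    l2sq (fun x => cutoff (rho + 2) x * v x).
  by rewrite IntZ//; apply: bcs_sqr; exact: bcs_cutoffM.
have hE : \int[mu]_x h x = n%:R * a / 2 * \int[mu]_x (fdiff z v x ^+ 2 * hardy_weight rho x) +
    n%:R / a * `|z| ^+ 2 * (2 * l2sq v).
  have b1 := bcs_hardy_fdiff rho z bv; have b2 := bcs_shift z bv2.
  have b3 : bcs (fun x => v (x + z) ^+ 2 + v x ^+ 2) by exact: bcsD.
  rewrite IntD ?IntZ ?IntD//; [|exact: bcsZ|exact: bcsZ].
  by rewrite (Int_shift z bv2) /l2sq; congr (_ + _ * _); ring.
move: e1; rewrite -byparts gE; move: e2; rewrite hE -/eta.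
have -> : n%:R / a * `|z| ^+ 2 * (2 * l2sq v) = `|z| ^+ 2 * (2 * n%:R / a * l2sq v) by ring.
lra.
Qed.

End hardy.

(** * Control by finitely many Fourier coefficients *)

Section compactness.
Context {R : realType} {n : nat}.
Local Notation Rd := 'rV[R]_n.
Local Notation mu := (@lebesgue_rV R n).
Variables (nu : {measure set Rd -> \bar R}) (D : set Rd).
Hypothesis n_gt0 : (0 < n)%N.
Hypothesis mD : measurable D.
Hypothesis D1 : forall z, D z -> `|z| <= 1.
Hypothesis symbol_infty : forall A : R, exists N : R, forall xi,
  N <= `|xi| -> (A%:E <= symbol nu D xi)%E.
Variable sig : R.
Hypothesis sig_gt0 : 0 < sig.
Hypothesis sigE : (\int[nu]_(z in D) (`|z| ^+ 2)%:E = sig%:E)%E.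
Implicit Types (v : Rd -> R) (x z u xi : Rd).

Lemma measurable_hardy_fdiff rho v : bcs v ->
  measurable_fun setT (fun z => (\int[mu]_x (fdiff z v x ^+ 2 * hardy_weight rho x))%:E).
Proof.
move=> bv; have [mv _ _] := bv.
under eq_fun do rewrite (EFin_Int (bcs_hardy_fdiff rho _ bv)).
apply: (measurable_fun_fubini_tonelli_F
  (fun p : Rd * Rd => (fdiff p.1 v p.2 ^+ 2 * hardy_weight rho p.2)%:E)) => [|p].
  apply: measurable_fun_EFin; apply: measurable_funM.
    apply: measurable_funX; apply: measurable_funB.
      apply: (measurableT_comp mv); apply: measurable_fun_rVD.
        exact: measurable_snd.
      exact: measurable_fst.
    exact: (measurableT_comp mv measurable_snd).
  exact: (measurableT_comp (measurable_hardy_weight rho) measurable_snd).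
by rewrite lee_fin mulr_ge0 ?sqr_ge0// hardy_weight_ge0.
Qed.

(** [hardy_difference] integrated in z; the factor |z|^2 becomes the second
    moment sig, by which one divides. *)
Lemma hardy_tail rho (a K : R) v : bcs v -> 0 <= rho -> 0 < a ->
  (\int[nu]_(z in D) (\int[mu]_x (fdiff z v x ^+ 2 * hardy_weight rho x))%:E <= K%:E)%E ->
  \int[mu]_x ((1 - cutoff rho x) * v x ^+ 2) <=
  n%:R * (rho + 2) * l2sq (fun x => cutoff (rho + 2) x * v x) +
  2 * n%:R / a * l2sq v + n%:R * a / (2 * sig) * K.
Proof.
move=> bv rho0 a0 vK.
pose T := \int[mu]_x ((1 - cutoff rho x) * v x ^+ 2); rewrite -/T.
pose B := n%:R * (rho + 2) * l2sq (fun x => cutoff (rho + 2) x * v x) +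
  2 * n%:R / a * l2sq v; rewrite -/B.
have T0 : 0 <= T by apply: Int_ge0 => x; rewrite mulr_ge0 ?sqr_ge0// subr_ge0 cutoff_le1.
have B0 : 0 <= B.
  apply: addr_ge0; apply: mulr_ge0; rewrite ?l2sq_ge0//; first by apply: mulr_ge0 => //; lra.
  by apply: divr_ge0 => //; exact: ltW.
have c0 : 0 <= n%:R * a / 2 by rewrite divr_ge0// mulr_ge0// ltW.
pose I z := \int[mu]_x (fdiff z v x ^+ 2 * hardy_weight rho x).
have I0 z : 0 <= I z by apply: Int_ge0 => x; rewrite mulr_ge0 ?sqr_ge0// hardy_weight_ge0.
have mI : measurable_fun D (fun z => (I z)%:E).
  by apply: measurable_funTS; exact: measurable_hardy_fdiff.
have mz : measurable_fun D (fun z : Rd => (`|z| ^+ 2)%:E).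
  apply: measurable_funTS; apply: measurable_fun_EFin; apply: measurable_funX.
  exact: measurable_fun_normrV.
suff h : (T%:E * sig%:E <= B%:E * sig%:E + (n%:R * a / 2)%:E * K%:E)%E.
  move: h; rewrite -!EFinM -EFinD lee_fin => h.
  rewrite -(ler_pM2r sig_gt0) (le_trans h)// [leRHS]mulrDl lerD2l.
  by rewrite le_eqVlt; apply/orP; left; apply/eqP; field; rewrite gt_eqF.
have zz0 z : (0 <= (`|z| ^+ 2)%:E)%E by rewrite lee_fin sqr_ge0.
have Ie0 z : (0 <= (I z)%:E)%E by rewrite lee_fin.
rewrite -sigE -!ge0_integralZl//.
apply: (@le_trans _ _ (\int[nu]_(z in D) (B%:E * (`|z| ^+ 2)%:E +
    (n%:R * a / 2)%:E * (I z)%:E))%E).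
  apply: ge0_le_integral => //.
  - by move=> z _; apply: mule_ge0; rewrite ?lee_fin.
  - exact: measurable_funeM.
  - by apply: emeasurable_funD; exact: measurable_funeM.
  move=> z Dz; rewrite -!EFinM -EFinD lee_fin.
  rewrite mulrC [B * _]mulrC; exact: hardy_difference (D1 Dz).
rewrite ge0_integralD//.
- rewrite leeD2l// ge0_integralZl//.
  by apply: lee_wpmul2l; rewrite ?lee_fin.
- by move=> z _; apply: mule_ge0; rewrite ?lee_fin.
- exact: measurable_funeM.
- by move=> z _; apply: mule_ge0; rewrite ?lee_fin.
- exact: measurable_funeM.
Qed.

(** [ctrl v e] stands for a form whose value at v is at most e; it dominates
    the translation-invariant form of nu up to a constant, and the form with
    weight |x|^2 near infinity up to an arbitrarily small constant. *)
Variable ctrl : (Rd -> R) -> R -> Prop.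
Hypothesis ctrlP : forall lambda : R, 0 < lambda -> exists c rho : R,
  [/\ 0 < c, 0 <= rho & forall v e, bcs v -> ctrl v e ->
  (\int[nu]_(z in D) (l2sq (fdiff z v))%:E <= (e / c)%:E)%E /\
  (\int[nu]_(z in D) (\int[mu]_x (fdiff z v x ^+ 2 * hardy_weight rho x))%:E <=
    (e / lambda)%:E)%E].

(** The Hardy inequality with a large and then lambda large compared with a
    leaves the mass in a ball, to which the compactness on balls applies. *)
Lemma finite_rank_control eps : 0 < eps -> exists s rho, coef_ge0 s /\
  forall v e, continuous v -> bcs v -> ctrl v e ->
  l2sq v <= eps * (l2sq v + e) +
    \sum_(p <- s) p.1 * pspec (fun x => cutoff rho x * v x) p.2.
Proof.
move=> eps0; have nR0 : 0 < n%:R :> R by rewrite ltr0n.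
(* a makes the coefficient of |v|^2 in the tail equal to eps / 2, and then lambda
   that of e; k plays the same part for the mass in the ball *)
pose a := 4 * n%:R / eps; have a0 : 0 < a by rewrite divr_gt0// mulr_gt0.
pose lambda := n%:R * a / (sig * eps).
have l0 : 0 < lambda by rewrite divr_gt0// mulr_gt0.
have [c [rho [c0 rho0 hc]]] := ctrlP l0.
pose C := n%:R * (rho + 2) + 1.
have nrho : 0 <= n%:R * (rho + 2) by apply: mulr_ge0 => //; lra.
have C0 : 0 < C by rewrite /C; lra.
pose k := eps / (2 * C) * (c / (1 + c)).
have k0 : 0 < k.
  by rewrite mulr_gt0// divr_gt0//; [rewrite mulr_gt0|lra].
have rho2 : 0 <= rho + 2 by lra.
have [s [s0 hs]] := cutoff_finite_rank n_gt0 mD D1 symbol_infty rho2 k0.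
exists [seq (C * p.1, p.2) | p <- s], (rho + 2); split.
  by move=> p /mapP[q /s0 q0 ->] /=; rewrite mulr_ge0// ltW.
move=> v e cv bv ve; have [h1 h2] := hc v e bv ve.
have e0 : 0 <= e.
  have : (0 <= (e / c)%:E)%E.
    by apply: le_trans h1; apply: integral_ge0 => z _; rewrite lee_fin l2sq_ge0.
  by rewrite lee_fin pmulr_lge0// invr_gt0.
have tail := hardy_tail bv rho0 a0 h2.
have loc := hs v _ cv bv h1.
rewrite big_map /=; under eq_bigr do rewrite -mulrA.
rewrite -mulr_sumr; move: loc tail.
set S := \sum_(_ <- _) _; set Q := l2sq (fun x => cutoff _ x * v x).
move=> loc tail.
have bv2 := bcs_sqr bv.
have split_v : l2sq v = \int[mu]_x ((1 - cutoff rho x) * v x ^+ 2) +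
    \int[mu]_x (cutoff rho x * v x ^+ 2).
  rewrite -IntD; [|exact: bcs_co_cutoff|exact: bcs_cutoffM].
  by apply: eq_Rintegral => x _; ring.
have inner : \int[mu]_x (cutoff rho x * v x ^+ 2) <= Q.
  apply: Int_le => [||x]; first exact: bcs_cutoffM.
    by apply: bcs_sqr; exact: bcs_cutoffM.
  rewrite exprMn ler_wpM2r ?sqr_ge0//.
  have [xr|rx] := leP (rho + 1) `|x|; first by rewrite cutoff0// sqr_ge0.
  by rewrite (@cutoff1 _ _ (rho + 2)) ?expr1n ?cutoff_le1//; lra.
have aE : 2 * n%:R / a = eps / 2 by rewrite /a; field; rewrite !gt_eqF.
have lE : n%:R * a / (2 * sig) * (e / lambda) = eps / 2 * e.
  by rewrite /lambda; field; rewrite !gt_eqF.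
rewrite aE lE in tail.
have lv0 := l2sq_ge0 v.
have k1 : C * k * l2sq v <= eps / 2 * l2sq v.
  rewrite ler_wpM2r// /k.
  have -> : C * (eps / (2 * C) * (c / (1 + c))) = eps / 2 * (c / (1 + c)).
    by field; rewrite !gt_eqF//; lra.
  by rewrite ler_piMr ?ler_pdivrMr//; lra.
have k2 : C * k * (e / c) <= eps / 2 * e.
  have -> : C * k * (e / c) = eps / 2 * e * (1 + c)^-1.
    by rewrite /k; field; rewrite !gt_eqF//; lra.
  rewrite ler_piMr//; first by rewrite mulr_ge0//; lra.
  by rewrite invf_le1//; lra.
have CQ : C * Q <= C * (k * (l2sq v + e / c) + S) by rewrite ler_pM2l.
have CE : C * Q = n%:R * (rho + 2) * Q + Q by rewrite /C mulrDl mul1r.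
rewrite mulrDr in CQ.
by rewrite split_v in lv0 k1 CQ tail *; lra.
Qed.

End compactness.

(** * Extraction of a Cauchy subsequence *)

Section extraction.
Context {R : realType} {n : nat}.
Local Notation Rd := 'rV[R]_n.
Local Notation mu := (@lebesgue_rV R n).
Implicit Types (v : Rd -> R).

(** A segment is compact, so the image of an ultrafilter converges there. *)
Lemma bounded_ultra_cvg (U : set_system nat) (x : nat -> R) (B : R) :
  UltraFilter U -> (forall i, `|x i| <= B) ->
  exists l, forall e, 0 < e -> U [set i | `|l - x i| <= e].
Proof.
move=> UU xB.
have UI : U (x @^-1` `[- B, B]).
  rewrite (_ : _ @^-1` _ = setT); first exact: filterT.
  by apply/seteqP; split => // i _; rewrite /= in_itv/= -ler_norml.
have [l [_ xl]] := @segment_compact R (- B) B (x @ U) _ UI.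
exists l => e e0.
have [//|Uc] := in_ultra_setVsetC [set i | `|l - x i| <= e] UU.
have [y [/= yc]] := xl (~` [set y | `|l - y| <= e]) _ Uc (nbhsx_ballx l e e0).
by rewrite /ball/= => /ltW.
Qed.

(** Two values close to the same limit; the bound by 1 turns the distance into
    a bound on its square. *)
Lemma sqr_dist_le (a b l t : R) : 0 < t -> `|l - a| <= Num.min 1 t ->
  `|l - b| <= Num.min 1 t -> (a - b) ^+ 2 <= 4 * t.
Proof.
move=> t0; rewrite !le_min => /andP[a1 at_] /andP[b1 bt].
have h1 : `|a - b| <= 2 /\ `|a - b| <= 2 * t.
  rewrite (_ : a - b = (l - b) - (l - a)); last by ring.
  by have := ler_normB (l - b) (l - a); split; lra.
rewrite -real_normK ?num_real// expr2; case: h1 => h1 h2.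
apply: (@le_trans _ _ (2 * (2 * t))); first exact: ler_pM.
by lra.
Qed.

(** Finite intersections of the A k belong to the ultrafilter and are therefore
    unbounded: choose the indices one after the other. *)
Lemma ultra_subsequence (U : set_system nat) (A : nat -> set nat) :
  UltraFilter U -> (forall m, U [set i | (m < i)%N]) -> (forall k, U (A k)) ->
  exists s : nat -> nat, {homo s : i j / (i < j)%N} /\
    forall k l, (k <= l)%N -> A k (s l).
Proof.
move=> UU Uoo UA; pose B k := [set i | forall l, (l <= k)%N -> A l i].
have UB k : U (B k).
  elim: k => [|k ih].
    by apply: filterS (UA 0%N) => i Ai l; rewrite leqn0 => /eqP ->.
  apply: filterS (filterI ih (UA k.+1)) => i [Bi Ai] l.
  by rewrite leq_eqVlt => /predU1P[->//|lk]; exact: Bi.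
have ex k m : exists i, (m < i)%N /\ B k i.
  have [i [mi Bi]] := filter_ex (filterI (Uoo m) (UB k)).
  by exists i.
have /choice[f fP] km : exists i, (km.2 < i)%N /\ B km.1 i by exact: ex.
pose s := fix s k := if k is k'.+1 then f (k, s k') else f (0%N, 0%N).
have sB k : B k (s k) by case: k => [|k]; [exact: (fP (0, 0)%N).2|exact: (fP (k.+1, s k)).2].
exists s; split; last by move=> k l kl; exact: sB.
apply: homo_ltn; first exact: ltn_trans.
by move=> k; exact: (fP (k.+1, s k)).1.
Qed.

Lemma l2sqD_le v w : bcs v -> bcs w ->
  l2sq (fun x => v x - w x) <= 2 * l2sq v + 2 * l2sq w.
Proof.
move=> bv bw; have b1 := bcs_sqr bv; have b2 := bcs_sqr bw.
rewrite -(IntZ _ b1) -(IntZ _ b2) -IntD; [|exact: bcsZ|exact: bcsZ].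
apply: Int_le => [||x]; first by apply: bcs_sqr; exact: bcsB.
  by apply: bcsD; exact: bcsZ.
by have := sqr_ge0 (v x + w x); lra.
Qed.

Lemma Int_mul_le v w : bcs v -> bcs w ->
  `|\int[mu]_x (v x * w x)| <= l2sq v + l2sq w.
Proof.
move=> bv bw; have b1 := bcs_sqr bv; have b2 := bcs_sqr bw.
have bm := bcsMM bv bw.
have h (c : R) : `|c| = 1 -> c * \int[mu]_x (v x * w x) <= l2sq v + l2sq w.
  move=> c1; rewrite -IntZ// -IntD//; apply: Int_le => [||x].
  - exact: bcsZ.
  - exact: bcsD.
  rewrite (le_trans (ler_norm _))// !normrM c1 mul1r.
  rewrite -(@real_normK _ (v x)) ?num_real// -(@real_normK _ (w x)) ?num_real//.
  have := sqr_ge0 (`|v x| - `|w x|).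
  have := mulr_ge0 (normr_ge0 (v x)) (normr_ge0 (w x)); lra.
rewrite ler_norml; have := h 1 (normr1 _); have := h (-1) (normrN1 _).
by move=> ? ?; apply/andP; split; lra.
Qed.

Lemma fourier_coef_bounded rho (v : Rd -> R) (M : R) (g : Rd -> R) : bcs v -> l2sq v <= M ->
  measurable_fun setT g -> (forall x, `|g x| <= 1) ->
  `|\int[mu]_x (cutoff rho x * v x * g x)| <= M + l2sq (cutoff rho : Rd -> R).
Proof.
move=> bv vM mg g1.
have bc : bcs (cutoff rho : Rd -> R).
  split; first exact: measurable_cutoff.
    by exists 1 => x; rewrite ger0_norm ?cutoff_ge0 ?cutoff_le1.
  by exists (rho + 1) => x xr; rewrite cutoff0// ltW.
have bg : bcs (fun x => cutoff rho x * g x) by exact: (bcsM_bounded bc mg g1).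
have -> : \int[mu]_x (cutoff rho x * v x * g x) = \int[mu]_x (v x * (cutoff rho x * g x)).
  by apply: eq_Rintegral => x _; ring.
rewrite (le_trans (Int_mul_le bv bg))// lerD//.
apply: Int_le => [||x]; [exact: bcs_sqr|exact: bcs_sqr|].
rewrite exprMn ler_piMr ?sqr_ge0// -real_normK ?num_real//.
by rewrite expr_le1.
Qed.

(** Total boundedness, phrased with an ultrafilter: along it every Fourier
    coefficient of the truncated functions converges, and finitely many of them
    control the distance between two terms. One ultrafilter serves all
    the frequencies and radii that occur as eps varies. *)
Lemma cauchy_subsequence (ctrl : (Rd -> R) -> R -> Prop) (phi : nat -> Rd -> R) (M : R) :
  (forall eps, 0 < eps -> exists s rho, coef_ge0 s /\
    forall v e, continuous v -> bcs v -> ctrl v e ->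
    l2sq v <= eps * (l2sq v + e) +
      \sum_(p <- s) p.1 * pspec (fun x => cutoff rho x * v x) p.2) ->
  (forall i, continuous (phi i)) -> (forall i, bcs (phi i)) ->
  (forall i, l2sq (phi i) <= M) ->
  (forall i j, ctrl (fun x => phi i x - phi j x) M) ->
  exists s : nat -> nat, {homo s : i j / (i < j)%N} /\
    forall k i j, (k <= i)%N -> (k <= j)%N ->
      l2sq (fun x => phi (s i) x - phi (s j) x) <= 4^-1 ^+ k.
Proof.
move=> Hctrl cphi bphi phiM phic.
have [U [UU Uoo]] := ultraFilterLemma eventually_filter.
have Ugt m : U [set i | (m < i)%N] by apply: Uoo; exact: nbhs_infty_gt.
have M0 : 0 <= M by rewrite (le_trans (l2sq_ge0 (phi 0%N))).
have key (t : R) : 0 < t -> exists A, U A /\ forall i j, A i -> A j ->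
    l2sq (fun x => phi i x - phi j x) <= t.
  move=> t0.
  pose eps := t / (2 * (5 * M + 1)); have eps0 : 0 < eps.
    by rewrite divr_gt0// mulr_gt0//; lra.
  have [s [rho [s0 hs]]] := Hctrl _ eps0.
  pose S := \sum_(p <- s) p.1; have S0 : 0 <= S.
    by rewrite /S big_seq sumr_ge0// => p /s0.
  pose w i x := cutoff rho x * phi i x.
  have bw i : bcs (w i) by exact: bcs_cutoffM.
  pose dl := t / (32 * (S + 1)).
  have dl0 : 0 < dl by rewrite divr_gt0// mulr_gt0//; lra.
  have dl1 : 0 < Num.min 1 dl by rewrite lt_min ltr01.
  have near_const (g : Rd -> R) : measurable_fun setT g -> (forall x, `|g x| <= 1) ->
      exists2 A, U A & forall i j, A i -> A j ->
        (\int[mu]_x (w i x * g x) - \int[mu]_x (w j x * g x)) ^+ 2 <= 4 * dl.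
    move=> mg g1.
    have [l hl] := bounded_ultra_cvg UU
      (fun i => fourier_coef_bounded rho (bphi i) (phiM i) mg g1).
    exists [set i | `|l - \int[mu]_x (w i x * g x)| <= Num.min 1 dl]; first exact: hl.
    by move=> i j /= hi hj; exact: (sqr_dist_le dl0 hi hj).
  have near_spec (p : R * Rd) : exists2 A, U A & forall i j, A i -> A j ->
      pspec (fun x => w i x - w j x) p.2 <= 8 * dl.
    have [A UA hA] := near_const _ (measurable_cos_dotr p.2) (fun x => cos_max _).
    have [B UB hB] := near_const _ (measurable_sin_dotr p.2) (fun x => sin_max _).
    exists (A `&` B); first exact: filterI.
    move=> i j [Ai Bi] [Aj Bj].
    have -> : pspec (fun x => w i x - w j x) p.2 =
       (fcos (w i) p.2 - fcos (w j) p.2) ^+ 2 + (fsin (w i) p.2 - fsin (w j) p.2) ^+ 2.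
      rewrite /pspec; congr (_ ^+ 2 + _ ^+ 2).
        rewrite -IntB; [|exact: bcs_cos|exact: bcs_cos].
        by apply: eq_Rintegral => x _; rewrite mulrBl.
      rewrite -IntB; [|exact: bcs_sin|exact: bcs_sin].
      by apply: eq_Rintegral => x _; rewrite mulrBl.
    by have := hA i j Ai Aj; have := hB i j Bi Bj; rewrite /fcos /fsin; lra.
  have [A UA hA] : exists2 A, U A & forall i j, A i -> A j ->
      \sum_(p <- s) p.1 * pspec (fun x => w i x - w j x) p.2 <= S * (8 * dl).
    clearbody dl; rewrite /S; elim: {hs S S0 dl0 dl1 near_const} s s0 near_spec => [|p s ih] s0 near_spec.
      by exists setT => [|i j _ _]; [exact: filterT|rewrite !big_nil mul0r].
    have [|A UA hA] := ih _ near_spec.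
      by move=> q qs; apply: s0; rewrite inE qs orbT.
    have [B UB hB] := near_spec p; exists (A `&` B); first exact: filterI.
    move=> i j [Ai Bi] [Aj Bj]; rewrite !big_cons mulrDl lerD ?hA//.
    by rewrite ler_wpM2l ?hB// s0// inE eqxx.
  exists A; split=> // i j Ai Aj.
  have cij : continuous (fun x => phi i x - phi j x).
    by move=> x; exact: (cvgB (cphi i x) (cphi j x)).
  have := hs _ M cij (bcsB (bphi i) (bphi j)) (phic i j).
  have -> : \sum_(p <- s) p.1 * pspec (fun x => cutoff rho x * (phi i x - phi j x)) p.2 =
     \sum_(p <- s) p.1 * pspec (fun x => w i x - w j x) p.2.
    by apply: eq_bigr => p _; congr (_ * pspec _ _); apply/funext => x; rewrite mulrBr.
  have h1 := l2sqD_le (bphi i) (bphi j).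
  have h2 := phiM i; have h3 := phiM j; have h4 := hA i j Ai Aj.
  have h5 : eps * (l2sq (fun x => phi i x - phi j x) + M) <= t / 2.
    apply: (@le_trans _ _ (eps * (5 * M + 1))); first by rewrite ler_pM2l//; lra.
    by rewrite le_eqVlt; apply/orP; left; apply/eqP; rewrite /eps; field; lra.
  have h6 : S * (8 * dl) <= t / 2.
    have -> : S * (8 * dl) = t / 4 * (S / (S + 1)) by rewrite /dl; field; lra.
    have : S / (S + 1) <= 1 by rewrite ler_pdivrMr//; lra.
    by move=> /(ler_wpM2l (_ : 0 <= t / 4)); rewrite mulr1 => h; have := h _; lra.
  by lra.
have /choice[A hA] (k : nat) : exists A, U A /\ forall i j, A i -> A j ->
    l2sq (fun x => phi i x - phi j x) <= 4^-1 ^+ k.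
  by apply: key; rewrite exprn_gt0.
have [s [sm sA]] := ultra_subsequence UU Ugt (fun k => (hA k).1).
by exists s; split => // k i j ki kj; apply: (hA k).2; exact: sA.
Qed.

End extraction.

(** * Completeness of L^2 *)

Section L2_completeness.
Context d (T : measurableType d) (R : realType) (mu : {measure set T -> \bar R}).

Lemma sum_half_le (N : nat) : \sum_(0 <= k < N) 2^-1 ^+ k <= 2 :> R.
Proof.
suff : \sum_(0 <= k < N) 2^-1 ^+ k = 2 - 2 * 2^-1 ^+ N :> R.
  by move=> ->; rewrite gerBl mulr_ge0// exprn_ge0// invr_ge0.
elim: N => [|N ih]; first by rewrite big_geq// expr0; lra.
by rewrite big_nat_recr//= ih exprS; lra.
Qed.

Lemma sqr_ge0E (t : R) : (0 <= (t ^+ 2)%:E)%E.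
Proof. by rewrite lee_fin sqr_ge0. Qed.

(** The squares of the increments f_(k+1) - f_k are summable almost everywhere
    with weights 2^k, hence so are the increments:
    2 |t| <= 2^(-k) + 2^k t^2. *)
Lemma ae_cvg_fast_cauchy (f : nat -> T -> R) :
  (forall k, measurable_fun setT (f k)) ->
  (forall k, \int[mu]_x ((f k.+1 x - f k x) ^+ 2)%:E <= (4^-1 ^+ k)%:E)%E ->
  {ae mu, forall x, cvgn (f ^~ x)}.
Proof.
move=> mf fC.
pose F k x := ((2 ^+ k) * (f k.+1 x - f k x) ^+ 2)%:E.
have F0 k x : (0 <= F k x)%E by rewrite lee_fin mulr_ge0 ?sqr_ge0// exprn_ge0.
have mF k : measurable_fun setT (F k).
  apply/measurable_EFinP; apply: measurable_funM => //; apply: measurable_funX.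
  exact: measurable_funB.
pose G x := (\sum_(k <oo) F k x)%E.
have G0 x : (0 <= G x)%E by apply: nneseries_ge0.
have mG : measurable_fun setT G by apply: ge0_emeasurable_sum.
have intG : mu.-integrable setT G.
  apply/integrableP; split => //.
  under eq_integral do rewrite gee0_abs//.
  rewrite integral_nneseries//.
  apply: (@le_lt_trans _ _ 2%:E); last exact: ltry.
  apply: lime_le.
    by apply: is_cvg_nneseries => k _ _; apply: integral_ge0.
  apply: nearW => N; rewrite (le_trans _ (_ : (\sum_(0 <= k < N) 2^-1 ^+ k)%:E <= _)%E)//; last first.
    by rewrite lee_fin sum_half_le.
  rewrite -sumEFin; apply: lee_sum => k _.
  have -> : (\int[mu]_x F k x = (2 ^+ k)%:E * \int[mu]_x ((f k.+1 x - f k x) ^+ 2)%:E)%E.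
    rewrite -ge0_integralZl//.
    - by apply/measurable_EFinP; apply: measurable_funX; exact: measurable_funB.
    - by move=> x _; exact: sqr_ge0E.
  have -> : (2^-1 ^+ k)%:E = ((2 ^+ k)%:E * (4^-1 ^+ k)%:E)%E :> \bar R.
    by rewrite -EFinM -exprMn; congr ((_ ^+ _)%:E); lra.
  by apply: lee_wpmul2l; rewrite ?lee_fin ?exprn_ge0.
apply: filterS (integrable_ae measurableT intG) => x /(_ I) Gfin.
have : cvgn (series (telescope (f ^~ x))).
  apply: normed_cvg; apply: nondecreasing_is_cvgn.
    by apply: nondecreasing_series => k _ _; exact: normr_ge0.
  exists (2^-1 * (2 + fine (G x))) => _ [N _ <-].
  have h1 : \sum_(0 <= k < N) (2 ^+ k) * (f k.+1 x - f k x) ^+ 2 <= fine (G x).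
    rewrite -lee_fin fineK// -sumEFin.
    by apply: (@nneseries_lim_ge _ (F ^~ x)) => k _ _.
  have h2 := sum_half_le N.
  apply: (@le_trans _ _ (2^-1 * (\sum_(0 <= k < N) 2^-1 ^+ k +
    \sum_(0 <= k < N) (2 ^+ k) * (f k.+1 x - f k x) ^+ 2))); last first.
    by rewrite ler_pM2l ?invr_gt0//; apply: lerD.
  rewrite -big_split /= mulr_sumr; apply: ler_sum => k _; rewrite /telescope.
  set t := f k.+1 x - f k x; rewrite -[t ^+ 2]real_normK ?num_real//.
  set y := `|t|.
  have p0 : 0 < (2 : R) ^+ k by exact: exprn_gt0.
  rewrite exprVn -subr_ge0.
  have -> : 2^-1 * ((2 ^+ k)^-1 + 2 ^+ k * y ^+ 2) - y =
     2^-1 * (2 ^+ k)^-1 * (1 - 2 ^+ k * y) ^+ 2.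
    by field; rewrite gt_eqF.
  by rewrite mulr_ge0 ?sqr_ge0// mulr_ge0 ?invr_ge0 ?ltW.
rewrite telescopeK => h.
have -> : f ^~ x = (fun k => f 0%N x + (f k x - f 0%N x)) by apply/funext => k; ring.
by apply: is_cvgD => //; exact: is_cvg_cst.
Qed.

(** The limit exists almost everywhere, and Fatou's lemma passes to it in the
    Cauchy estimate. Its everywhere defined representative is the upper limit. *)
Lemma L2_complete (f : nat -> T -> R) :
  (forall k, measurable_fun setT (f k)) ->
  (forall k i j, (k <= i)%N -> (k <= j)%N ->
    \int[mu]_x ((f i x - f j x) ^+ 2)%:E <= (4^-1 ^+ k)%:E)%E ->
  exists2 g : T -> R, measurable_fun setT g &
    forall k, (\int[mu]_x ((f k x - g x) ^+ 2)%:E <= (4^-1 ^+ k)%:E)%E.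
Proof.
move=> mf fC.
have aecvg := ae_cvg_fast_cauchy mf (fun k => fC k k.+1 k (leqnSn k) (leqnn k)).
pose ge x := limn_esup (fun k => (f k x)%:E).
have mge : measurable_fun setT ge.
  by apply: measurable_fun_limn_esup => k; exact/measurable_EFinP.
pose g x := fine (ge x).
have mg : measurable_fun setT g.
  exact: (measurableT_comp (fine_measurable measurableT) mge).
have gE x : cvgn (f ^~ x) -> f ^~ x @ \oo --> g x.
  move=> cx; rewrite /g /ge is_cvg_limn_esupE.
    by rewrite EFin_lim.
  by apply/cvg_ex; exists (lim (f ^~ x @ \oo))%:E; apply: cvg_EFin => //; exact: nearW.
exists g => // k.
have mD i j : measurable_fun setT (fun x => ((f i x - f j x) ^+ 2)%:E).
  by apply/measurable_EFinP; apply: measurable_funX; exact: measurable_funB.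
pose u x j := ((f k x - f (j + k)%N x) ^+ 2)%:E.
have u0 x j : (0 <= u x j)%E by rewrite lee_fin sqr_ge0.
have einf0 x : (0 <= limn_einf (u x))%E.
  rewrite limn_einf_lim; apply: lime_ge; first exact: is_cvg_einfs.
  by apply: nearW => m; apply: le_ereal_inf_tmp => _ [j _ <-].
apply: (@le_trans _ _ (\int[mu]_x limn_einf (u x))%E).
  apply: ae_ge0_le_integral => //.
  - by move=> x _; exact: sqr_ge0E.
  - by apply/measurable_EFinP; apply: measurable_funX; exact: measurable_funB.
  - rewrite /limn_einf; apply: measurableT_comp => //.
    apply: measurable_fun_limn_esup => j; apply: measurableT_comp => //.
    exact: mD.
  apply: filterS aecvg => x /gE gx _.
  have cu : u x @ \oo --> ((f k x - g x) ^+ 2)%:E.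
    apply: cvg_EFin; first exact: nearW.
    have h : f (j + k)%N x @[j --> \oo] --> g x by rewrite (cvg_shiftn k (f ^~ x)).
    have h2 : f k x - f (j + k)%N x @[j --> \oo] --> f k x - g x.
      by apply: cvgB => //; exact: cvg_cst.
    by apply: (cvg_trans _ (cvgM h2 h2)).
  rewrite is_cvg_limn_einfE; last by apply/cvg_ex; eexists; exact: cu.
  by rewrite (cvg_lim _ cu).
have mu_ j : measurable_fun setT (u ^~ j) by exact: mD.
apply: (le_trans (fatou mu measurableT mu_ (fun j x _ => u0 x j))).
rewrite limn_einf_lim; apply: lime_le; first exact: is_cvg_einfs.
apply: nearW => m; apply: (@le_trans _ _ (\int[mu]_x u x m)%E).
  by apply: ereal_inf_lbound; exists m => //=.
by apply: fC => //; exact: leq_addl.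
Qed.

End L2_completeness.

(** * Growth of the symbol at infinity *)

(** Monotonicity for functions that need not be measurable: the integral of a
    nonnegative function is a supremum over the simple functions below it. *)
Lemma ge0_le_integralT d (T : measurableType d) (R : realType)
    (m : {measure set T -> \bar R}) (f g : T -> \bar R) :
  (forall x, 0 <= f x)%E -> (forall x, f x <= g x)%E ->
  (\int[m]_x f x <= \int[m]_x g x)%E.
Proof.
move=> f0 fg; have g0 x : (0 <= g x)%E by exact: le_trans (fg x).
rewrite !ge0_integralTE//; apply: le_ereal_sup => _ [h hf <-].
by exists h => // x; exact: le_trans (fg x).
Qed.

Section symbol_growth.
Context {R : realType} {n : nat}.
Local Notation Rd := 'rV[R]_n.
Local Notation mu := (@lebesgue_rV R n).
Variables (nu : {measure set Rd -> \bar R}) (D : set Rd).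
Hypothesis n_gt0 : (0 < n)%N.
Hypothesis mD : measurable D.
Variable sig : R.
Hypothesis sigE : (\int[nu]_(z in D) (`|z| ^+ 2)%:E = sig%:E)%E.
Hypothesis beta_lty : (\int[mu]_xi expeR (- symbol nu D xi) < +oo)%E.
Implicit Types (x z u xi : Rd).

Lemma symbol_ge0 xi : (0 <= symbol nu D xi)%E.
Proof. by apply: integral_ge0 => z _; rewrite lee_fin one_sub_cos_ge0. Qed.

Let mcos xi : measurable_fun D (fun z => (1 - cos (dotr z xi))%:E).
Proof.
apply: measurable_funTS; apply: measurable_fun_EFin; apply: measurable_funB => //.
by under eq_fun do rewrite dotrC; exact: measurable_cos_dotr.
Qed.

Lemma symbol_le_quadratic xi :
  (symbol nu D xi <= ((n%:R * `|xi|) ^+ 2 / 2 * sig)%:E)%E.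
Proof.
have c0 : 0 <= (n%:R * `|xi|) ^+ 2 / 2 by rewrite divr_ge0// sqr_ge0.
have mz : measurable_fun D (fun z : Rd => (`|z| ^+ 2)%:E).
  apply: measurable_funTS; apply: measurable_fun_EFin; apply: measurable_funX.
  exact: measurable_fun_normrV.
have z0 z : (0 <= (`|z : Rd| ^+ 2)%:E)%E by rewrite lee_fin sqr_ge0.
rewrite EFinM -sigE -ge0_integralZl//.
apply: ge0_le_integral => //.
- exact: measurable_funeM.
move=> z _; rewrite -EFinM lee_fin (le_trans (one_sub_cos_le _))//.
rewrite [leRHS]mulrAC ler_pM2r// -exprMn -real_normK ?num_real//.
rewrite lerXn2r ?nnegrE ?mulr_ge0// (le_trans (dotr_le _ _))//.
by rewrite -mulrA (mulrC `|z|).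
Qed.

(** 1 - cos (a + b) <= 2 (1 - cos a) + 2 (1 - cos b), that is,
    |e^(i (a + b)) - 1|^2 <= 2 |e^(i a) - 1|^2 + 2 |e^(i b) - 1|^2. *)
Lemma symbol_triangle xi eta :
  (symbol nu D (xi + eta) <= 2%:E * symbol nu D xi + 2%:E * symbol nu D eta)%E.
Proof.
have c0 t z : (0 <= (1 - cos (dotr z t))%:E :> \bar R)%E by rewrite lee_fin one_sub_cos_ge0.
have mc t : measurable_fun D (fun z => 2%:E * (1 - cos (dotr z t))%:E)%E.
  exact: measurable_funeM.
have c2 t z : (0 <= 2%:E * (1 - cos (dotr z t))%:E :> \bar R)%E by exact: mule_ge0.
rewrite -!ge0_integralZl// -ge0_integralD//.
apply: ge0_le_integral => //; first exact: emeasurable_funD.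
move=> z _; rewrite -!EFinM -EFinD lee_fin dotrDr cosD.
have := cos2Dsin2 (dotr z xi); have := cos2Dsin2 (dotr z eta).
move: (cos _) (sin _) (cos (dotr z xi)) (sin (dotr z xi)) => c s a b h1 h2.
have h3 := sqr_ge0 (b - s); have h4 := sqr_ge0 (a + c - 2).
lra.
Qed.

(** Otherwise the symbol is bounded by a constant C on unit balls arbitrarily
    far away, and so on any number of disjoint ones; each of them contributes
    at least kappa, which is e^(- C) times its volume, to the integral of
    e^(- phi). *)
Lemma symbol_infty (A : R) : exists N : R, forall xi,
  N <= `|xi| -> (A%:E <= symbol nu D xi)%E.
Proof.
apply/not_existsP => hN.
have small N : exists2 xi, N <= `|xi| & (symbol nu D xi < A%:E)%E.
  have /existsNP[xi /not_implyP[h1 /negP]] := hN N.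
  by rewrite -ltNge; exists xi.
have sig0 : 0 <= sig.
  by rewrite -lee_fin -sigE; apply: integral_ge0 => z _; rewrite lee_fin sqr_ge0.
have [xi0 _ A0] := small 0; have A1 : 0 < A.
  by rewrite -lte_fin (le_lt_trans _ A0)// symbol_ge0.
pose C := 2 * A + 2 * (n%:R ^+ 2 / 2 * sig).
have ballC xi eta : (symbol nu D xi < A%:E)%E -> `|eta| <= 1 ->
    (symbol nu D (xi + eta) <= C%:E)%E.
  move=> xiA eta1; rewrite (le_trans (symbol_triangle _ _))//.
  have -> : C%:E = (2%:E * A%:E + 2%:E * (n%:R ^+ 2 / 2 * sig)%:E)%E.
    by rewrite -!EFinM -EFinD.
  apply: leeD; first by apply: lee_wpmul2l => //; exact: ltW.
  apply: lee_wpmul2l => //; rewrite (le_trans (symbol_le_quadratic _))//.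
  rewrite lee_fin ler_wpM2r// ler_wpM2r// exprMn ler_piMr ?sqr_ge0//.
  by rewrite expr_le1.
pose kappa := expR (- C) * 2 ^+ n.
have k0 : 0 < kappa by rewrite mulr_gt0 ?expR_gt0// exprn_gt0.
(* a sum of N disjoint bumps below e^(- phi) *)
have build (N : nat) : exists g : Rd -> R, [/\ bcs g, forall x, 0 <= g x,
    forall x, ((g x)%:E <= expeR (- symbol nu D x))%E &
    \int[mu]_x g x = N%:R * kappa].
  elim: N => [|N [g [bg g0 gf gN]]].
    exists (cst 0); split => //; first exact: bcs0.
      by move=> x; exact: expeR_ge0.
    by rewrite Rintegral_cst// !mul0r.
  have [M [r [M0 r0 gM gr]]] := bcs_bounds bg.
  have [xi xir xiA] := small (r + 2).
  pose b x := expR (- C) * \1_(supball 1) (x + (- xi)).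
  have b1 : bcs (fun x : Rd => expR (- C) * \1_(supball 1) x).
    by apply: bcsZ; exact: bcs_indic.
  have bb : bcs b by exact: (bcs_shift (- xi) b1).
  exists (fun x => g x + b x); split.
  - exact: bcsD.
  - by move=> x; rewrite addr_ge0// mulr_ge0// expR_ge0.
  - move=> x; have [x1|x1] := leP `|x - xi| 1; last first.
      rewrite /b indicE memNset; last by apply/negP; rewrite -ltNge.
      by rewrite mulr0 addr0.
    have xr : r < `|x|.
      have := ler_normB x (x - xi); rewrite opprB addrC subrK => h.
      lra.
    rewrite gr// add0r /b indicE mem_set// mulr1.
    have := ballC xi (x - xi) xiA x1; rewrite addrC subrK.
    move=> h; rewrite -[(expR _)%:E]/(expeR (- C)%:E) lee_expeR.
    by rewrite EFinN leeN2.
  - rewrite IntD// gN -natr1 mulrDl mul1r; congr (_ + _).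
    by rewrite /b (Int_shift (- xi) b1) Int_indic// mulr1.
have Ilty := beta_lty; set I := (\int[mu]_xi _)%E in Ilty.
have I0 : (0 <= I)%E by apply: integral_ge0 => x _; exact: expeR_ge0.
have [g [bg g0 gf gN]] := build (Num.truncn (fine I / kappa)).+1.
have : ((\int[mu]_x g x)%:E <= I)%E.
  by rewrite EFin_Int//; apply: ge0_le_integralT => // x; rewrite lee_fin.
rewrite gN -[I]fineK ?ge0_fin_numE// lee_fin -ler_pdivlMr//.
by rewrite leNgt truncnS_gt.
Qed.

(** The symbol is at most a multiple of sig, and is not identically zero. *)
Lemma sig_gt0 : 0 < sig.
Proof.
have sig0 : 0 <= sig.
  by rewrite -lee_fin -sigE; apply: integral_ge0 => z _; rewrite lee_fin sqr_ge0.
rewrite lt_neqAle sig0 andbT; apply/eqP => s0.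
have [N hN] := symbol_infty 1.
pose xi : Rd := const_mx `|N|.
have : N <= `|xi|.
  rewrite (le_trans (ler_norm N))//.
  by have := coord_le_normrV xi (Ordinal n_gt0); rewrite mxE normr_id.
move=> /hN; rewrite leNgt => /negP; apply.
by rewrite (le_lt_trans (symbol_le_quadratic _))// -s0 mulr0 lte_fin.
Qed.

End symbol_growth.

(** * Comparison of the energy with translation-invariant forms *)

Section restriction.
Context {R : realType} {n : nat}.
Local Notation Rd := 'rV[R]_n.
Variables (nu : {measure set Rd -> \bar R}) (D : set Rd).
Hypothesis mD : measurable D.
Hypothesis D0 : ~ D 0.
Hypothesis momentD : (\int[nu]_(z in D) (`|z| ^+ 2)%:E < +oo)%E.

(** |z|^2 is positive on D and integrable, so D is the union of the sets where
    |z| >= 1 / (k + 1), which have finite mass. *)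
Lemma restriction_sigma_finite : exists nu' : {sigma_finite_measure set Rd -> \bar R},
  forall A, nu' A = nu (A `&` D).
Proof.
have mz : measurable_fun setT (fun z : Rd => (`|z| ^+ 2)%:E).
  apply: measurable_fun_EFin; apply: measurable_funX; exact: measurable_fun_normrV.
(* the complement of D is added to cover the whole space; it has mass zero *)
pose F k := [set z : Rd | k.+1%:R^-1 <= `|z|] `|` ~` D.
have mF1 k : measurable [set z : Rd | k.+1%:R^-1 <= `|z|].
  have -> : [set z : Rd | k.+1%:R^-1 <= `|z|] = (fun z : Rd => `|z|) @^-1` `[k.+1%:R^-1, +oo[.
    by apply/seteqP; split => z /=; rewrite in_itv /= andbT.
  by rewrite -[X in measurable X]setTI; apply: measurable_fun_normrV.
have sF : sigma_finite setT (mrestr nu mD).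
  exists F.
    apply/seteqP; split => // z _.
    have [Dz|nDz] := pselect (D z); last by exists 0%N => //; right.
    have z0 : 0 < `|z| by rewrite normr_gt0; apply/eqP => z0; apply: D0; rewrite -z0.
    exists (Num.truncn (`|z|^-1)) => //; left => /=.
    by rewrite invf_ple ?posrE// ltW// truncnS_gt.
  move=> k; split; first by apply: measurableU; [exact: mF1|exact: measurableC].
  rewrite /mrestr; set A := F k `&` D.
  have mA : measurable A.
    apply: measurableI => //.
    by apply: measurableU; [exact: mF1|exact: measurableC].
  have AD : A `<=` D by apply: subIsetr.
  pose c : R := (k.+1%:R^-1) ^+ 2.
  have c0 : 0 < c by rewrite exprn_gt0// invr_gt0.
  have h : (c%:E * nu A <= \int[nu]_(z in D) (`|z| ^+ 2)%:E)%E.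
    have m1 : measurable_fun D (fun z : Rd => (\1_A z)%:E : \bar R).
      by apply: measurable_funTS; apply: measurable_fun_EFin; exact: measurable_indic.
    have -> : nu A = (\int[nu]_(z in D) (\1_A z)%:E)%E.
      by rewrite integral_indic// setIidl.
    have c0' : (0 <= c%:E)%E by rewrite lee_fin ltW.
    rewrite -ge0_integralZl//.
    apply: ge0_le_integral => //.
    - by move=> z _; apply: mule_ge0; rewrite ?lee_fin.
    - exact: measurable_funeM.
    - exact: measurable_funTS.
    move=> z Dz; rewrite -EFinM lee_fin indicE.
    have [/set_mem [[/= kz|//] _]|_] := boolP (z \in A); last by rewrite mulr0 sqr_ge0.
    by rewrite mulr1 lerXn2r ?nnegrE ?invr_ge0.
  have : (c%:E * nu A < +oo)%E by exact: le_lt_trans momentD.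
  case: (nu A) (measure_ge0 nu A) => [r _ _||]; first exact: ltry.
    by rewrite gt0_muley ?lte_fin.
  by [].
pose nu' : {sigma_finite_measure set Rd -> \bar R} :=
  HB.pack (mrestr nu mD) (@Measure_isSigmaFinite.Build _ _ _ (mrestr nu mD) sF).
by exists nu'.
Qed.

End restriction.

Section kernel_lower_bound.
Context {R : realType} {n : nat}.
Local Notation Rd := 'rV[R]_n.
Variables (J : R.-ker Rd ~> Rd) (nu nu' : {measure set Rd -> \bar R}).
Variable D : set Rd.
Hypothesis mD : measurable D.
Hypothesis D1 : forall z, D z -> enorm z < 1.
Hypothesis nu'E : forall A, nu' A = nu (A `&` D).
Hypothesis J_nu : forall (x : Rd) (A : set Rd), measurable A ->
  A `<=` [set z | enorm z < 1] -> (nu A <= J x [set (x + z)%R | z in A])%E.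

(** The hypothesis compares J(x, dy) with the image of nu under z |-> x + z. *)
Lemma kernel_ge x (f : Rd -> \bar R) : measurable_fun setT f ->
  (forall y, 0 <= f y)%E ->
  (\int[nu']_z f (x + z)%R <= \int[J x]_y f y)%E.
Proof.
move=> mf f0.
have mx : measurable_fun setT (fun z : Rd => x + z) by exact: measurable_fun_rVD.
have mNx : measurable_fun setT (fun z : Rd => z - x).
  by apply: measurable_fun_rVD; [exact: measurable_id|exact: measurable_cst].
have -> : (\int[nu']_z f (x + z)%R = \int[pushforward nu' (fun z : Rd => (x + z)%R)]_y f y)%E.
  by rewrite (ge0_integral_pushforward mx nu' measurableT)// preimage_setT.
apply: ge0_le_measure_integral => // A mA.
rewrite /pushforward [X in (X <= _)%E]nu'E.
set B := _ `&` D.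
have mB : measurable B.
  by apply: measurableI => //; rewrite -[X in measurable X]setTI; exact: mx.
have BI : [set x + z | z in B] = (fun y => y - x) @^-1` B.
  apply/seteqP; split => y /=; first by move=> [z Bz <-]; rewrite addrC addKr.
  by move=> By; exists (y - x) => //; rewrite addrC subrK.
rewrite (le_trans (J_nu x mB _))//; first by move=> z [_ /D1].
apply: le_measure; rewrite ?inE//.
  by rewrite BI -[X in measurable X]setTI; exact: mNx.
by move=> _ [z [Az _] <-].
Qed.

End kernel_lower_bound.

Section energy_lower_bound.
Context {R : realType} {n : nat}.
Local Notation Rd := 'rV[R]_n.
Local Notation mu := (@lebesgue_rV R n).
Variables (J : R.-ker Rd ~> Rd) (W : Rd -> Rd -> R).
Variables (nu : {measure set Rd -> \bar R}) (nu' : {sigma_finite_measure set Rd -> \bar R}).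
Variable D : set Rd.
Hypothesis mD : measurable D.
Hypothesis D1 : forall z, D z -> enorm z < 1.
Hypothesis nu'E : forall A, nu' A = nu (A `&` D).
Hypothesis W_ge0 : forall x y, 0 <= W x y.
Hypothesis W_meas : measurable_fun setT (fun p : Rd * Rd => W p.1 p.2).
Hypothesis J_nu : forall (x : Rd) (A : set Rd), measurable A ->
  A `<=` [set z | enorm z < 1] -> (nu A <= J x [set (x + z)%R | z in A])%E.
Implicit Types (u v : Rd -> R) (x z : Rd).

Definition admissible (g : Rd -> R) := [/\ measurable_fun setT g,
  forall x, 0 <= g x & forall x z, enorm z < 1 -> g x <= W x (x + z)].

Definition weighted_form (g : Rd -> R) u : \bar R :=
  (\int[nu']_(z in D) \int[mu]_x (fdiff z u x ^+ 2 * g x)%:E)%E.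

Lemma measurable_form_integrand g u : measurable_fun setT g ->
  measurable_fun setT u ->
  measurable_fun setT (fun p : Rd * Rd => (fdiff p.1 u p.2 ^+ 2 * g p.2)%:E).
Proof.
move=> mg mv; apply: measurable_fun_EFin; apply: measurable_funM.
  apply: measurable_funX; apply: measurable_funB.
    apply: (measurableT_comp mv); apply: measurable_fun_rVD.
      exact: measurable_snd.
    exact: measurable_fst.
  exact: (measurableT_comp mv measurable_snd).
exact: (measurableT_comp mg measurable_snd).
Qed.

(** Tonelli, which requires the sigma-finite measure nu', exchanges x and z;
    then nu' is replaced by the larger kernel J(x, dy) for each x. *)
Lemma weighted_form_le_energy g u : admissible g -> measurable_fun setT u ->
  (weighted_form g u <= energy J W u)%E.
Proof.
move=> [mg g0 gW] mv.
pose F (p : Rd * Rd) : \bar R := (fdiff p.1 u p.2 ^+ 2 * g p.2 * \1_D p.1)%:E.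
have F0 p : (0 <= F p)%E
  by rewrite lee_fin; apply: mulr_ge0 => //; apply: mulr_ge0 => //; exact: sqr_ge0.
have mF : measurable_fun setT F.
  rewrite /F; under eq_fun do rewrite EFinM.
  apply: emeasurable_funM; first exact: measurable_form_integrand.
  apply: measurable_fun_EFin.
  exact: (measurableT_comp (measurable_indic mD) measurable_fst).
have -> : weighted_form g u = (\int[nu']_z \int[mu]_x F (z, x))%E.
  rewrite /weighted_form integral_mkcond; apply: eq_integral => z _.
  rewrite patchE /F /= indicE; case: ifPn => zD.
    by under [RHS]eq_integral do rewrite mulr1.
  by under [RHS]eq_integral do rewrite mulr0; rewrite integral0.
rewrite fubini_tonelli//; apply: ge0_le_integralT => x.
  by apply: integral_ge0 => z _.
apply: (@le_trans _ _ (\int[nu']_z ((u x - u (x + z)%R) ^+ 2 * W x (x + z)%R)%:E)%E).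
  apply: ge0_le_integralT => // z; rewrite lee_fin /F /= indicE.
  have [/set_mem/D1 zD|_] := boolP (z \in D); last first.
    by rewrite mulr0 mulr_ge0// sqr_ge0.
  rewrite mulr1; apply: ler_pM => //; first exact: sqr_ge0.
    by rewrite /fdiff -sqrrN opprB.
  exact: gW.
apply: (@kernel_ge _ _ J nu nu' D mD D1 nu'E J_nu x (fun y => ((u x - u y) ^+ 2 * W x y)%:E)).
  apply: measurable_fun_EFin; apply: measurable_funM.
    by apply: measurable_funX; apply: measurable_funB.
  exact: (measurableT_comp W_meas (measurable_pair1 x)).
by move=> y; rewrite lee_fin mulr_ge0// sqr_ge0.
Qed.

(** Differences of test functions are handled by this bound rather than by the
    energy itself: an iterated integral against the product of two measures is
    additive for jointly measurable integrands, which gives [form_ctrlB]. *)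
Definition form_ctrl u (e : R) := forall g, admissible g -> (weighted_form g u <= e%:E)%E.

Lemma form_ctrlB u v a b : measurable_fun setT u -> measurable_fun setT v ->
  form_ctrl u a -> form_ctrl v b -> form_ctrl (fun x => u x - v x) (2 * a + 2 * b).
Proof.
move=> mu_ mv ua vb g ag; have [mg g0 _] := ag.
pose H w (p : Rd * Rd) : \bar R := (fdiff p.1 w p.2 ^+ 2 * g p.2)%:E.
have H0 w p : (0 <= H w p)%E by rewrite lee_fin; apply: mulr_ge0 => //; exact: sqr_ge0.
have mH w : measurable_fun setT w -> measurable_fun setT (H w).
  by move=> mw; exact: measurable_form_integrand.
have mHz w z : measurable_fun setT w -> measurable_fun setT (fun x => H w (z, x)).
  by move=> /mH mw; exact: (measurableT_comp mw (measurable_pair1 z)).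
have mI w : measurable_fun setT w -> measurable_fun D (fun z => \int[mu]_x H w (z, x))%E.
  move=> /mH mw; apply: measurable_funTS.
  exact: (measurable_fun_fubini_tonelli_F (H w)).
have I0 w z : (0 <= \int[mu]_x H w (z, x))%E by exact: integral_ge0.
have -> : (2 * a + 2 * b)%:E = (2%:E * a%:E + 2%:E * b%:E)%E by rewrite -!EFinM -EFinD.
apply: (@le_trans _ _ (2%:E * weighted_form g u + 2%:E * weighted_form g v)%E); last first.
  by apply: leeD; apply: lee_wpmul2l => //; [exact: ua|exact: vb].
have I2 w z : (0 <= 2%:E * \int[mu]_x H w (z, x))%E by apply: mule_ge0.
have mI2 w : measurable_fun setT w -> measurable_fun D (fun z => 2%:E * \int[mu]_x H w (z, x))%E.
  by move=> /mI mw; exact: measurable_funeM.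
have ZE w : measurable_fun setT w -> (2%:E * weighted_form g w =
    \int[nu']_(z in D) (2%:E * \int[mu]_x H w (z, x)))%E.
  by move=> mw; rewrite ge0_integralZl//; exact: mI.
rewrite !ZE// -ge0_integralD//; [|exact: mI2|exact: mI2].
have muv : measurable_fun setT (fun x => u x - v x) by exact: measurable_funB.
apply: ge0_le_integral => //.
- by move=> z _; exact: (I0 (fun x => u x - v x)).
- exact: (mI _ muv).
- by apply: emeasurable_funD; exact: mI2.
move=> z _.
have m2 w : measurable_fun setT w -> measurable_fun setT (fun x => 2%:E * H w (z, x))%E.
  by move=> /(mHz _ z) mw; exact: measurable_funeM.
have H2 w x : (0 <= 2%:E * H w (z, x))%E by apply: mule_ge0.
have ZE2 w : measurable_fun setT w -> (2%:E * \int[mu]_x H w (z, x) =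
    \int[mu]_x (2%:E * H w (z, x)))%E.
  by move=> mw; rewrite ge0_integralZl//; exact: mHz.
rewrite !ZE2// -ge0_integralD//; [|exact: m2|exact: m2].
apply: ge0_le_integral => //.
- by move=> x _; exact: (H0 (fun x => u x - v x) (z, x)).
- exact: (mHz _ z muv).
- by apply: emeasurable_funD; exact: m2.
move=> x _; rewrite /H -!EFinM -EFinD lee_fin /= !mulrA -mulrDl ler_wpM2r//.
have -> : fdiff z (fun x => u x - v x) x = fdiff z u x - fdiff z v x.
  by rewrite /fdiff; ring.
by have := sqr_ge0 (fdiff z u x + fdiff z v x); lra.
Qed.

End energy_lower_bound.

(** * Slopes of midpoint convex functions *)

Section midpoint_convex.
Context {R : realType}.
Variable psi : R -> R.
Hypothesis psi_nincr : forall a b, 0 <= a -> a <= b -> psi b <= psi a.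
Hypothesis psi_mid : forall a b, 0 <= a -> 0 <= b ->
  psi ((a + b) / 2) <= (psi a + psi b) / 2.

Lemma decrement_nincr a h (i j : nat) : 0 <= a -> 0 <= h -> (i <= j)%N ->
  psi (a + j%:R * h) - psi (a + j.+1%:R * h) <=
  psi (a + i%:R * h) - psi (a + i.+1%:R * h).
Proof.
move=> a0 h0; elim: j => [|j ih]; first by rewrite leqn0 => /eqP ->.
rewrite leq_eqVlt => /predU1P[->//|ij]; apply: le_trans (ih ij).
have pos (k : nat) : 0 <= a + k%:R * h by rewrite addr_ge0// mulr_ge0.
have := psi_mid (pos j) (pos j.+2).
have -> : (a + j%:R * h + (a + j.+2%:R * h)) / 2 = a + j.+1%:R * h.
  by rewrite -(natr1 j.+1) -(natr1 j); field.
by lra.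
Qed.

Lemma sum_decrement a h (m : nat) :
  \sum_(0 <= k < m) (psi (a + k%:R * h) - psi (a + k.+1%:R * h)) =
  psi a - psi (a + m%:R * h).
Proof.
elim: m => [|m ih]; first by rewrite big_geq// mul0r addr0 subrr.
by rewrite big_nat_recr//= ih; ring.
Qed.

(** Chebyshev: the mean of the first m of p nonincreasing decrements is at
    least the mean of all of them. *)
Lemma decrement_mean a h (m p : nat) : 0 <= a -> 0 <= h -> (m <= p)%N ->
  m%:R * (psi a - psi (a + p%:R * h)) <= p%:R * (psi a - psi (a + m%:R * h)).
Proof.
move=> a0 h0 mp.
have dm (q : nat) : (m <= q)%N -> m%:R * (psi (a + q%:R * h) - psi (a + q.+1%:R * h)) <=
    psi a - psi (a + m%:R * h).
  move=> mq; rewrite -sum_decrement mulr_natl -[in leLHS](subn0 m) -sumr_const_nat.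
  rewrite big_nat [leRHS]big_nat; apply: ler_sum => k /andP[_ km].
  by apply: decrement_nincr => //; exact: ltnW (leq_trans km mq).
elim: p mp => [|p ih]; first by rewrite leqn0 => /eqP ->.
rewrite leq_eqVlt => /predU1P[->//|mp]; rewrite -[p.+1%:R in leRHS]natr1.
by have := dm p mp; have := ih mp; lra.
Qed.

(** For s and t commensurable this is [decrement_mean]. In general the interval
    of length t is cut into N steps, and s is rounded down to a whole number m
    of steps, monotonicity of psi absorbing the difference; the error is a
    multiple of 1 / N. *)
Lemma slope_nincr a s t : 0 <= a -> 0 < s -> s <= t ->
  t^-1 * (psi a - psi (a + t)) <= s^-1 * (psi a - psi (a + s)).
Proof.
move=> a0 s0 st; have t0 : 0 < t by exact: lt_le_trans st.
have Y0 : 0 <= psi a - psi (a + t) by rewrite subr_ge0 psi_nincr//; lra.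
suff : s / t * (psi a - psi (a + t)) <= psi a - psi (a + s).
  by rewrite ler_pdivlMl// mulrA.
apply/ler_addgt0Pr => e e0.
pose Y := psi a - psi (a + t); rewrite -/Y.
pose N := (Num.truncn (Y / e)).+1.
have N0 : 0 < N%:R :> R by rewrite ltr0n.
have YN : Y / e < N%:R by exact: truncnS_gt.
pose h := t / N%:R; have h0 : 0 < h by rewrite divr_gt0.
pose m := Num.truncn (s / h).
have sh0 : 0 <= s / h by rewrite divr_ge0 ?ltW.
have ms' : m%:R <= s / h by rewrite /m truncn_le.
have ms : m%:R * h <= s by rewrite -ler_pdivlMr.
have sm : s / h < m.+1%:R by exact: truncnS_gt.
have mN : (m <= N)%N.
  rewrite -(ler_nat R) (le_trans ms')//.
  rewrite ler_pdivrMr// (le_trans st)// /h mulrCA divff ?mulr1// gt_eqF//.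
have := @decrement_mean a h m N a0 (ltW h0) mN.
have -> : N%:R * h = t by rewrite /h mulrCA divff ?mulr1// gt_eqF.
rewrite -/Y => hm.
have mono : psi (a + s) <= psi (a + m%:R * h).
  by apply: psi_nincr; rewrite ?lerD2l// addr_ge0// mulr_ge0// ltW.
have h1 : m%:R * Y <= N%:R * (psi a - psi (a + s)).
  by rewrite (le_trans hm)// ler_pM2l//; lra.
have h2 : (s / h - 1) * Y <= m%:R * Y.
  by rewrite ler_wpM2r//; move: sm; rewrite -natr1; lra.
have h3 : s / h = N%:R * (s / t) by rewrite /h; field; rewrite !gt_eqF.
have h4 : Y <= N%:R * e by move: YN; rewrite ltr_pdivrMr// => /ltW.
rewrite -(ler_pM2l N0); rewrite h3 in h2; lra.
Qed.

(** Convexity: a slope to the right of a is at most the slope from 0 to a. *)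
Lemma slope_le_initial a s : 0 < a -> 0 < s ->
  s^-1 * (psi a - psi (a + s)) <= a^-1 * (psi 0 - psi a).
Proof.
move=> a0 s0; pose N := (Num.truncn (a / s)).+1.
have N0 : 0 < N%:R :> R by rewrite ltr0n.
pose h := a / N%:R; have h0 : 0 < h by rewrite divr_gt0.
have hs : h <= s.
  by rewrite ler_pdivrMr// -ler_pdivrMl// mulrC ltW// truncnS_gt.
apply: (le_trans (slope_nincr (ltW a0) h0 hs)).
have Nh : N%:R * h = a by rewrite /h mulrCA divff ?mulr1// gt_eqF.
have : N%:R * (psi a - psi (a + h)) <= psi 0 - psi a.
  have := sum_decrement 0 h N; rewrite !add0r Nh => <-.
  rewrite mulr_natl -[in leLHS](subn0 N) -sumr_const_nat.
  rewrite big_nat [leRHS]big_nat; apply: ler_sum => k /andP[_ kN].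
  have := @decrement_nincr 0 h k N (lexx _) (ltW h0) (ltnW kN).
  by rewrite !add0r -natr1 mulrDl mul1r Nh.
move=> hN; have -> : h^-1 = N%:R / a by rewrite /h; field; rewrite !gt_eqF.
by rewrite mulrAC mulrC ler_pM2l ?invr_gt0.
Qed.

Lemma slope_cvg a : 0 < a ->
  cvg (s^-1 * (psi a - psi (a + s)) @[s --> 0^'+]).
Proof.
move=> a0; apply: nonincreasing_at_right_is_cvgr; near=> x.
  move=> s t; rewrite !in_itv/= => /andP[s0 _] /andP[t0 _] st.
  by apply: slope_nincr => //; exact: ltW.
exists (a^-1 * (psi 0 - psi a)) => _ [s /= + <-]; rewrite in_itv/= => /andP[s0 _].
exact: slope_le_initial.
Unshelve. all: by end_near. Qed.

End midpoint_convex.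

(** * Smoothing by the semigroup *)

Section L2_functions.
Context {R : realType} {d : nat}.
Local Notation Rd := 'rV[R]_d.
Local Notation mu := (@lebesgue_rV R d).
Local Notation L2 := (L2 R d).
Local Notation "'N2[ u ]" := ('N[mu]_2%:E[EFin \o u%R])%E (format "''N2[' u ]").
Implicit Types u v w : L2.

Lemma Lnorm2_sqr (f : Rd -> R) :
  ('N2[f] ^+ 2 = \int[mu]_x ((f x) ^+ 2)%:E)%E.
Proof.
have -> : ('N2[f] ^+ 2)%E = ('N2[f] `^ 2)%E.
  case: ('N2[f])%E (Lnorm_ge0 mu 2%:E (EFin \o f)) => [r||]//.
    by rewrite lee_fin => r0; rewrite -EFin_expe poweR_EFin powR_mulrn.
  by rewrite poweRyr// expe2 mulyy.
rewrite powR_Lnorm//; apply: eq_integral => x _ /=.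
by rewrite powR_mulrn// real_normK ?num_real.
Qed.

Lemma L2_int_mul u v : mu.-integrable setT (fun x => (u x * v x)%:E).
Proof.
apply/Lfun1_integrable.
by apply: (@Lfun2_mul_Lfun1 _ _ _ mu u v); exact: LfunP.
Qed.

Lemma L2_inner_ae (f f' g g' : Rd -> R) :
  measurable_fun setT f -> measurable_fun setT f' ->
  measurable_fun setT g -> measurable_fun setT g' ->
  f = f' %[ae mu] -> g = g' %[ae mu] -> L2_inner f g = L2_inner f' g'.
Proof.
move=> mf mf' mg mg' ff' gg'; congr fine; apply: ae_eq_integral => //.
- by apply/measurable_EFinP; exact: measurable_funM.
- by apply/measurable_EFinP; exact: measurable_funM.
by apply: filterS2 ff' gg' => x /= h1 h2 _; rewrite h1// h2.
Qed.

Lemma L2_measurable u : measurable_fun setT (u : Rd -> R).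
Proof. exact: measurable_funP. Qed.

Lemma L2_inner_sqr u : (L2_inner u u)%:E = ('N2[u] ^+ 2)%E.
Proof.
rewrite Lnorm2_sqr /L2_inner /Rintegral fineK.
  by apply: eq_integral => x _; rewrite expr2.
exact: integrable_fin_num (L2_int_mul u u).
Qed.

Lemma L2_inner_sqr_ge0 u : 0 <= L2_inner u u.
Proof. by apply: Rintegral_ge0 => x _; rewrite -expr2 sqr_ge0. Qed.

Lemma L2_innerC (f g : Rd -> R) : L2_inner f g = L2_inner g f.
Proof. by apply: eq_Rintegral => x _; rewrite mulrC. Qed.

Lemma L2_inner_le_mean u v :
  L2_inner u v <= (L2_inner u u + L2_inner v v) / 2.
Proof.
have iuu := L2_int_mul u u; have ivv := L2_int_mul v v; have iuv := L2_int_mul u v.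
have i2 : mu.-integrable setT (fun x => (u x * u x + v x * v x)%:E).
  under eq_fun do rewrite EFinD.
  exact: integrableD.
have i3 : mu.-integrable setT (fun x => (2 * (u x * v x))%:E).
  by under eq_fun do rewrite EFinM; exact: integrableZl.
rewrite ler_pdivlMr// mulrC -RintegralZl// -RintegralD//.
apply: le_Rintegral => // x _; have := sqr_ge0 (u x - v x); lra.
Qed.

Lemma L2_innerBl u v w : L2_inner (u \- v) w = L2_inner u w - L2_inner v w.
Proof.
have i1 := L2_int_mul u w; have i2 := L2_int_mul v w.
rewrite -RintegralB//; apply: eq_Rintegral => x _ /=; exact: mulrBl.
Qed.

End L2_functions.

Section smoothing.
Context {R : realType} {d : nat}.
Local Notation Rd := 'rV[R]_d.
Local Notation mu := (@lebesgue_rV R d).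
Local Notation L2 := (L2 R d).
Local Notation "'N2[ u ]" := ('N[mu]_2%:E[EFin \o u%R])%E (format "''N2[' u ]").
Variables (E : (Rd -> R) -> \bar R) (F : set L2) (P : R -> L2 -> L2).
Hypothesis P_assoc : associated_semigroup E F P.
Implicit Types u v : L2.

Let P_sg : symmetric_markov_semigroup P. Proof. by case: P_assoc. Qed.

(** By symmetry and the semigroup law it equals |P_(r/2) u|^2, from which come
    its monotonicity and its midpoint convexity. *)
Definition decay u (r : R) : R := L2_inner (P r u) u.

Lemma decayD u s t : 0 <= s -> 0 <= t ->
  decay u (s + t) = L2_inner (P s u) (P t u).
Proof.
move=> s0 t0; rewrite /decay.
rewrite (@L2_inner_ae _ _ _ (P s (P t u)) _ u) ?L2_measurable//.
- by rewrite (sg_symmetric P_sg)// L2_innerC.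
- exact: (sg_add P_sg).
- exact: ae_eq_refl.
Qed.

Lemma decay_double u s : 0 <= s -> decay u (2 * s) = L2_inner (P s u) (P s u).
Proof. by move=> s0; rewrite -decayD// mulr_natl. Qed.

Lemma L2_inner_contraction t u : 0 <= t ->
  L2_inner (P t u) (P t u) <= L2_inner u u.
Proof.
move=> t0; rewrite -lee_fin !L2_inner_sqr.
by rewrite lee_sqr ?Lnorm_ge0//; exact: (sg_contraction P_sg).
Qed.

Lemma decay_mid u a b : 0 <= a -> 0 <= b ->
  decay u ((a + b) / 2) <= (decay u a + decay u b) / 2.
Proof.
move=> a0 b0; have a20 : 0 <= a / 2 by lra.
have b20 : 0 <= b / 2 by lra.
have := L2_inner_le_mean (P (a / 2) u) (P (b / 2) u).
by rewrite -!decayD// -!splitr -mulrDl.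
Qed.

Lemma decay_nincr u a b : 0 <= a -> a <= b -> decay u b <= decay u a.
Proof.
move=> a0 ab; have a20 : 0 <= a / 2 by lra.
have h0 : 0 <= (b - a) / 2 by lra.
rewrite (_ : b = 2 * ((b - a) / 2 + a / 2)); last by lra.
rewrite [in leRHS](_ : a = 2 * (a / 2)); last by lra.
rewrite !decay_double ?addr_ge0//.
rewrite (@L2_inner_ae _ _ _ (P ((b - a) / 2) (P (a / 2) u)) _
  (P ((b - a) / 2) (P (a / 2) u))) ?L2_measurable//.
- exact: L2_inner_contraction.
- exact: (sg_add P_sg).
- exact: (sg_add P_sg).
Qed.

(** The approximate form of P_t u at s is the slope of decay u between 2 t and
    2 t + s. Slopes of a nonincreasing midpoint convex function increase as s
    decreases, and are bounded by the slope between 0 and 2 t, which is at most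
    |u|^2 / (2 t). *)
Lemma semigroup_energy t u : 0 < t ->
  F (P t u) /\ (E (P t u) <= ((2 * t)^-1 * L2_inner u u)%:E)%E.
Proof.
move=> t0; have [_ FP EP] := P_assoc.
have t20 : 0 < 2 * t by lra.
have approxE s : 0 < s -> approx_form P s (P t u) =
    s^-1 * (decay u (2 * t) - decay u (2 * t + s)).
  move=> s0; rewrite /approx_form L2_innerBl -decay_double ?(ltW t0)//; congr (_ * (_ - _)).
  have -> : 2 * t + s = (s + t) + t by lra.
  have st0 : 0 <= s + t by lra.
  rewrite (decayD _ st0 (ltW t0)).
  apply: L2_inner_ae; try exact: L2_measurable; last exact: ae_eq_refl.
  by apply: ae_eq_sym; apply: (sg_add P_sg); exact: ltW.
have near0 (Q : R -> Prop) : (forall s, 0 < s -> Q s) -> \forall s \near 0^'+, Q s.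
  by move=> hQ; apply: filterS hQ _; exact: nbhs_right_gt.
have Ft : F (P t u).
  apply/FP/cvg_ex.
  have /cvg_ex[l hl] := slope_cvg (@decay_nincr u) (@decay_mid u) t20.
  exists l; apply: cvg_trans hl.
  by apply: near_eq_cvg; apply: near0 => r r0; rewrite approxE.
split => //; have Ecvg := EP _ Ft.
rewrite -(cvg_lim _ Ecvg)//; apply: lime_le; first by apply/cvg_ex; eexists; exact: Ecvg.
apply: near0 => r r0; rewrite lee_fin approxE//.
apply: (le_trans (slope_le_initial (@decay_nincr u) (@decay_mid u) t20 r0)).
rewrite ler_pM2l ?invr_gt0//.
have -> : decay u 0 = L2_inner u u.
  apply: L2_inner_ae; try exact: L2_measurable; last exact: ae_eq_refl.
  exact: (sg_id P_sg).
by rewrite gerBl (decay_double _ (ltW t0)) L2_inner_sqr_ge0.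
Qed.

End smoothing.

(** * The Levy measure on the punctured ball *)

Section levy_restriction.
Context {R : realType} {n : nat}.
Local Notation Rd := 'rV[R]_n.
Local Notation mu := (@lebesgue_rV R n).

(** The center is removed because nu may have infinite mass there; it does not
    contribute to the Levy exponent. *)
Definition punctured_ball : set Rd := [set z | 0 < dotr z z < 1].

Lemma dotr_ge0 (z : Rd) : 0 <= dotr z z.
Proof. by apply: sumr_ge0 => i _; rewrite -expr2 sqr_ge0. Qed.

Lemma enorm_sqr (z : Rd) : enorm z ^+ 2 = dotr z z.
Proof. by rewrite sqr_sqrtr// dotr_ge0. Qed.

Lemma enorm_lt1 (z : Rd) : (enorm z < 1) = (dotr z z < 1).
Proof. by rewrite /enorm -[ltLHS]/(Num.sqrt _) -{1}sqrtr1 ltr_sqrt. Qed.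

Lemma normrV_le_enorm (z : Rd) : `|z| <= enorm z.
Proof.
rewrite -(@ler_pXn2r _ 2) ?nnegrE ?sqrtr_ge0// enorm_sqr.
exact: sqr_normrV_le_dotr.
Qed.

Lemma dotr_eq0 (z : Rd) : dotr z z <= 0 -> z = 0.
Proof.
move=> z0; apply/eqP; rewrite -normr_eq0 -sqrf_eq0 eq_le sqr_ge0 andbT.
exact: le_trans (sqr_normrV_le_dotr z) z0.
Qed.

Lemma measurable_punctured_ball : measurable punctured_ball.
Proof.
have -> : punctured_ball = (fun z => dotr z z) @^-1` `]0, 1[.
  by apply/seteqP; split => z /=; rewrite in_itv.
rewrite -[X in measurable X]setTI; apply: measurable_fun_dotr => //.
Qed.

Lemma punctured_ball_enorm z : punctured_ball z -> enorm z < 1.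
Proof. by move=> /andP[_]; rewrite enorm_lt1. Qed.

Lemma punctured_ball_normr z : punctured_ball z -> `|z| <= 1.
Proof.
move=> /punctured_ball_enorm z1.
by rewrite (le_trans (normrV_le_enorm z))// ltW.
Qed.

Lemma symbol_levy (nu nu' : {measure set Rd -> \bar R}) xi :
  (forall A, nu' A = nu (A `&` punctured_ball)) ->
  symbol nu' punctured_ball xi = levy_exponent nu xi.
Proof.
move=> nu'E; rewrite /symbol.
rewrite (eq_measure_integral nu) => [|A mA AD]; last by rewrite nu'E setIidl.
rewrite /levy_exponent integral_mkcond [RHS]integral_mkcond.
apply: eq_integral => z _; rewrite !patchE.
have [zD|zD] := boolP (z \in punctured_ball).
  by rewrite mem_set//=; apply: punctured_ball_enorm; rewrite inE in zD.
have [/set_mem /= z1|//] := boolP (z \in [set z | enorm z < 1]).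
have -> : z = 0.
  apply: dotr_eq0; rewrite leNgt; apply/negP => z0; move: zD; apply/negP/negPn.
  by rewrite inE /punctured_ball /= z0 -enorm_lt1.
by rewrite /dotr big1 ?cos0 ?subrr// => i _; rewrite mxE mul0r.
Qed.

(** nu is dominated by J(0, dy), to which the uniform bound applies. *)
Lemma levy_moment (J : R.-ker Rd ~> Rd) (nu : {measure set Rd -> \bar R}) :
  uniform_levy_bound J ->
  (forall (x : Rd) (A : set Rd), measurable A ->
    A `<=` [set z | enorm z < 1] -> (nu A <= J x [set (x + z)%R | z in A])%E) ->
  (\int[nu]_(z in punctured_ball) (`|z| ^+ 2)%:E < +oo)%E.
Proof.
move=> Jlevy Jnu; have mD := measurable_punctured_ball.
pose m : {measure set Rd -> \bar R} := mrestr nu mD.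
have mE A : m A = nu (A `&` punctured_ball) by [].
apply: (@le_lt_trans _ _ (\int[m]_(z in punctured_ball) (`|z| ^+ 2)%:E)%E).
  by rewrite (eq_measure_integral m)// => A mA AD; rewrite mE setIidl.
have tE (y : Rd) : trunc_sqdist 0 y = Num.min 1 (dotr y y).
  rewrite /trunc_sqdist enorm_sqr sub0r; congr Num.min.
  by apply: eq_bigr => i _; rewrite !mxE mulrNN.
have t0 (y : Rd) : (0 <= (trunc_sqdist 0 y)%:E)%E.
  by rewrite lee_fin tE le_min ler01 dotr_ge0.
pose I0 : \bar R := (\int[J 0%R]_y (trunc_sqdist 0 y)%:E)%E.
apply: (@le_lt_trans _ _ I0); last first.
  apply: le_lt_trans Jlevy; apply: ereal_sup_ubound => /=.
  by exists 0.
have mt : measurable_fun setT (fun y : Rd => (trunc_sqdist 0 y)%:E).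
  under eq_fun do rewrite tE; apply: measurable_fun_EFin.
  by apply: measurable_minr => //; exact: measurable_fun_dotr.
apply: le_trans (kernel_ge mD punctured_ball_enorm mE Jnu 0 mt t0).
rewrite integral_mkcond; apply: ge0_le_integralT => z.
  by rewrite patchE; case: ifP => // _; rewrite lee_fin sqr_ge0.
rewrite patchE add0r; case: ifPn => // /set_mem /andP[_ z1].
by rewrite lee_fin tE le_min (le_trans (sqr_normrV_le_dotr z)) ?sqr_normrV_le_dotr// ltW.
Qed.

Lemma smooth_cpt_supp_bcs (phi : Rd -> R) : smooth_cpt_supp phi ->
  continuous phi /\ bcs phi.
Proof.
move=> [phik cS].
have cphi : continuous phi by have [_ /(_ [::] isT)] := phik 0%N.
split=> //; split.
- exact: continuous_measurable_fun_rV.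
- have : bounded_set (phi @` closure [set x | phi x != 0]).
    apply: compact_bounded; apply: continuous_compact => //.
    exact: continuous_subspaceT.
  move=> /pinfty_ex_gt0[M M0 hM]; exists M => x.
  have [->|x0] := eqVneq (phi x) 0; first by rewrite normr0 ltW.
  by apply: hM; exists x => //; exact: subset_closure.
- have /pinfty_ex_gt0[M M0 hM] := compact_bounded cS.
  exists M => x Mx; apply/eqP; apply/negPn/negP => x0.
  have /hM : closure [set x | phi x != 0] x by exact: subset_closure.
  by rewrite /= leNgt Mx.
Qed.

End levy_restriction.

Section square_integrals.
Context {R : realType} {n : nat}.
Local Notation Rd := 'rV[R]_n.
Local Notation mu := (@lebesgue_rV R n).

Definition sqint (f : Rd -> R) : \bar R := (\int[mu]_x ((f x) ^+ 2)%:E)%E.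

Lemma sqint_ge0 f : (0 <= sqint f)%E.
Proof. by apply: integral_ge0 => x _; rewrite lee_fin sqr_ge0. Qed.

Lemma sqintB (f g : Rd -> R) : measurable_fun setT f -> measurable_fun setT g ->
  (sqint (fun x => (f x - g x)%R) <= 2%:E * sqint f + 2%:E * sqint g)%E.
Proof.
move=> mf mg.
have m2 (h : Rd -> R) : measurable_fun setT h ->
    measurable_fun setT (fun x => (h x ^+ 2)%:E).
  move=> mh; apply: measurable_fun_EFin; exact: measurable_funX.
have s0 (t : R) : (0 <= (t ^+ 2)%:E :> \bar R)%E by rewrite lee_fin sqr_ge0.
have m2f := m2 _ mf; have m2g := m2 _ mg.
have s2 (t : R) : (0 <= 2%:E * (t ^+ 2)%:E :> \bar R)%E by exact: mule_ge0.
have m22 (h : Rd -> R) : measurable_fun setT h ->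
    measurable_fun setT (fun x => 2%:E * (h x ^+ 2)%:E)%E.
  by move=> /m2 mh; exact: measurable_funeM.
have m2f' := m22 _ mf; have m2g' := m22 _ mg.
rewrite /sqint -!ge0_integralZl// -ge0_integralD//.
apply: ge0_le_integral => //.
- by apply: (m2 (fun x => f x - g x)); exact: measurable_funB.
- exact: emeasurable_funD.
move=> x _; rewrite -!EFinM -EFinD lee_fin.
by have := sqr_ge0 (f x + g x); lra.
Qed.

Lemma sqint_bcs (f : Rd -> R) : bcs f -> sqint f = (l2sq f)%:E.
Proof. by move=> bf; rewrite EFin_Int//; exact: bcs_sqr. Qed.

Lemma Lnorm2_le (f : Rd -> R) (c : R) : 0 <= c -> (sqint f <= (c ^+ 2)%:E)%E ->
  ('N[mu]_2%:E[EFin \o f] <= c%:E)%E.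
Proof.
move=> c0 fc; apply: lee_sqrE; first by rewrite lee_fin.
by rewrite Lnorm2_sqr -EFin_expe.
Qed.

Lemma sqint_le (f : Rd -> R) (c : R) : 0 <= c ->
  ('N[mu]_2%:E[EFin \o f] <= c%:E)%E -> (sqint f <= (c ^+ 2)%:E)%E.
Proof.
move=> c0 fc; rewrite /sqint -Lnorm2_sqr EFin_expe.
by rewrite lee_sqr ?lee_fin// Lnorm_ge0.
Qed.

End square_integrals.

(** * Compactness of the semigroup *)

Section form_control.
Context {R : realType} {n : nat}.
Local Notation Rd := 'rV[R]_n.
Local Notation mu := (@lebesgue_rV R n).
Variable W : Rd -> Rd -> R.
Hypothesis W_lower : forall lambda : R, 0 < lambda ->
  exists (V : Rd -> R) (R0 : R),
    [/\ (forall x, 0 < V x) /\ class_C 1 V, 0 < R0,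
        forall x y, enorm (x - y) < 1 -> V x + V y <= W x y,
        0 < inf (range V) &
        forall x, R0 <= enorm x -> V x = lambda * (1 + enorm x ^+ 2)].
Variable nu' : {sigma_finite_measure set Rd -> \bar R}.
Local Notation D := punctured_ball.

Lemma enormN (z : Rd) : enorm (- z) = enorm z.
Proof. by congr Num.sqrt; apply: eq_bigr => i _; rewrite !mxE mulrNN. Qed.

(** The two admissible weights come from V itself: W(x, x + z) >= V(x), which is
    at least inf V everywhere and at least lambda |x|^2 off a ball. *)
Lemma form_ctrl_bounds (lambda : R) : 0 < lambda -> exists c rho : R,
  [/\ 0 < c, 0 <= rho & forall (v : Rd -> R) e, bcs v -> form_ctrl W nu' D v e ->
  (\int[nu']_(z in D) (l2sq (fdiff z v))%:E <= (e / c)%:E)%E /\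
  (\int[nu']_(z in D) (\int[mu]_x (fdiff z v x ^+ 2 * hardy_weight rho x))%:E <=
    (e / lambda)%:E)%E].
Proof.
move=> l0; have [V [R0 [[V0 CV] R00 VW Vinf VE]]] := W_lower l0.
have VWz x z : enorm z < 1 -> V x <= W x (x + z).
  move=> z1; have : V x + V (x + z) <= W x (x + z).
    by apply: VW; rewrite opprD addrA subrr sub0r enormN.
  by apply: le_trans; rewrite lerDl ltW.
pose c := inf (range V).
have cV x : c <= V x.
  by apply: ge_inf; [exists 0 => _ [y _ <-]; exact: ltW|exists x].
have adm1 : admissible W (fun=> c).
  split => //; first by move=> x; exact: ltW.
  by move=> x z /(VWz x); apply: le_trans.
have adm2 : admissible W (fun x => lambda * hardy_weight R0 x).
  split => [|x|x z /(VWz x)].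
  - by apply: measurable_funM => //; exact: measurable_hardy_weight.
  - by rewrite mulr_ge0 ?hardy_weight_ge0// ltW.
  apply: le_trans; have [xR|Rx] := leP `|x| R0.
    by rewrite /hardy_weight cutoff1// subrr mul0r mulr0 ltW.
  rewrite VE; last by rewrite (le_trans (ltW Rx))// normrV_le_enorm.
  rewrite ler_pM2l// /hardy_weight enorm_sqr.
  apply: (@le_trans _ _ (`|x| ^+ 2)).
    by rewrite ler_piMl ?sqr_ge0// gerBl cutoff_ge0.
  by rewrite (le_trans (sqr_normrV_le_dotr x))// lerDr.
have mD := @measurable_punctured_ball R n.
exists c, R0; split => // [|v e bv ve]; first exact: ltW.
have scale (k : R) (I : Rd -> R) : 0 < k -> (forall z, 0 <= I z) ->
    measurable_fun setT (fun z => (I z)%:E) ->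
    (\int[nu']_(z in D) (k * I z)%:E <= e%:E)%E ->
    (\int[nu']_(z in D) (I z)%:E <= (e / k)%:E)%E.
  move=> k0 I0 mI; under eq_integral do rewrite EFinM.
  rewrite ge0_integralZl//; last 3 first.
  - exact: measurable_funTS.
  - by move=> z _; rewrite lee_fin.
  - by rewrite lee_fin ltW.
  move=> h; rewrite mulrC EFinM.
  have -> : (\int[nu']_(z in D) (I z)%:E =
      k^-1%:E * (k%:E * \int[nu']_(z in D) (I z)%:E))%E.
    by rewrite muleA -EFinM mulVf ?gt_eqF// mul1e.
  by apply: lee_wpmul2l => //; rewrite lee_fin invr_ge0 ltW.
split.
- apply: scale => //.
  + by move=> z; exact: l2sq_ge0.
  + by apply: measurable_fun_EFin; exact: measurable_l2sq_fdiff.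
  apply: le_trans (ve _ adm1); rewrite le_eqVlt; apply/orP; left; apply/eqP.
  apply: eq_integral => z _.
  have b2 := bcs_sqr (bcs_fdiff z bv).
  rewrite /l2sq -(IntZ _ b2) EFin_Int; last exact: bcsZ.
  by apply: eq_integral => x _; rewrite mulrC.
- apply: scale => //.
  + by move=> z; apply: Int_ge0 => x; rewrite mulr_ge0 ?sqr_ge0// hardy_weight_ge0.
  + exact: measurable_hardy_fdiff.
  apply: le_trans (ve _ adm2); rewrite le_eqVlt; apply/orP; left; apply/eqP.
  apply: eq_integral => z _.
  have b2 := bcs_hardy_fdiff R0 z bv.
  rewrite -(IntZ _ b2) EFin_Int; last exact: bcsZ.
  by apply: eq_integral => x _; rewrite mulrCA.
Qed.

Lemma form_ctrl_le v (a b : R) : a <= b -> form_ctrl W nu' D v a -> form_ctrl W nu' D v b.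
Proof. by move=> ab va g /va /le_trans; apply; rewrite lee_fin. Qed.

End form_control.

Lemma energy_ge0 (R : realType) (n : nat) (J : R.-ker 'rV[R]_n ~> 'rV[R]_n)
    (W : 'rV[R]_n -> 'rV[R]_n -> R) (u : 'rV[R]_n -> R) :
  (forall x y, 0 <= W x y) -> (0 <= energy J W u)%E.
Proof.
move=> W0; apply: integral_ge0 => x _; apply: integral_ge0 => y _.
by rewrite lee_fin mulr_ge0// sqr_ge0.
Qed.

Theorem theorem2p4 (R : realType) (d : nat) (d_gt0 : (0 < d)%N)
  (J : R.-ker 'rV[R]_d ~> 'rV[R]_d) (W : 'rV[R]_d -> 'rV[R]_d -> R)
  (P : R -> L2 R d -> L2 R d)
  (J_sym : symmetric_kernel J)
  (J_levy : uniform_levy_bound J)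
  (W_ge0 : forall x y, 0 <= W x y)
  (W_locbnd : locally_bounded W)
  (W_sym : forall x y, W x y = W y x)
  (W_meas : measurable_fun setT
     (fun p : 'rV[R]_d * 'rV[R]_d => W p.1 p.2))
  (WJ_L1loc : L1_loc (fun x : 'rV[R]_d =>
     \int[J x]_y (trunc_sqdist x y * W x y)%:E)%E)
  (P_assoc : associated_semigroup (energy J W) (form_domain J W) P)
  (W_lower : forall lambda : R, 0 < lambda ->
     exists (V : 'rV[R]_d -> R) (R0 : R),
       [/\ (forall x, 0 < V x) /\ class_C 1 V,
           0 < R0,
           forall x y, enorm (x - y) < 1 -> V x + V y <= W x y,
           0 < inf (range V) &
           forall x, R0 <= enorm x -> V x = lambda * (1 + enorm x ^+ 2)])
  (J_lower : exists nu : {measure set 'rV[R]_d -> \bar R},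
     [/\ forall (x : 'rV[R]_d) (A : set 'rV[R]_d), measurable A ->
           A `<=` [set z | enorm z < 1] ->
           (nu A <= J x [set (x + z)%R | z in A])%E,
         forall A : set 'rV[R]_d, measurable A ->
           A `<=` [set z | enorm z < 1] -> nu A = nu [set z | A (- z)],
         forall r : R, 0 < r -> (beta0 nu r < +oo)%E &
         forall r : R, 0 < r ->
           (\int[lebesgue_measure]_(s in `[r, +oo[)
              (beta0_inv nu s / s)%:E < +oo)%E]) :
  forall t : R, 0 < t -> compact_operator (P t).
Proof.
move=> t t0 u_ [M0 uM0].
pose M := `|M0|.
have uM k : ('N[@lebesgue_rV R d]_2%:E[EFin \o u_ k] <= M%:E)%E.
  by rewrite (le_trans (uM0 k))// lee_fin ler_norm.
have [nu [J_nu _ beta_fin _]] := J_lower.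
pose D := @punctured_ball R d.
have mD : measurable D := measurable_punctured_ball.
have D0 : ~ D 0.
  by rewrite /D /punctured_ball /= /dotr big1 ?ltxx// => i _; rewrite mxE mul0r.
have momD := levy_moment J_levy J_nu.
have [nu' nu'E] := restriction_sigma_finite mD D0 momD.
have [sig sigE] : exists sig : R, (\int[nu']_(z in D) (`|z| ^+ 2)%:E = sig%:E)%E.
  have mom : (\int[nu']_(z in D) (`|z| ^+ 2)%:E = \int[nu]_(z in D) (`|z| ^+ 2)%:E)%E.
    apply: eq_measure_integral => A mA AD.
    by transitivity (nu (A `&` D)); [exact: nu'E|rewrite setIidl].
  rewrite mom; exists (fine (\int[nu]_(z in D) (`|z| ^+ 2)%:E)%E).
  rewrite fineK// ge0_fin_numE; first exact: momD.
  by apply: integral_ge0 => z _; rewrite lee_fin sqr_ge0.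
have beta1 : (\int[@lebesgue_rV R d]_xi expeR (- symbol nu' D xi) < +oo)%E.
  have := beta_fin 1 ltr01; rewrite /beta0; congr (_ < _)%E.
  by apply: eq_integral => xi _; rewrite mul1e (symbol_levy xi nu'E).
have sinf := symbol_infty mD sigE beta1.
have sig0 := sig_gt0 d_gt0 mD sigE beta1.
have D1 z : D z -> `|z| <= 1 by exact: punctured_ball_normr.
have ctrlP := form_ctrl_bounds W_lower nu'.
have ctrl_energy (v : 'rV[R]_d -> R) e : measurable_fun setT v ->
    (energy J W v <= e%:E)%E -> form_ctrl W nu' D v e.
  move=> mv ve g ag; apply: le_trans ve.
  exact: (weighted_form_le_energy mD (@punctured_ball_enorm R d) nu'E W_ge0 W_meas J_nu ag mv).
pose v k := P t (u_ k).
pose M1 := (2 * t)^-1 * M ^+ 2.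
have vF k : form_domain J W (v k) /\ (energy J W (v k) <= M1%:E)%E.
  have [h1 h2] := semigroup_energy P_assoc (u_ k) t0; split => //.
  apply: le_trans h2 _; rewrite lee_fin ler_wpM2l// ?invr_ge0; first by lra.
  rewrite -lee_fin L2_inner_sqr EFin_expe.
  by rewrite lee_sqr ?Lnorm_ge0 ?lee_fin ?normr_ge0 ?uM.
have mv k : measurable_fun setT (v k : 'rV[R]_d -> R) by exact: L2_measurable.
have vM k : (sqint (v k) <= (M ^+ 2)%:E)%E.
  apply: sqint_le; first exact: normr_ge0.
  apply: le_trans (uM k).
  have [sgP _ _] := P_assoc; exact: (sg_contraction sgP _ (ltW t0)).
(* test functions approach v k at the speed needed to transfer the Cauchy
   estimate with ratio 1 / 4 for squares *)
pose e k : R := 2^-1 ^+ k.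
have e0 k : 0 < e k by rewrite exprn_gt0// invr_gt0.
have e2 k : e k ^+ 2 = 4^-1 ^+ k.
  by rewrite /e -exprM mulnC exprM; congr (_ ^+ _); lra.
have e21 k : e k ^+ 2 <= 1 by rewrite e2 exprn_ile1// ?invr_ge0// invf_le1// ler1n.
have /choice[phi phiP] k : exists f, smooth_cpt_supp f /\
    (E1_norm J W (v k \- f)%R < (e k)%:E)%E.
  by have [_ /(_ _ (e0 k))[f sf fe]] := (vF k).1; exists f.
have cphi k : continuous (phi k) := (smooth_cpt_supp_bcs (phiP k).1).1.
have bphi k : bcs (phi k) := (smooth_cpt_supp_bcs (phiP k).1).2.
have mphi k : measurable_fun setT (phi k) by have [] := bphi k.
have mvphi k : measurable_fun setT (fun x => v k x - phi k x) by exact: measurable_funB.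
have close k : (energy J W (fun x => v k x - phi k x)%R <= (e k ^+ 2)%:E)%E /\
    (sqint (fun x => v k x - phi k x)%R <= (e k ^+ 2)%:E)%E.
  have := (phiP k).2; rewrite /E1_norm.
  set En := energy J W _; rewrite Lnorm2_sqr; set S := (\int[_]_x _)%E => h.
  have En0 : (0 <= En)%E by exact: energy_ge0.
  have S0 : (0 <= S)%E by exact: sqint_ge0.
  have : (En + S <= (e k ^+ 2)%:E)%E.
    have ES0 : (0 <= En + S)%E by exact: adde_ge0.
    rewrite -(sqr_sqrte ES0) EFin_expe lee_sqr; first exact: ltW.
      exact: sqrte_ge0.
    by rewrite lee_fin ltW.
  by move=> ES; split; apply: le_trans ES; [rewrite leeDl|rewrite leeDr].
have phiE k : phi k = (fun x => v k x - (v k x - phi k x)).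
  by apply/funext => x; ring.
(* B bounds the square norms of the phi k as well as the forms of their
   differences; hence the sum *)
pose B := (2 * M ^+ 2 + 2) + 2 * (2 * M1 + 2) + 2 * (2 * M1 + 2).
have M10 : 0 <= M1 by rewrite mulr_ge0 ?sqr_ge0// invr_ge0; lra.
have M20 : 0 <= M ^+ 2 by exact: sqr_ge0.
have phiL k : l2sq (phi k) <= B.
  rewrite -lee_fin -sqint_bcs// {1}phiE (le_trans (sqintB (mv k) (mvphi k)))//.
  apply: (@le_trans _ _ (2%:E * (M ^+ 2)%:E + 2%:E * (e k ^+ 2)%:E)%E).
    by apply: leeD; apply: lee_wpmul2l => //; exact: (close k).2.
  by rewrite -!EFinM -EFinD lee_fin /B; have := e21 k; lra.
have phiC k : form_ctrl W nu' D (phi k) (2 * M1 + 2).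
  rewrite phiE; apply: (@form_ctrl_le _ _ _ _ _ (2 * M1 + 2 * e k ^+ 2)).
    by have := e21 k; lra.
  apply: form_ctrlB => //; apply: ctrl_energy => //; first exact: (vF k).2.
  exact: (close k).1.
have phiCB i j : form_ctrl W nu' D (fun x => phi i x - phi j x) B.
  apply: (@form_ctrl_le _ _ _ _ _ (2 * (2 * M1 + 2) + 2 * (2 * M1 + 2))).
    by rewrite /B; lra.
  exact: form_ctrlB.
have [s [sm sC]] := cauchy_subsequence
  (finite_rank_control d_gt0 mD D1 sinf sig0 sigE ctrlP) cphi bphi phiL phiCB.
have sge k : (k <= s k)%N.
  by elim: k => // k ih; rewrite (leq_ltn_trans ih)// sm.
have [g mg gC] := @L2_complete _ _ R (@lebesgue_rV R d) (fun k => phi (s k))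
  (fun k => mphi (s k)) (fun k i j ki kj => ltac:(
     by rewrite -[X in (X <= _)%E]/(sqint (fun x => phi (s i) x - phi (s j) x)%R)
          sqint_bcs ?lee_fin; [exact: sC|exact: bcsB])).
have close_g k : (sqint (fun x => v (s k) x - g x)%R <= ((2 * e k) ^+ 2)%:E)%E.
  have -> : (fun x => v (s k) x - g x) =
      (fun x => (v (s k) x - phi (s k) x) - (g x - phi (s k) x)).
    by apply/funext => x; ring.
  have mgphi : measurable_fun setT (fun x => g x - phi (s k) x) by exact: measurable_funB.
  rewrite (le_trans (sqintB (mvphi _) mgphi))//.
  apply: (@le_trans _ _ (2%:E * (e k ^+ 2)%:E + 2%:E * (e k ^+ 2)%:E)%E).
    apply: leeD; apply: lee_wpmul2l => //.
      apply: le_trans (close (s k)).2 _; rewrite lee_fin !e2.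
      by apply: ler_wiXn2l => //; lra.
    rewrite e2; apply: le_trans (gC k); rewrite le_eqVlt; apply/orP; left; apply/eqP.
    by apply: eq_integral => x _; congr EFin; ring.
  by rewrite -!EFinM -EFinD lee_fin; lra.
have gfin : finite_norm (@lebesgue_rV R d) 2%:E g.
  have h : (sqint g <= (2 * M ^+ 2 + 8)%:E)%E.
    have -> : g = (fun x => v (s 0%N) x - (v (s 0%N) x - g x)).
      by apply/funext => x; ring.
    have mvg : measurable_fun setT (fun x => v (s 0%N) x - g x) by exact: measurable_funB.
    rewrite (le_trans (sqintB (mv _) mvg))//.
    apply: (@le_trans _ _ (2%:E * (M ^+ 2)%:E + 2%:E * ((2 * e 0%N) ^+ 2)%:E)%E).
      by apply: leeD; apply: lee_wpmul2l => //; exact: close_g.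
    by rewrite -!EFinM -EFinD lee_fin /e expr0; lra.
  have : (sqint g < +oo)%E by rewrite (le_lt_trans h)// ltry.
  rewrite /sqint -Lnorm2_sqr expe2 /finite_norm.
  by case: ('N[_]_2%:E[_])%E => [r||//]; rewrite ?ltry// mulyy.
have gL : g \in Lfun (@lebesgue_rV R d) 2%:E.
  by rewrite inE; apply/andP; split; rewrite inE.
exists s; split => //.
exists (Lfun_Sub (lee1n 2) gL).
have N2le k : ('N[@lebesgue_rV R d]_2%:E[EFin \o (v (s k) \- g)%R] <= (2 * e k)%:E)%E.
  by apply: Lnorm2_le; [rewrite mulr_ge0// ltW|exact: close_g].
apply: (@squeeze_cvge _ _ _ _ (cst 0%E) _ (fun k => (2 * e k)%:E)).
- by apply: nearW => k; rewrite Lnorm_ge0 N2le.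
- exact: cvg_cst.
- apply: cvg_EFin; first exact: nearW.
  have h : e k @[k --> \oo] --> (0 : R).
    by apply: cvg_expr; rewrite ger0_norm ?invr_ge0// invf_lt1// ltr1n.
  have := cvgM (cvg_cst (2 : R)) h; rewrite mulr0; exact.
Qed.
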